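(* Assume that for some $\alpha\in(0,1]$ the following holds. (i) There exist a function $\bar\varphi(t,s)$, constants $a^2$ and $b$ and a remainder $\mathscr R^1_\varepsilon(t,s)$ (depending on $T_n$) such that for $s,t\in[0,1]$ $$\mathrm{Cov}(X_{T_n+\varepsilon t}-X_{T_n},X_{T_n+\varepsilon s}-X_{T_n})=\varepsilon^2\big[a^2ts+b(t^2s+ts^2)\varepsilon+\bar\varphi(t,s)\varepsilon^{1+\alpha}+\mathscr R^1_\varepsilon(t,s)\big],\qquad\lim_{\varepsilon\to0}\sup_{s,t\in[0,1]}\frac{|\mathscr R^1_\varepsilon(t,s)|}{\varepsilon^{1+\alpha}}=0.$$ (ii) For every fixed $T>0$ there exist a function $\bar\psi(t;T)$, constants $c(T)$ and $d(T)$ and a remainder $\mathscr R^2_\varepsilon(t;T)$ (depending on $T_n$) such that for $t\in[0,1]$ $$k(T_n+\varepsilon t,T)-k(T_n,T)=\varepsilon\big[c(T)t+d(T)t^2\varepsilon+\bar\psi(t;T)\varepsilon^{1+\alpha}+\mathscr R^2_\varepsilon(t;T)\big],\qquad\lim_{\varepsilon\to0}\sup_{t\in[0,1]}\frac{|\mathscr R^2_\varepsilon(t;T)|}{\varepsilon^{1+\alpha}}=0.$$ Let $Y^n$ be the bridge of the $n$-fold conditional process $X^n$ with final value $y$ at time $T_n+\varepsilon$. Then the family of processes $\{(Y^n_{T_n+\varepsilon t})_{t\in[0,1]}\}_\varepsilon$ satisfies a large deviation principle on $C([0,1])$ as $\varepsilon\to0$, with inverse speed $\varepsilon^{3+\alpha}$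 and good rate function $$J_Y(h)=\begin{cases}\frac12\|h-\bar m\|^2_{\bar{\mathscr H}_Y}&\text{if }h-\bar m\in\bar{\mathscr H}_Y,\\+\infty&\text{otherwise,}\end{cases}$$ where $\bar m_t=x_n+\bar\beta_t(y-x_n)$ and $\bar{\mathscr H}_Y$ is the reproducing kernel Hilbert space associated to the covariance function $$\bar k_Y(t,s)=\begin{cases}\bar\varphi_n(t,s)+ts\,\bar\varphi_n(1,1)-t\,\bar\varphi_n(1,s)-s\,\bar\varphi_n(t,1)&\text{if }\alpha<1,\\[2pt]b_n^2\,(ts^2+t^2s-t^2s^2-st)+\bar\varphi_n(t,s)+ts\,\bar\varphi_n(1,1)-t\,\bar\varphi_n(1,s)-s\,\bar\varphi_n(t,1)&\text{if }\alpha=1.\end{cases}$$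
   Context: Let $X=(X_t)_{t\ge0}$ be a continuous centered Gaussian process with continuous covariance function $k(t,s)=\mathrm{Cov}(X_t,X_s)$. Fix $n\in\mathbb N$, $n\ge1$, times $0<T_1<\dots<T_n$ and real numbers $x_1,\dots,x_n$, $y$. Set $X^0=X$, $k_0=k$ and, for $j=1,\dots,n$, $$\alpha_j(t)=\frac{k_{j-1}(t,T_j)}{k_{j-1}(T_j,T_j)},\qquad X^j_t=X^{j-1}_t-\alpha_j(t)(X^{j-1}_{T_j}-x_j),\qquad k_j(t,s)=k_{j-1}(t,s)-\alpha_j(t)k_{j-1}(s,T_j).$$ Then $k_j$ is the covariance function of $X^j$, and $X^n$ (the $n$-fold conditional process) has the law of $X$ conditioned on $X_{T_1}=x_1,\dots,X_{T_n}=x_n$. The bridge $Y^n$ (which depends on $\varepsilon$) is $X^n$ conditioned to be at $y$ at time $T_n+\varepsilon$; in law, $$Y^n_{T_n+\varepsilon t}=X^n_{T_n+\varepsilon t}-\beta^\varepsilon_{T_n+\varepsilon t}(X^n_{T_n+\varepsilon}-y),\qquad \beta^\varepsilon_{T_n+\varepsilon t}=\frac{k_n(T_n+\varepsilon t,T_n+\varepsilon)}{k_n(T_n+\varepsilon,T_n+\varepsilon)},\quad t\in[0,1],$$ and $\bar\beta_t=\lim_{\varepsilon\to0}\beta^\varepsilon_{T_n+\varepsilon t}=\bar k_n(t,1)/\bar k_n(1,1)$, where $\bar k_n(t,s)=\lim_{\varepsilon\to0}\varepsilon^{-2}k_n(T_n+\varepsilon t,T_n+\varepsilon s)$. Set $c_0=c$,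 $d_0=d$, $\bar\psi_0=\bar\psi$ and, for $j=1,\dots,n$, $c_j(T)=c_{j-1}(T)-\alpha_j(T)c_{j-1}(T_j)$, $d_j(T)=d_{j-1}(T)-\alpha_j(T)d_{j-1}(T_j)$, $\bar\psi_j(t;T)=\bar\psi_{j-1}(t;T)-\alpha_j(T)\bar\psi_{j-1}(t;T_j)$. Set $$b_n=b-\sum_{\ell=1}^n\frac{c_{\ell-1}(T_\ell)d_{\ell-1}(T_\ell)}{k_{\ell-1}(T_\ell,T_\ell)},$$ $$\bar\varphi_n(t,s)=\bar\varphi(t,s)-\sum_{\ell=1}^n\frac{c_{\ell-1}(T_\ell)}{k_{\ell-1}(T_\ell,T_\ell)}\big(\bar\psi_{\ell-1}(t;T_\ell)\,s+\bar\psi_{\ell-1}(s;T_\ell)\,t\big)\quad\text{if }\alpha<1,$$ while if $\alpha=1$ one subtracts in addition $\sum_{\ell=1}^n\frac{d_{\ell-1}^2(T_\ell)}{k_{\ell-1}(T_\ell,T_\ell)}t^2s^2$ from the right-hand side. $C([0,1])$ is the space of continuous real paths on $[0,1]$ with the sup-norm. A family $\{U^\varepsilon\}_\varepsilon$ of $C([0,1])$-valued random variables satisfies a large deviation principle with inverse speed $\gamma_\varepsilon^2$ and good rate function $I$ if $\gamma_\varepsilon\to0$, the set $\{I\le r\}$ is compact for every real $r$, $\liminf_{\varepsilon\to0}\gamma_\varepsilon^2\log\mathbb P(U^\varepsilon\in G)\ge-\inf_GI$ for every open $G$, and $\limsup_{\varepsilon\to0}\gamma_\varepsilon^2\log\mathbb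 P(U^\varepsilon\in F)\le-\inf_FI$ for every closed $F$. The reproducing kernel Hilbert space of a continuous, symmetric, positive definite (i.e. covariance) function $q$ on $[0,1]^2$ is the completion, inside $C([0,1])$, of the set of paths $h_t=\int_0^1q(t,s)\lambda(ds)$, $\lambda$ a signed Borel measure on $[0,1]$, with respect to the norm given by $\|h\|^2=\int_0^1\int_0^1q(t,s)\lambda(dt)\lambda(ds)$.
   Formalization: For α=1 the coefficient b_n² in k̄_Y is replaced by b_n²/k̄_n(1,1), since the printed formula is false unless k̄_n(1,1)=1 or b_n=0; the denominators k_{j-1}(T_j,T_j) and k̄_n(1,1) are explicitly assumed nonzero. *)

(* Defs.v *)
From HB Require Import structures.
From mathcomp Require Import all_boot all_order all_algebra.
From mathcomp Require Import all_classical all_reals all_analysis.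

Set Implicit Arguments.
Unset Strict Implicit.
Unset Printing Implicit Defensive.

Import Order.TTheory GRing.Theory Num.Theory.
Import numFieldNormedType.Exports.

Local Open Scope classical_set_scope.
Local Open Scope ring_scope.

Definition I01 (R : realType) : topologicalType :=
  set_type (`[0, 1]%classic : set R).

(* Continuous functions on the subtype [0,1] with the topology of uniform
   convergence, i.e. that of the sup-norm. *)
Definition C01 (R : realType) : uniformType :=
  initial_topology
    (fun f : continuousType (I01 R) R =>
       (f : I01 R -> R) : arrow_uniform_type (I01 R) R).

Definition ev (R : realType) (h : C01 R) : I01 R -> R :=
  (h : continuousType (I01 R) R).

(* Large deviations as epsilon -> 0+; [v e] stands for gamma_e ^ 2. *)

Section large_deviations.
Context d (Omega : measurableType d) (R : realType) (P : probability Omega R).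
Context (E : topologicalType).

Definition good_rate_function (I : E -> \bar R) :=
  (forall x, (0 <= I x)%E) /\
  (forall r : R, compact [set x | (I x <= r%:E)%E]).

Definition LDP (U : R -> Omega -> E) (v : R -> R) (I : E -> \bar R) :=
  [/\ (* each U e is a random variable for the Borel sigma-algebra of E *)
      forall e, 0 < e -> forall G : set E, open G -> measurable (U e @^-1` G),
      v e @[e --> 0^'+] --> 0,
      good_rate_function I,
      forall G : set E, open G ->
        (limf_einf (fun e => (v e)%:E * lne (P (U e @^-1` G))) 0^'+
         >= - ereal_inf (I @` G))%E
    & forall F : set E, closed F ->
        (limf_esup (fun e => (v e)%:E * lne (P (U e @^-1` F))) 0^'+
         <= - ereal_inf (I @` F))%E].

End large_deviations.

Section charge_integral.
Context d (T : measurableType d) (R : realType).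
Implicit Types lam : {charge set T -> \bar R}.

Lemma hahn_ex lam :
  exists PN : set T * set T, hahn_decomposition lam PN.1 PN.2.
Proof. by have [A [B AB]] := Hahn_decomposition lam; exists (A, B). Qed.

Definition hahnP lam := projT2 (cid (hahn_ex lam)).

(* Integral against a signed measure through its Jordan decomposition; the
   value does not depend on the chosen Hahn decomposition. *)
Definition charge_integral lam (D : set T) (f : T -> R) : R :=
  Rintegral (jordan_pos (hahnP lam)) D f -
  Rintegral (jordan_neg (hahnP lam)) D f.

End charge_integral.

Section rkhs.
Context (R : realType) (q : R -> R -> R).
(* A signed Borel measure on [0,1] is represented by one on the line, which is
   only ever integrated over [0,1]. *)

Definition kernel_path (lam : {charge set R -> \bar R}) : I01 R -> R :=
  fun t => charge_integral lam `[0, 1] (fun s => q (val t) s).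

Definition kernel_norm (lam : {charge set R -> \bar R}) : R :=
  Num.sqrt (charge_integral lam `[0, 1]
    (fun t => charge_integral lam `[0, 1] (fun s => q t s))).

(* The completion inside C([0,1]) is made of the uniform limits [h] of sequences
   of kernel paths that are Cauchy for [kernel_norm], with norm the limit of
   the norms. *)
Definition rkhs_approx (lam : nat -> {charge set R -> \bar R})
    (h : I01 R -> R) :=
  (forall e : R, 0 < e -> exists N : nat, forall i j : nat,
     (N <= i)%N -> (N <= j)%N ->
     kernel_norm (cadd (lam i) (cscale (-1) (lam j))) < e) /\
  {uniform, (fun i : nat => kernel_path (lam i)) @ \oo --> h}.

Definition rkhs : set (I01 R -> R) := [set h | exists lam, rkhs_approx lam h].

Definition rkhs_norm (h : I01 R -> R) : R :=
  get [set r : R | exists2 lam, rkhs_approx lam h &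
                   kernel_norm (lam i) @[i --> \oo] --> r].

Definition rkhs_rate (m : I01 R -> R) (h : C01 R) : \bar R :=
  let g := fun t => ev h t - m t in
  if `[< rkhs g >] then (2^-1 * rkhs_norm g ^+ 2)%:E else +oo%E.

End rkhs.

(* The library's [normal_prob m 0] is not the Dirac mass. *)
Definition gaussian (R : realType) (m s : R) (A : set R) : \bar R :=
  if s == 0 then \d_m A else normal_prob m s A.

Section gaussian_process.
Context d (Omega : measurableType d) (R : realType) (P : probability Omega R).

Definition gaussian_process (X : R -> {RV P >-> R}) :=
  forall (N : nat) (t a : 'I_N -> R), (forall i, 0 <= t i) ->
  exists m s : R, forall A : set R, measurable A ->
    P ((fun w => \sum_(i < N) a i * X (t i) w) @^-1` A) = gaussian m s A.

Definition continuous_centered_gaussian_process (X : R -> {RV P >-> R})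
    (k : R -> R -> R) :=
  [/\ gaussian_process X,
      forall t, 0 <= t -> ('E_P[X t] = 0)%E,
      forall w, {within `[0, +oo[, continuous (fun t => X t w)},
      forall t s, 0 <= t -> 0 <= s -> covariance P (X t) (X s) = (k t s)%:E
    & {within `[0, +oo[ `*` `[0, +oo[,
         continuous (fun ts : R * R => k ts.1 ts.2)}].

End gaussian_process.

(* Only the entries 1, ..., n of the sequences [T] of times and [x] of values
   are used. *)

Section conditioning.
Context (R : realType) (k : R -> R -> R) (T : nat -> R).

Fixpoint cond_cov (j : nat) : R -> R -> R :=
  if j is i.+1 then
    fun t s => cond_cov i t s -
      cond_cov i t (T i.+1) / cond_cov i (T i.+1) (T i.+1) *
      cond_cov i s (T i.+1)
  else k.

Definition cond_alpha (j : nat) (t : R) : R :=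
  cond_cov j.-1 t (T j) / cond_cov j.-1 (T j) (T j).

Fixpoint cond_proc (Omega : Type) (X : R -> Omega -> R) (x : nat -> R) (j : nat)
    : R -> Omega -> R :=
  if j is i.+1 then
    fun t w => cond_proc X x i t w -
      cond_alpha i.+1 t * (cond_proc X x i (T i.+1) w - x i.+1)
  else X.

(* The recursion shared by c_j, d_j and bar psi_j (t; .). *)
Fixpoint cond_coef (g : R -> R) (j : nat) : R -> R :=
  if j is i.+1 then
    fun S => cond_coef g i S - cond_alpha i.+1 S * cond_coef g i (T i.+1)
  else g.

Context (n : nat).

Definition bar_k (t s : R) : R :=
  lim (cond_cov n (T n + e * t) (T n + e * s) / e ^+ 2 @[e --> 0^'+]).

(* [beta e t] and [bar_beta t] are the values at the time T n + e * t. *)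
Definition beta (e t : R) : R :=
  cond_cov n (T n + e * t) (T n + e) / cond_cov n (T n + e) (T n + e).

Definition bar_beta (t : R) : R := lim (beta e t @[e --> 0^'+]).

Definition bridge (Omega : Type) (X : R -> Omega -> R) (x : nat -> R) (y : R)
    (e t : R) (w : Omega) : R :=
  cond_proc X x n (T n + e * t) w -
  beta e t * (cond_proc X x n (T n + e) w - y).

Definition bar_m (x : nat -> R) (y t : R) : R := x n + bar_beta t * (y - x n).

Context (alpha b : R) (phi : R -> R -> R) (c dd : R -> R) (psi : R -> R -> R).

Definition b_cond : R :=
  b - \sum_(1 <= l < n.+1)
        cond_coef c l.-1 (T l) * cond_coef dd l.-1 (T l) /
        cond_cov l.-1 (T l) (T l).

Definition phi_cond (t s : R) : R :=
  phi t s -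
  \sum_(1 <= l < n.+1)
    cond_coef c l.-1 (T l) / cond_cov l.-1 (T l) (T l) *
    (cond_coef (psi t) l.-1 (T l) * s + cond_coef (psi s) l.-1 (T l) * t) -
  (if alpha == 1 then
     \sum_(1 <= l < n.+1)
       cond_coef dd l.-1 (T l) ^+ 2 / cond_cov l.-1 (T l) (T l) *
       (t ^+ 2 * s ^+ 2)
   else 0).

(* The bridge has covariance k_n(t,s) - k_n(t,1) k_n(s,1) / k_n(1,1) in the
   rescaled times. For alpha = 1 the last term contributes, at order e ^ 4,
   b_n ^ 2 * (t ^ 2 - t) * (s ^ 2 - s) divided by the leading coefficient
   bar_k 1 1 of k_n(1,1). The source prints the b_n ^ 2 term without this
   division, which is correct only if bar_k 1 1 = 1 or b_n = 0. *)
Definition bar_kY (t s : R) : R :=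
  (if alpha == 1 then
     b_cond ^+ 2 / bar_k 1 1 *
     (t * s ^+ 2 + t ^+ 2 * s - t ^+ 2 * s ^+ 2 - s * t)
   else 0) +
  (phi_cond t s + t * s * phi_cond 1 1 - t * phi_cond 1 s - s * phi_cond t 1).

End conditioning.

(* Main.v *)
(* A large deviation principle for Gaussian paths in C([0,1]) follows from the
   uniform convergence of the rescaled covariances v^-1 K_e to K, and of the
   means. The rate is handled as a Legendre transform over discrete measures mu,
     I(g) = sup_mu (mu(g) - K(mu,mu) / 2),
   a near maximizer mu giving g ~ K mu and |mu|^2 / 2 ~ I(g).
   Upper bound: the Gaussian concentration inequality (Maurey-Pisier rotation)
   applied to small increments makes the values on a fine grid decisive up to
   events of probability exp(-C/v) with C arbitrarily large, and on the grid
   finitely many Chernoff half-spaces suffice. Lower bound: tilting by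
   exp(mu(Z)/v), which only involves the exponential moments of Z and a
   Cauchy-Schwarz inequality for the oscillations.
   Riemann sums turn signed measures into discrete ones and identify I with half
   the squared norm of the reproducing kernel Hilbert space.
   For the bridge, k_n(T_n + e t, T_n + e s) = e^2 (A t s + b_n (t^2 s + t s^2) e +
   phi_n(t,s) e^(1+alpha) + ...) with A <> 0, and in
   k_n(t,s) - k_n(t,1) k_n(1,s) / k_n(1,1) the two leading orders cancel, leaving
   e^(3+alpha) bar_kY(t,s) (for alpha = 1 the term in b_n^2 / A survives). *)

Require Import Defs.
From HB Require Import structures.
From mathcomp Require Import all_boot all_order all_algebra.
From mathcomp Require Import all_classical all_reals all_analysis.
From mathcomp Require Import measurable_realfun ring lra.

Set Implicit Arguments.
Unset Strict Implicit.
Unset Printing Implicit Defensive.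

Import Order.TTheory GRing.Theory Num.Theory.
Import numFieldNormedType.Exports.

Local Open Scope classical_set_scope.
Local Open Scope ring_scope.

(** * Centered Gaussian variables *)

(** A Gaussian process is given only through one-dimensional laws of linear combinations, whereas
    rotating two independent copies requires a joint law. Hence the detour through a uniqueness
    theorem: the law of a vector is determined by the integrals of cosines of linear forms, proved
    with an algebra of real multipliers instead of Fourier inversion. Concentration is used around
    an event of probability at least one half on which the whole path is small, not around an
    expected supremum. For the bridge such an event is cheap: X^n has continuous paths and is
    deterministic at T_n. As the constants do not depend on the size of the family, the bound
    reaches all pairs of rational times without chaining or entropy estimates. No regularity of
    [phi], [psi] or of the limit kernel is assumed. Boundedness, symmetry, uniform continuity and
    positivity of that kernel are inherited from genuine covariances at small epsilon, because the
    expansion is uniform. The limit kernel may be degenerate and the Legendre supremum need not be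
    attained, so quantitative near maximizers take the place of Riesz representatives. *)

Section density.
Context d (T : measurableType d) (R : realType).
Variables (nu : {finite_measure set T -> \bar R})
          (mu : {sigma_finite_measure set T -> \bar R}) (g : T -> \bar R).
Hypothesis ig : mu.-integrable setT g.
Hypothesis nug : forall A, measurable A -> nu A = (\int[mu]_(x in A) g x)%E.

Lemma density_dominates : nu `<< mu.
Proof.
apply/null_content_dominatesP => A mA muA0; rewrite nug//.
apply: null_set_integral => //.
exact: measurable_funTS (measurable_int _ ig).
Qed.

(** The change of variables holds for the Radon-Nikodym derivative, which equals [g] almost
    everywhere because both have integral [nu A] over every measurable [A]. *)
Lemma ge0_integral_density (f : T -> \bar R) : (forall x, 0 <= f x)%E ->
  measurable_fun setT f ->
  (\int[nu]_x f x = \int[mu]_x (f x * g x))%E.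
Proof.
move=> f0 mf; rewrite -(Radon_Nikodym_SigmaFinite.change_of_variables density_dominates)//.
have ir := Radon_Nikodym_SigmaFinite.f_integrable density_dominates.
apply: ae_eq_integral => //.
- by apply: emeasurable_funM => //; exact: measurable_int ir.
- by apply: emeasurable_funM => //; exact: measurable_int ig.
- apply: ae_eqe_mul2l; apply: integral_ae_eq => //.
    exact: measurable_int ig.
  move=> E _ mE; rewrite -nug//.
  by rewrite -(Radon_Nikodym_SigmaFinite.f_integral density_dominates).
Qed.
End density.

Section gaussian_law.
Context d (Omega : measurableType d) (R : realType) (P : probability Omega R).
Implicit Types f : Omega -> R.

Definition has_law f (m s : R) :=
  measurable_fun setT f /\
  forall A : set R, measurable A -> P (f @^-1` A) = gaussian m s A.

(** In [has_law] the sign of [s] is free, so laws are compared through [s ^+ 2] only. *)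
Lemma normal_pdf_sq (s s' : R) : s ^+ 2 = s' ^+ 2 -> forall m, normal_pdf m s = normal_pdf m s'.
Proof.
move=> ss m; apply/funext => x; rewrite /normal_pdf.
have -> : (s == 0) = (s' == 0) by rewrite -[LHS]sqrf_eq0 ss sqrf_eq0.
by case: ifP => // _; rewrite /normal_peak /normal_fun ss.
Qed.

Lemma integral_law f (m s : R) (h : R -> \bar R) : has_law f m s ->
  (forall x, 0 <= h x)%E -> measurable_fun setT h ->
  (\int[P]_w h (f w))%E = if s == 0 then h m else
   (\int[lebesgue_measure]_x (h x * (normal_pdf m s x)%:E))%E.
Proof.
move=> [mf lf] h0 mh.
case: ifPn => s0.
  rewrite -[LHS](@ge0_integral_pushforward _ _ _ _ _ _ mf P setT h)//.
  rewrite (eq_measure_integral (\d_m : set R -> \bar R)).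
    by rewrite integral_dirac// diracT mul1e.
  by move=> A mA _; have := lf A mA; rewrite /gaussian s0.
have mf' : measurable_fun setT (f : Omega -> measurableTypeR R) by exact: mf.
have mh' : measurable_fun setT (h : measurableTypeR R -> \bar R) by exact: mh.
rewrite -[LHS](@ge0_integral_pushforward _ _ _ _ _ _ mf' P setT h)//.
rewrite (eq_measure_integral (normal_prob m s)); last first.
  by move=> A mA _; have := lf A mA; rewrite /gaussian (negbTE s0).
by apply: ge0_integral_density => //; exact: integrable_normal_pdf.
Qed.

(** Completing the square: an exponential weight translates the density by [th * s ^+ 2]. The
    constant in front is the exponential moment. *)
Lemma normal_pdf_tilt (m s th x : R) : s != 0 ->
  expR (th * x) * normal_pdf m s x =
  expR (th * m + th ^+ 2 * s ^+ 2 / 2) * normal_pdf (m + th * s ^+ 2) s x.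
Proof.
move=> s0; rewrite /normal_pdf (negbTE s0) /normal_fun.
rewrite mulrCA -expRD [RHS]mulrCA -expRD; congr (_ * expR _).
by field.
Qed.

Lemma law_expR f (m s th : R) : has_law f m s ->
  (\int[P]_w (expR (th * f w))%:E = (expR (th * m + th ^+ 2 * s ^+ 2 / 2))%:E)%E.
Proof.
move=> lf; rewrite (@integral_law _ m s (fun x => (expR (th * x))%:E)) //; last first.
  by apply/measurable_EFinP; apply: measurableT_comp => //; exact: measurable_funM.
case: ifPn => [/eqP ->|s0]; first by rewrite expr0n/= mulr0 mul0r addr0.
under eq_integral do rewrite -EFinM normal_pdf_tilt// EFinM.
rewrite integralZl//=; last exact: integrable_normal_pdf.
by rewrite integral_normal_pdf mule1.
Qed.

End gaussian_law.

(** * Convolution of normal densities *)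

Section normal_convolution.
Context (R : realType).
Local Notation mu := (@lebesgue_measure R).

Lemma integral_shift (G : R -> R) (a : R) : continuous G -> (forall x, 0 <= G x) ->
  (\int[mu]_x (G x)%:E = \int[mu]_x (G (x - a))%:E)%E.
Proof.
move=> cG G0.
have F'E : (fun x : R => x - a)^`()%classic = cst 1.
  apply/funext => x; rewrite derive1E deriveB// derive_id derive_cst subr0//.
rewrite (@increasing_ge0_integration_by_substitutionT R (fun x => x - a) G)//.
- by apply: eq_integral => x _; rewrite F'E/= !fctE mulr1.
- by move=> x y xy; rewrite ltrD2r.
- by rewrite F'E => x; exact: cvg_cst.
- by rewrite F'E; exact: is_cvg_cst.
- by rewrite F'E; exact: is_cvg_cst.
- exact: cvg_addrr_Ny.
- exact: cvg_addrr.
Qed.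

(** The joint density of a first summand [x] and a sum [z] is the density of [z] times the
    conditional density of [x] given [z]. In this form integrating out [x] needs no computation. *)
Lemma normal_pdf_conv (s t x z : R) : s != 0 -> t != 0 ->
  normal_pdf 0 s x * normal_pdf 0 t (z - x) =
  normal_pdf 0 (Num.sqrt (s ^+ 2 + t ^+ 2)) z *
  normal_pdf (z * s ^+ 2 / (s ^+ 2 + t ^+ 2)) (s * t / Num.sqrt (s ^+ 2 + t ^+ 2)) x.
Proof.
move=> s0 t0.
have s2 : 0 < s ^+ 2 by rewrite exprn_even_gt0.
have t2 : 0 < t ^+ 2 by rewrite exprn_even_gt0.
have r2 : 0 < s ^+ 2 + t ^+ 2 by rewrite addr_gt0.
have r0 : Num.sqrt (s ^+ 2 + t ^+ 2) != 0 by rewrite gt_eqF// sqrtr_gt0.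
have q0 : s * t / Num.sqrt (s ^+ 2 + t ^+ 2) != 0.
  by rewrite mulf_neq0 ?mulf_neq0// invr_neq0.
rewrite /normal_pdf (negbTE s0) (negbTE t0) (negbTE r0) (negbTE q0).
rewrite mulrACA [RHS]mulrACA; congr (_ * _).
  rewrite /normal_peak -!invfM -!sqrtrM; last 2 first.
  - by rewrite mulrn_wge0// mulr_ge0 ?pi_ge0// sqr_ge0.
  - by rewrite mulrn_wge0// mulr_ge0 ?pi_ge0// sqr_ge0.
  congr (Num.sqrt _)^-1; rewrite exprMn exprVn sqr_sqrtr ?(ltW r2)//.
  by rewrite exprMn; field; rewrite gt_eqF.
rewrite /normal_fun -!expRD; congr expR.
rewrite exprMn exprVn sqr_sqrtr ?(ltW r2)// exprMn.
field; rewrite s0 t0 !andbT; rewrite gt_eqF//.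
Qed.

Lemma normal_conv (s t : R) (h : R -> R) : s != 0 -> t != 0 ->
  continuous h -> (forall x, 0 <= h x) ->
  (\int[mu]_x ((\int[mu]_y ((h (x + y))%:E * (normal_pdf 0 t y)%:E)) * (normal_pdf 0 s x)%:E) =
   \int[mu]_z ((h z)%:E * (normal_pdf 0 (Num.sqrt (s ^+ 2 + t ^+ 2)) z)%:E))%E.
Proof.
move=> s0 t0 ch h0.
have mh : measurable_fun setT h by exact: continuous_measurable_fun.
pose F (xz : R * R) := ((h xz.2) * normal_pdf 0 t (xz.2 - xz.1) * normal_pdf 0 s xz.1)%:E.
have F0 xz : (0 <= F xz)%E by rewrite lee_fin !mulr_ge0 ?normal_pdf_ge0.
have mF : measurable_fun setT F.
  apply/measurable_EFinP; apply: measurable_funM.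
    apply: measurable_funM; first exact: measurableT_comp.
    apply: measurableT_comp; first exact: measurable_normal_pdf.
    exact: measurable_funB.
  by apply: measurableT_comp => //; exact: measurable_normal_pdf.
transitivity (\int[mu]_x \int[mu]_z F (x, z))%E.
  apply: eq_integral => x _.
  pose G (y : R) := h (x + y) * normal_pdf 0 t y * normal_pdf 0 s x.
  transitivity (\int[mu]_y (G y)%:E)%E.
    transitivity (\int[mu]_y ((h (x + y) * normal_pdf 0 t y)%:E * (normal_pdf 0 s x)%:E))%E.
      apply/esym.
      apply: (@ge0_integralZr _ _ R mu _ measurableT (fun y : R => (h (x + y) * normal_pdf 0 t y)%:E)).
      - apply/measurable_EFinP; apply: measurable_funM; last exact: measurable_normal_pdf.
        by apply: measurableT_comp => //; exact: measurable_funD.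
      - by move=> y _; rewrite lee_fin mulr_ge0 ?normal_pdf_ge0.
      - by rewrite lee_fin normal_pdf_ge0.
    by apply: eq_integral => y _; rewrite -!EFinM.
  rewrite (@integral_shift G x).
  - by apply: eq_integral => y _; rewrite /F/G/= addrC subrK.
  - move=> y; apply: cvgM; last exact: cvg_cst.
    apply: cvgM; last exact: continuous_normal_pdf.
    apply: (@continuous_comp _ _ _ (fun y => x + y) h); last exact: ch.
    by apply: cvgD; [exact: cvg_cst|exact: cvg_id].
  - by move=> y; rewrite !mulr_ge0 ?normal_pdf_ge0.
rewrite (@fubini_tonelli _ _ _ _ _ mu mu F)//.
apply: eq_integral => z _.
transitivity (\int[mu]_x ((h z * normal_pdf 0 (Num.sqrt (s ^+ 2 + t ^+ 2)) z)%:E *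
  (normal_pdf (z * s ^+ 2 / (s ^+ 2 + t ^+ 2)) (s * t / Num.sqrt (s ^+ 2 + t ^+ 2)) x)%:E))%E.
  apply: eq_integral => x _; rewrite /F -EFinM/= -mulrA [X in _ * X]mulrC normal_pdf_conv//.
  by rewrite !mulrA.
rewrite integralZl//=; last exact: integrable_normal_pdf.
by rewrite integral_normal_pdf mule1 EFinM.
Qed.
End normal_convolution.

(** Squeezed between [c] and [c / (1 - c * u n)], both from [1 + x <= expR x], applied to [c * u n]
    and to its opposite. *)
Lemma cvg_expR_sub1 (R : realType) (c : R) (u : R^nat) : (forall n, 0 < u n) ->
  u @ \oo --> 0 -> (fun n => (expR (c * u n) - 1) / u n) @ \oo --> c.
Proof.
move=> u_gt0 u0.
have cn : (fun n => c * u n) @ \oo --> (0 : R).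
  by rewrite -[X in _ --> X](mulr0 c); apply: cvgMr.
apply: (@squeeze_cvgr _ _ _ _ (fun=> c) (fun n => c / (1 - c * u n))).
- near=> n.
  have n0 := u_gt0 n.
  have cn1 : c * u n < 1 by near: n; apply: (cvgr_lt (0 : R)) => //.
  apply/andP; split.
    by rewrite ler_pdivlMr// lerBrDl expR_ge1Dx.
  have y0 : 0 < 1 - c * u n by rewrite subr_gt0.
  have h : expR (c * u n) <= (1 - c * u n)^-1.
    rewrite -[leLHS]invrK -expRN lef_pV2 ?posrE ?expR_gt0//.
    exact: expR_ge1Dx.
  rewrite ler_pdivrMr//.
  have -> : c / (1 - c * u n) * u n = (1 - c * u n)^-1 - 1 by field; rewrite gt_eqF.
  by rewrite lerB.
- exact: cvg_cst.
- rewrite -[X in _ --> X](divr1 c); apply: cvgMr; apply: cvgV => //.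
  by rewrite -[X in _ --> X](subr0 1); apply: cvgB => //; exact: cvg_cst.
Unshelve. all: by end_near.
Qed.

(** * Moments of Gaussian variables *)

Section gaussian_moments.
Context d (Omega : measurableType d) (R : realType) (P : probability Omega R).
Implicit Types f : Omega -> R.

Lemma law_integrable_expR f m s th : has_law P f m s ->
  P.-integrable setT (fun w => (expR (th * f w))%:E).
Proof.
move=> lf; apply/integrableP; split.
  apply/measurable_EFinP; apply: measurableT_comp => //; apply: measurable_funM => //.
  exact: lf.1.
under eq_integral do rewrite gee0_abs ?lee_fin ?expR_ge0//.
by rewrite (law_expR th lf) ltry.
Qed.

Lemma law_integrable f m s : has_law P f m s -> P.-integrable setT (EFin \o f).
Proof.
move=> lf.
apply: (@le_integrable _ _ _ P _ measurableT _ (fun w => (expR (1 * f w))%:E + (expR (-1 * f w))%:E)%E).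
- by apply/measurable_EFinP; exact: lf.1.
- move=> w _ /=; rewrite lee_fin mul1r mulN1r [leRHS]ger0_norm ?addr_ge0 ?expR_ge0//.
  have h1 := expR_ge1Dx (f w); have h2 := expR_ge1Dx (- f w).
  have h3 := expR_gt0 (f w); have h4 := expR_gt0 (- f w).
  by rewrite ler_norml; apply/andP; split; lra.
- by apply: integrableD => //; exact: (law_integrable_expR _ lf).
Qed.

(** Integrating [1 + th * f <= expR (th * f)] with zero mean shows that
    [th * m + th ^+ 2 * s ^+ 2 / 2] is nonnegative for every [th], which forces the linear
    coefficient to vanish. *)
Lemma law_centered f m s : has_law P f m s -> (\int[P]_w (f w)%:E = 0)%E -> m = 0.
Proof.
move=> lf f0.
have h th : 0 <= th * m + th ^+ 2 * s ^+ 2 / 2.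
  have : (1 + th%:E * \int[P]_w (f w)%:E <= \int[P]_w (expR (th * f w))%:E)%E.
    rewrite -integralZl//; last exact: law_integrable lf.
    rewrite -[1%E](_ : \int[P]_w 1 = 1)%E; last by rewrite integral_cst// mul1e; exact: probability_setT.
    rewrite -integralD//; last 2 first.
    - exact: finite_measure_integrable_cst.
    - by apply: integrableZl => //; exact: law_integrable lf.
    apply: le_integral => //.
    - apply: integrableD => //; first exact: finite_measure_integrable_cst.
      by apply: integrableZl => //; exact: law_integrable lf.
    - exact: law_integrable_expR lf.
    - by move=> w _; rewrite -EFinM -EFinD lee_fin expR_ge1Dx.
  by rewrite f0 mule0 adde0 (law_expR th lf) lee_fin -expR0 ler_expR.
have s1 : 0 < s ^+ 2 + 1 by rewrite ltr_pwDr// sqr_ge0.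
(* Near the minimizer of the quadratic; the added 1 covers the degenerate case [s = 0]. *)
have := h (- m / (s ^+ 2 + 1)).
have -> : - m / (s ^+ 2 + 1) * m + (- m / (s ^+ 2 + 1)) ^+ 2 * s ^+ 2 / 2 =
  - ((m / (s ^+ 2 + 1)) ^+ 2 * (s ^+ 2 / 2 + 1)) by field; rewrite gt_eqF.
rewrite oppr_ge0 pmulr_lle0; last by rewrite ltr_pwDr// divr_ge0 ?sqr_ge0.
move=> h0; have : (m / (s ^+ 2 + 1)) ^+ 2 == 0 by rewrite eq_le h0 sqr_ge0.
by rewrite sqrf_eq0 mulf_eq0 invr_eq0 (gt_eqF s1) orbF => /eqP.
Qed.

Lemma sqr_expR_subN_le (u : R) : (expR u - expR (- u)) ^+ 2 <= 4 * u ^+ 2 * expR (2 * `|u|).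
Proof.
wlog u0 : u / 0 <= u.
  move=> h; have [|u0] := leP 0 u; first exact: h.
  have := h (- u); rewrite opprK oppr_ge0 normrN sqrrN => /(_ (ltW u0)).
  by rewrite -[in X in X <= _ -> _]sqrrN opprB.
rewrite ger0_norm//.
have -> : 4 * u ^+ 2 * expR (2 * u) = (2 * u * expR u) ^+ 2.
  by rewrite expRM_natl; ring.
have h := expR_ge1Dx (- (2 * u)).
have eu : expR (- u) = expR u * expR (- (2 * u)) by rewrite -expRD; congr expR; ring.
rewrite lerXn2r ?nnegrE ?mulr_ge0 ?expR_ge0// ?subr_ge0 ?ler_expR; first lra.
rewrite eu -[X in X - _]mulr1 -mulrBr mulrC ler_wpM2r ?expR_ge0//; lra.
Qed.

Lemma expR_norm_le (u : R) : expR `|u| <= expR u + expR (- u).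
Proof.
by have [u0|u0] := leP 0 u; [rewrite ger0_norm// lerDl|rewrite ltr0_norm// lerDr]; exact: expR_ge0.
Qed.

(** The square is the limit of second differences of the exponential, [h n], whose integrals are
    known from [law_expR]. Writing them as squares of hyperbolic sines gives the domination by
    [expR (3 * x) + expR (-3 * x)]. *)
Lemma law_sqr f s : has_law P f 0 s ->
  P.-integrable setT (fun w => (f w ^+ 2)%:E) /\
  (\int[P]_w (f w ^+ 2)%:E = (s ^+ 2)%:E)%E.
Proof.
move=> lf; have mf := lf.1.
pose u (n : nat) : R := n.+1%:R^-1.
have u_gt0 n : 0 < u n by rewrite invr_gt0 ltr0n.
have u_le1 n : u n <= 1 by rewrite invf_le1 ?ltr0n// ler1n.
have u0 : u @ \oo --> 0 by exact: cvg_harmonic.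
pose h n (x : R) := ((expR (x / 2 * u n) - expR (- (x / 2 * u n))) / u n) ^+ 2.
have hE n x : h n x = (expR (u n * x) + expR (- u n * x) - 2) / u n ^+ 2.
  rewrite /h expr_div_n; congr (_ / _).
  have AB : expR (x / 2 * u n) * expR (- (x / 2 * u n)) = 1 by rewrite -expRD addrN expR0.
  rewrite (_ : u n * x = (x / 2 * u n) * 2%:R); last by field.
  rewrite (_ : - u n * x = - (x / 2 * u n) * 2%:R); last by field.
  by rewrite !expRM_natr sqrrB AB; ring.
have hx x : h n x @[n --> \oo] --> x ^+ 2.
  apply: (@cvg_comp _ _ _ _ (fun y => y ^+ 2) _ (nbhs x)); last exact: exprn_continuous.
  have h1 := cvg_expR_sub1 (c := x / 2) u_gt0 u0.
  have h2 := cvg_expR_sub1 (c := - (x / 2)) u_gt0 u0.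
  have -> : x = x / 2 - - (x / 2) by field.
  under eq_fun => n.
    rewrite (_ : _ / u n = (expR ((x / 2 - - (x / 2)) / 2 * u n) - 1) / u n -
      (expR (- ((x / 2 - - (x / 2)) / 2) * u n) - 1) / u n); last first.
      by rewrite mulNr; ring.
    over.
  rewrite (_ : (x / 2 - - (x / 2)) / 2 = x / 2); last by field.
  exact: (cvgB h1 h2).
have hb n x : h n x <= expR (3 * x) + expR (-3 * x).
  apply: (@le_trans _ _ (x ^+ 2 * expR `|x|)).
    rewrite /h expr_div_n ler_pdivrMr ?exprn_gt0//.
    apply: (le_trans (sqr_expR_subN_le _)).
    have -> : 4 * (x / 2 * u n) ^+ 2 = x ^+ 2 * u n ^+ 2 by field.
    rewrite mulrAC ler_wpM2r ?sqr_ge0// ler_wpM2l ?sqr_ge0// ler_expR.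
    rewrite normrM normrM (gtr0_norm (u_gt0 n)) (@ger0_norm _ 2^-1)//.
    rewrite (_ : 2 * _ = `|x| * u n); last by field.
    by rewrite ler_piMr.
  apply: (@le_trans _ _ (expR `|3 * x|)); last by rewrite mulNr; exact: expR_norm_le.
  rewrite normrM (ger0_norm (_ : 0 <= 3))// (_ : 3 * `|x| = 2 * `|x| + `|x|); last by ring.
  rewrite expRD ler_wpM2r ?expR_ge0// expRM_natl -real_normK ?num_real//.
  rewrite lerXn2r ?nnegrE ?expR_ge0//.
  by apply: (le_trans _ (expR_ge1Dx _)); rewrite lerDr.
have mh n : measurable_fun setT (fun w => (h n (f w))%:E).
  apply/measurable_EFinP; under eq_fun do rewrite hE.
  apply: measurable_funM => //; apply: measurable_funB => //.
  by apply: measurable_funD; apply: measurableT_comp => //; apply: measurable_funM.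
have [i1 _ i2] := @dominated_convergence _ _ _ P setT measurableT
  (fun n w => (h n (f w))%:E) (fun w => (f w ^+ 2)%:E)
  (fun w => (expR (3 * f w))%:E + (expR (-3 * f w))%:E)%E mh
  ltac:(by apply/measurable_EFinP; exact: measurable_funX)
  ltac:(by apply: aeW => w _; apply/cvg_EFin; [exact: nearW|exact: hx])
  ltac:(by apply: integrableD => //; exact: (law_integrable_expR _ lf))
  ltac:(by apply: aeW => w n _; rewrite gee0_abs ?lee_fin ?sqr_ge0//).
split => //.
have Eh n : (\int[P]_w (h n (f w))%:E)%E =
    (2 * ((expR (s ^+ 2 / 2 * u n ^+ 2) - 1) / u n ^+ 2))%:E.
  transitivity (\int[P]_w ((u n ^- 2)%:E * (((expR (u n * f w))%:E + (expR (- u n * f w))%:E) + (- 2)%:E)))%E.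
    by apply: eq_integral => w _; rewrite hE mulrC EFinM !EFinD.
  have i1' := law_integrable_expR (u n) lf; have i2' := law_integrable_expR (- u n) lf.
  have i3 : P.-integrable setT (cst (- 2)%:E) by exact: finite_measure_integrable_cst.
  have i12 := integrableD measurableT i1' i2'.
  rewrite integralZl//=; last exact: (integrableD measurableT i12 i3).
  rewrite (integralD _ i12 i3)// (integralD _ i1' i2')// (law_expR _ lf) (law_expR _ lf).
  rewrite integral_cst//= probability_setT mule1.
  rewrite !mulr0 !add0r sqrrN -!EFinD -EFinM; congr EFin.
  rewrite (_ : u n ^+ 2 * s ^+ 2 / 2 = s ^+ 2 / 2 * u n ^+ 2); last by field.
  by ring.
have lim1 : (\int[P]_w (h n (f w))%:E)%E @[n --> \oo] --> (s ^+ 2)%:E.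
  under eq_fun do rewrite Eh.
  apply/cvg_EFin; first exact: nearW.
  have v0 : (fun n => u n ^+ 2) @ \oo --> 0.
    by rewrite -[X in _ --> X](mulr0 0); under eq_fun do rewrite expr2; exact: (cvgM u0 u0).
  have v_gt0 n : 0 < u n ^+ 2 by rewrite exprn_gt0.
  have h1 := cvg_expR_sub1 (c := s ^+ 2 / 2) v_gt0 v0.
  have -> : s ^+ 2 = 2 * (s ^+ 2 / 2) by field.
  rewrite (_ : 2 * (s ^+ 2 / 2) / 2 = s ^+ 2 / 2); last by field.
  by apply: cvgMr; exact: h1.
exact: (cvg_unique _ i2 lim1).
Qed.
End gaussian_moments.

Section bounded_expectation.
Context d (T : measurableType d) (R : realType) (P : probability T R).

Lemma bounded_integrable (f : T -> R) (B : R) : measurable_fun setT f ->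
  (forall x, `|f x| <= B) -> P.-integrable setT (EFin \o f).
Proof.
move=> mf fB; apply: measurable_bounded_integrable => //.
- by rewrite -ge0_fin_numE// fin_num_measure.
- exists B; split; first exact: num_real.
  by move=> M BM x _; apply: (le_trans (fB x)); exact: ltW.
Qed.

Lemma bounded_cvg_Rintegral (f_ : nat -> T -> R) (f : T -> R) (B : R) :
  (forall n, measurable_fun setT (f_ n)) -> measurable_fun setT f ->
  (forall n x, `|f_ n x| <= B) -> (forall x, f_ n x @[n --> \oo] --> f x) ->
  (\int[P]_x f_ n x)%R @[n --> \oo] --> (\int[P]_x f x)%R.
Proof.
move=> mf_ mf fB ff.
have [_ _ h] := @dominated_convergence _ _ _ P setT measurableT
  (fun n x => (f_ n x)%:E) (fun x => (f x)%:E) (cst B%:E)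
  ltac:(by move=> n; exact/measurable_EFinP)
  ltac:(exact/measurable_EFinP)
  ltac:(by apply: aeW => w _; apply/cvg_EFin; [exact: nearW|exact: ff])
  ltac:(exact: finite_measure_integrable_cst)
  ltac:(by apply: aeW => w n _; rewrite lee_fin).
have fB' x : `|f x| <= B.
  apply: (@cvgr_to_le _ \oo _ _ (fun n => `|f_ n x|)); first by apply: cvg_norm; exact: ff.
  by apply: nearW => n; exact: fB.
apply: fine_cvg; rewrite fineK; first exact: h.
by apply: integrable_fin_num => //; apply: (bounded_integrable mf fB').
Qed.
End bounded_expectation.

(** * The law of a vector is determined by its linear combinations *)

Section cramer_wold.
Context d1 d2 (T1 : measurableType d1) (T2 : measurableType d2) (R : realType).
Context (P1 : probability T1 R) (P2 : probability T2 R).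
Context (N : nat) (U : 'I_N -> T1 -> R) (W : 'I_N -> T2 -> R).
Hypothesis mU : forall i, measurable_fun setT (U i).
Hypothesis mW : forall i, measurable_fun setT (W i).
Hypothesis same_cos : forall (l : 'I_N -> R) (c : R),
  \int[P1]_x cos (\sum_i l i * U i x + c) = \int[P2]_x cos (\sum_i l i * W i x + c).

Implicit Types f m : ('I_N -> R) -> R.
Local Notation lin l v := (\sum_i l i * v i).

Definition bounded_meas f := [/\ measurable_fun setT (fun x => f (U^~ x)),
  measurable_fun setT (fun x => f (W^~ x)) & exists B, forall v, `|f v| <= B].

(** The phase [c] makes the class contain sines as well, so it is closed under the product-to-sum
    formulas without complex exponentials. *)
Definition cos_equal f := bounded_meas f /\ forall l c,
  \int[P1]_x (f (U^~ x) * cos (lin l (U^~ x) + c)) =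
  \int[P2]_x (f (W^~ x) * cos (lin l (W^~ x) + c)).

(* Multipliers form an algebra closed under bounded pointwise limits. It contains
   the cosines of linear forms, hence their signs, hence indicators of rectangles. *)
Definition multiplier m := bounded_meas m /\
  forall f, cos_equal f -> cos_equal (fun v => m v * f v).

Lemma bounded_measM f g : bounded_meas f -> bounded_meas g -> bounded_meas (fun v => f v * g v).
Proof.
move=> [f1 f2 [A fA]] [g1 g2 [B gB]]; split; [exact: measurable_funM..|].
by exists (A * B) => v; rewrite normrM ler_pM.
Qed.

Lemma bounded_measD f g : bounded_meas f -> bounded_meas g -> bounded_meas (fun v => f v + g v).
Proof.
move=> [f1 f2 [A fA]] [g1 g2 [B gB]]; split; [exact: measurable_funD..|].
by exists (A + B) => v; rewrite (le_trans (ler_normD _ _))// lerD.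
Qed.

Lemma bounded_meas_cst a : bounded_meas (fun=> a).
Proof. by split; [exact: measurable_cst..|exists `|a|]. Qed.

Lemma bounded_meas_cos l c : bounded_meas (fun v => cos (lin l v + c)).
Proof.
have mcos : measurable_fun setT (@cos R).
  by apply: continuous_measurable_fun; exact: continuous_cos.
split; last by exists 1 => v; rewrite ler_norml cos_geN1 cos_le1.
- apply: measurableT_comp => //; apply: measurable_funD => //.
  by apply: measurable_sum => i; exact: measurable_funM.
- apply: measurableT_comp => //; apply: measurable_funD => //.
  by apply: measurable_sum => i; exact: measurable_funM.
Qed.

Lemma bounded_meas_int f : bounded_meas f ->
  P1.-integrable setT (fun x => (f (U^~ x))%:E) /\ P2.-integrable setT (fun x => (f (W^~ x))%:E).
Proof. by move=> [f1 f2 [B fB]]; split; apply: (@bounded_integrable _ _ _ _ _ B). Qed.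

Lemma cos_equal1 : cos_equal (fun=> 1).
Proof.
split; first exact: bounded_meas_cst.
move=> l c; under eq_Rintegral do rewrite mul1r.
by under [RHS]eq_Rintegral do rewrite mul1r; exact: same_cos.
Qed.

Lemma multiplier_cst a : multiplier (fun=> a).
Proof.
split; first exact: bounded_meas_cst.
move=> f [bf ef]; split; first by apply: bounded_measM => //; exact: bounded_meas_cst.
move=> l c; have [i1 i2] := bounded_meas_int (bounded_measM bf (bounded_meas_cos l c)).
under eq_Rintegral do rewrite -mulrA; under [RHS]eq_Rintegral do rewrite -mulrA.
by rewrite !RintegralZl// ef.
Qed.

Lemma multiplierD m m' : multiplier m -> multiplier m' -> multiplier (fun v => m v + m' v).
Proof.
move=> [b1 h1] [b2 h2]; split; first exact: bounded_measD.
move=> f ff; have [bf1 ef1] := h1 _ ff; have [bf2 ef2] := h2 _ ff.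
split; first by apply: bounded_measM; [exact: bounded_measD|exact: ff.1].
move=> l c; have [i1 i2] := bounded_meas_int (bounded_measM bf1 (bounded_meas_cos l c)).
have [i3 i4] := bounded_meas_int (bounded_measM bf2 (bounded_meas_cos l c)).
under eq_Rintegral do rewrite mulrDl mulrDl; under [RHS]eq_Rintegral do rewrite mulrDl mulrDl.
by rewrite !RintegralD// ef1 ef2.
Qed.

Lemma multiplierM m m' : multiplier m -> multiplier m' -> multiplier (fun v => m v * m' v).
Proof.
move=> [b1 h1] [b2 h2]; split; first exact: bounded_measM.
move=> f ff; have -> : (fun v => m v * m' v * f v) = (fun v => m v * (m' v * f v)).
  by apply/funext => v; rewrite mulrA.
by apply: h1; exact: h2.
Qed.

(** By the product-to-sum formula, multiplying by a cosine of a linear form only shifts the forms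
    and phases against which [f] is tested. *)
Lemma multiplier_cos l c : multiplier (fun v => cos (lin l v + c)).
Proof.
split; first exact: bounded_meas_cos.
move=> f [bf ef]; split; first by apply: bounded_measM => //; exact: bounded_meas_cos.
move=> l' c'.
have E v : cos (lin l v + c) * f v * cos (lin l' v + c') =
  2^-1 * (f v * cos (lin (fun i => l i + l' i) v + (c + c'))) +
  2^-1 * (f v * cos (lin (fun i => l i - l' i) v + (c - c'))).
  have -> : lin (fun i => l i + l' i) v = lin l v + lin l' v.
    by rewrite -big_split; apply: eq_bigr => i _; rewrite mulrDl.
  have -> : lin (fun i => l i - l' i) v = lin l v - lin l' v.
    by rewrite -sumrB; apply: eq_bigr => i _; rewrite mulrBl.
  rewrite (_ : lin l v + lin l' v + (c + c') = (lin l v + c) + (lin l' v + c')); last by ring.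
  rewrite (_ : lin l v - lin l' v + (c - c') = (lin l v + c) - (lin l' v + c')); last by ring.
  by move: (lin l v + c) (lin l' v + c') => A B; rewrite cosD cosB; field.
have [i1 i2] := bounded_meas_int (bounded_measM bf (bounded_meas_cos (fun i => l i + l' i) (c + c'))).
have [i3 i4] := bounded_meas_int (bounded_measM bf (bounded_meas_cos (fun i => l i - l' i) (c - c'))).
under eq_Rintegral do rewrite E; under [RHS]eq_Rintegral do rewrite E.
have j1 := integrableZl measurableT 2^-1 i1; have j2 := integrableZl measurableT 2^-1 i2.
have j3 := integrableZl measurableT 2^-1 i3; have j4 := integrableZl measurableT 2^-1 i4.
rewrite !RintegralD//.
by rewrite !RintegralZl// !ef.
Qed.

Lemma multiplier_lim (m_ : nat -> ('I_N -> R) -> R) m (B : R) :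
  (forall n, multiplier (m_ n)) -> (forall n v, `|m_ n v| <= B) ->
  (forall v, m_ n v @[n --> \oo] --> m v) -> multiplier m.
Proof.
move=> hm bm mm.
have bmm : bounded_meas m.
  split.
  - apply: (@measurable_fun_cvg _ _ _ setT (fun n x => m_ n (U^~ x))).
      by move=> n; case: (hm n) => -[].
    by move=> x _; exact: mm.
  - apply: (@measurable_fun_cvg _ _ _ setT (fun n x => m_ n (W^~ x))).
      by move=> n; case: (hm n) => -[].
    by move=> x _; exact: mm.
  - exists B => v; apply: (@cvgr_to_le _ \oo _ _ (fun n => `|m_ n v|)); first by apply: cvg_norm; exact: mm.
    by apply: nearW => n; exact: bm.
split => // f ff; split; first by apply: bounded_measM => //; exact: ff.1.
move=> l c.
have bfc := bounded_measM ff.1 (bounded_meas_cos l c).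
have [mfc1 mfc2 [C fC]] := bfc.
have L x : m_ n (U^~ x) * f (U^~ x) * cos (lin l (U^~ x) + c) @[n --> \oo] -->
    m (U^~ x) * f (U^~ x) * cos (lin l (U^~ x) + c).
  by apply: cvgMl; apply: cvgMl; exact: mm.
have L' x : m_ n (W^~ x) * f (W^~ x) * cos (lin l (W^~ x) + c) @[n --> \oo] -->
    m (W^~ x) * f (W^~ x) * cos (lin l (W^~ x) + c).
  by apply: cvgMl; apply: cvgMl; exact: mm.
have b n v : `|m_ n v * f v * cos (lin l v + c)| <= B * C.
  by rewrite -mulrA normrM ler_pM//; exact: fC.
have bn n := bounded_measM (bounded_measM (hm n).1 ff.1) (bounded_meas_cos l c).
have bl := bounded_measM (bounded_measM bmm ff.1) (bounded_meas_cos l c).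
have h1 := bounded_cvg_Rintegral (P := P1) (fun n => let: And3 q _ _ := bn n in q)
  (let: And3 q _ _ := bl in q) (fun n x => b n (U^~ x)) L.
have h2 := bounded_cvg_Rintegral (P := P2) (fun n => let: And3 _ q _ := bn n in q)
  (let: And3 _ q _ := bl in q) (fun n x => b n (W^~ x)) L'.
apply: (cvg_unique (@Rhausdorff R) h1).
rewrite /=; under eq_fun do rewrite ((hm _).2 _ ff).2; exact: h2.
Qed.

(* Being polynomial, this step preserves multipliers; its iterates converge to the sign. *)
Definition sgn_step (x : R) := (3 * x - x ^+ 3) / 2.

Lemma sgn_step_itv (x : R) : 0 <= x <= 1 -> x <= sgn_step x <= 1.
Proof.
move=> /andP[x0 x1]; rewrite /sgn_step; apply/andP; split.
  rewrite ler_pdivlMr// -subr_ge0 (_ : _ - _ = x * (1 - x) * (1 + x)); last by ring.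
  by rewrite !mulr_ge0// ?subr_ge0// addr_ge0.
rewrite ler_pdivrMr// -subr_ge0 (_ : _ - _ = (1 - x) ^+ 2 * (2 + x)); last by ring.
by rewrite mulr_ge0 ?sqr_ge0// addr_ge0.
Qed.

Lemma sgn_stepN (x : R) : sgn_step (- x) = - sgn_step x.
Proof. by rewrite /sgn_step; field. Qed.

Lemma iter_sgn_stepN n (x : R) : iter n sgn_step (- x) = - iter n sgn_step x.
Proof. by elim: n => //= n ->; rewrite sgn_stepN. Qed.

Lemma iter_sgn_step_itv n (x : R) : 0 <= x <= 1 -> x <= iter n sgn_step x <= 1.
Proof.
move=> x01; elim: n => [|n /andP[ih1 ih2]] /=; first by move: x01 => /andP[_ ->]; rewrite lexx.
have /andP[x0 x1] := x01.
have /sgn_step_itv/andP[h1 h2] : 0 <= iter n sgn_step x <= 1 by rewrite (le_trans x0 ih1).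
by rewrite h2 (le_trans ih1 h1).
Qed.

Lemma iter_sgn_step_le1 n (x : R) : `|x| <= 1 -> `|iter n sgn_step x| <= 1.
Proof.
wlog x0 : x / 0 <= x.
  move=> h x1; have [|x0] := leP 0 x; first by move=> /h; exact.
  by rewrite -normrN -iter_sgn_stepN h// ?oppr_ge0 ?normrN// ltW.
rewrite ger0_norm// => x1; have /(iter_sgn_step_itv n)/andP[h1 h2] : 0 <= x <= 1 by rewrite x0.
by rewrite ger0_norm// (le_trans x0 h1).
Qed.

Lemma cvg_iter_sgn_step (x : R) : `|x| <= 1 -> iter n sgn_step x @[n --> \oo] --> Num.sg x.
Proof.
have pos y : 0 < y <= 1 -> iter n sgn_step y @[n --> \oo] --> (1 : R).
  move=> /andP[y0 y1].
  have y01 : 0 <= y <= 1 by rewrite (ltW y0).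
  (* The distance to 1 is multiplied at each step by [1 - (z + z ^+ 2) / 2], at most [1 - y / 2]
     because the iterates stay above the starting point [y]. *)
  have h n : 1 - (1 - y / 2) ^+ n <= iter n sgn_step y.
    rewrite lerBlDl -lerBlDr; elim: n => [|n ih] /=.
      by rewrite expr0 lerBlDr lerDl ltW.
    have /andP[h1 h2] := iter_sgn_step_itv n y01.
    set z := iter n sgn_step y in ih h1 h2 *.
    have -> : 1 - sgn_step z = (1 - z) * (1 - (z + z ^+ 2) / 2) by rewrite /sgn_step; field.
    rewrite [leRHS]exprSr; apply: ler_pM => //; first by rewrite subr_ge0.
      rewrite subr_ge0 ler_pdivrMr// mul1r.
      have z2 : z ^+ 2 <= 1 by rewrite exprn_ile1// (le_trans (ltW y0) h1).
      lra.
    have := sqr_ge0 z; lra.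
  apply: (@squeeze_cvgr _ _ _ _ (fun n => 1 - (1 - y / 2) ^+ n) (fun=> 1)).
  - by apply: nearW => n; rewrite h; have /andP[_ ->] := iter_sgn_step_itv n y01.
  - rewrite -[X in _ --> X](subr0 1); apply: cvgB; first exact: cvg_cst.
    apply: cvg_expr; rewrite ger0_norm; lra.
  - exact: cvg_cst.
have [x0|x0|->] := ltgtP x 0.
- move=> x1; rewrite ltr0_sg// -(opprK x).
  under eq_fun do rewrite iter_sgn_stepN.
  by apply: cvgN; apply: pos; rewrite oppr_gt0 x0/= -(ltr0_norm x0).
- by move=> x1; rewrite gtr0_sg//; apply: pos; rewrite x0 -(gtr0_norm x0).
- move=> _; rewrite sgr0 (_ : (fun _ => _) = fun=> 0); first exact: cvg_cst.
  by apply/funext => n; elim: n => //= n ->; rewrite /sgn_step expr0n/= mulr0 subr0 mul0r.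
Qed.

Lemma multiplier_sgn_cos l c : multiplier (fun v => Num.sg (cos (lin l v + c))).
Proof.
apply: (@multiplier_lim (fun n v => iter n sgn_step (cos (lin l v + c))) _ 1).
- elim=> [|n ih] /=; first exact: multiplier_cos.
  rewrite /sgn_step (_ : (fun v => _) = (fun v => 3 / 2 * iter n sgn_step (cos (lin l v + c)) +
    (- 2^-1) * (iter n sgn_step (cos (lin l v + c)) *
     (iter n sgn_step (cos (lin l v + c)) * iter n sgn_step (cos (lin l v + c)))))); last first.
    by apply/funext => v; field.
  apply: multiplierD; apply: multiplierM; try exact: multiplier_cst; first exact: ih.
  by apply: multiplierM; [|apply: multiplierM]; exact: ih.
- by move=> n v; apply: iter_sgn_step_le1; rewrite ler_norml cos_geN1 cos_le1.
- by move=> v; apply: cvg_iter_sgn_step; rewrite ler_norml cos_geN1 cos_le1.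
Qed.

(** For [k] large, [(v i - a) / k.+1%:R] lies in []-pi, pi[], where the sine has the sign of its
    argument. The sine is a cosine with phase [- pi / 2], so [multiplier_sgn_cos] applies. *)
Lemma multiplier_sgn i a : multiplier (fun v => Num.sg (v i - a)).
Proof.
apply: (@multiplier_lim (fun k v => Num.sg (cos (lin (fun j => if j == i then k.+1%:R^-1 else 0) v +
  (- a / k.+1%:R - pi / 2)))) _ 1).
- by move=> k; exact: multiplier_sgn_cos.
- by move=> k v; rewrite normr_sg; case: eqP => //= _; exact: ler01.
move=> v.
have E k : lin (fun j => if j == i then k.+1%:R^-1 else 0) v + (- a / k.+1%:R - pi / 2) =
    (v i - a) / k.+1%:R - pi / 2.
  rewrite (bigD1 i)//= eqxx big1; first by rewrite addr0 addrA; ring.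
  by move=> j /negbTE ->; rewrite mul0r.
under eq_fun do rewrite E cosBpihalf.
have xk : (fun k : nat => (v i - a) / k.+1%:R) @ \oo --> (0 : R).
  by rewrite -[X in _ --> X](mulr0 (v i - a)); apply: cvgMr; exact: cvg_harmonic.
apply: cvg_near_cst; near=> k.
have h1 : (v i - a) / k.+1%:R < pi by near: k; apply: (cvgr_lt (0 : R)) => //; exact: pi_gt0.
have h2 : - pi < (v i - a) / k.+1%:R.
  by near: k; apply: (cvgr_gt (0 : R)) => //; rewrite oppr_lt0 pi_gt0.
have k0 : (0 : R) < k.+1%:R^-1 by rewrite invr_gt0.
have [x0|x0|->] := ltgtP (v i - a) 0.
- rewrite [RHS]ltr0_sg// ltr0_sg// -(opprK (_ / _)) sinN oppr_lt0 sin_gt0_pi// oppr_gt0.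
  by rewrite pmulr_llt0// x0/= ltrNl.
- by rewrite [RHS]gtr0_sg// gtr0_sg// sin_gt0_pi// pmulr_lgt0// x0.
- by rewrite mul0r sin0.
Unshelve. all: by end_near.
Qed.

(** The indicator of a positive number is half of its squared sign plus half of its sign; at 0 this
    gives 0, hence the strict inequality. *)
Lemma multiplier_gt i a : multiplier (fun v => (a < v i)%R%:R).
Proof.
rewrite (_ : (fun v => _) = (fun v => 2^-1 * (Num.sg (v i - a) * Num.sg (v i - a) + Num.sg (v i - a)))).
  apply: multiplierM; first exact: multiplier_cst.
  by apply: multiplierD; [apply: multiplierM|]; exact: multiplier_sgn.
apply/funext => v; rewrite -subr_gt0; case: sgrP => _ /=.
- by rewrite mul0r addr0 mulr0.
- by rewrite mulr1 -[1 + 1]/2 mulVf.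
- by rewrite mulrNN mulr1 addrN mulr0.
Qed.

Lemma multiplier_rect (a : 'I_N -> R) : multiplier (fun v => \prod_i (a i < v i)%R%:R).
Proof.
suff h (s : seq 'I_N) : multiplier (fun v => \prod_(i <- s) (a i < v i)%R%:R) by exact: h.
elim: s => [|i s ih].
  rewrite (_ : (fun v => _) = fun=> 1); first exact: multiplier_cst.
  by apply/funext => v; rewrite big_nil.
rewrite (_ : (fun v => _) = fun v => (a i < v i)%R%:R * \prod_(i <- s) (a i < v i)%R%:R).
  by apply: multiplierM => //; exact: multiplier_gt.
by apply/funext => v; rewrite big_cons.
Qed.

Lemma Rintegral_rect d (T : measurableType d) (P : probability T R) (V : 'I_N -> T -> R)
    (a : 'I_N -> R) : (forall i, measurable_fun setT (V i)) ->
  \int[P]_x (\prod_i (a i < V i x)%R%:R) = fine (P [set x | forall i, a i < V i x]).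
Proof.
move=> mV; rewrite /Rintegral.
rewrite -[X in fine (P X)]setIT -integral_indic//; last first.
  rewrite (_ : [set x | _] = \bigcap_(i in [set: 'I_N]) (V i @^-1` `]a i, +oo[)).
    apply: fin_bigcap_measurable => // i _.
    rewrite -[X in measurable X]setTI; apply: mV => //.
  by apply/seteqP; split => x /=; [move=> h i _; rewrite /= in_itv/= h|
    move=> h i; have := h i I; rewrite /= in_itv/= andbT].
congr fine; apply: eq_integral => x _; congr EFin.
rewrite indicE; case: (boolP (x \in _)) => [|]; rewrite ?inE ?notin_setE/=.
  by move=> h; rewrite big1// => i _; rewrite h.
move=> h; have /existsNP[i hi] := h.
by rewrite (bigD1 i)//= (negbTE (introN idP hi)) mul0r.
Qed.

Lemma same_rect (a : 'I_N -> R) :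
  P1 [set x | forall i, a i < U i x] = P2 [set x | forall i, a i < W i x].
Proof.
have m1 : measurable [set x | forall i, a i < U i x].
  rewrite (_ : [set x | _] = \bigcap_(i in [set: 'I_N]) (U i @^-1` `]a i, +oo[)).
    by apply: fin_bigcap_measurable => // i _; rewrite -[X in measurable X]setTI; apply: mU.
  by apply/seteqP; split => x /=; [move=> h i _; rewrite /= in_itv/= h|
    move=> h i; have := h i I; rewrite /= in_itv/= andbT].
have m2 : measurable [set x | forall i, a i < W i x].
  rewrite (_ : [set x | _] = \bigcap_(i in [set: 'I_N]) (W i @^-1` `]a i, +oo[)).
    by apply: fin_bigcap_measurable => // i _; rewrite -[X in measurable X]setTI; apply: mW.
  by apply/seteqP; split => x /=; [move=> h i _; rewrite /= in_itv/= h|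
    move=> h i; have := h i I; rewrite /= in_itv/= andbT].
rewrite -(fineK (fin_num_measure P1 _ m1)) -(fineK (fin_num_measure P2 _ m2)).
rewrite -!Rintegral_rect//; congr EFin.
have [_ /(_ (fun=> 0) 0)] := (multiplier_rect a).2 _ cos_equal1.
have z (v : 'I_N -> R) : \sum_i 0 * v i + 0 = 0 by rewrite addr0 big1// => i _; rewrite mul0r.
by under eq_Rintegral do rewrite z cos0 !mulr1; under [RHS]eq_Rintegral do rewrite z cos0 !mulr1.
Qed.

Let tU x := mktuple (fun i => U i x).
Let tW x := mktuple (fun i => W i x).

Let mtU : measurable_fun setT tU.
Proof.
apply/measurable_fun_tnthP => i; rewrite (_ : _ \o _ = U i)//.
by apply/funext => x /=; rewrite tnth_mktuple.
Qed.

Let mtW : measurable_fun setT tW.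
Proof.
apply/measurable_fun_tnthP => i; rewrite (_ : _ \o _ = W i)//.
by apply/funext => x /=; rewrite tnth_mktuple.
Qed.

Definition rects : set (set (N.-tuple R)) :=
  [set A | exists a : 'I_N -> R, A = [set t | forall i, a i < tnth t i]].

Lemma rects_measurable : rects `<=` measurable.
Proof.
move=> _ [a ->].
rewrite (_ : [set x | _] = \bigcap_(i in [set: 'I_N]) ((fun t => tnth t i) @^-1` `]a i, +oo[)).
  apply: fin_bigcap_measurable => // i _; rewrite -[X in measurable X]setTI.
  by apply: (measurable_tnth i).
by apply/seteqP; split => x /=; [move=> h i _; rewrite /= in_itv/= h|
    move=> h i; have := h i I; rewrite /= in_itv/= andbT].
Qed.

Lemma rects_gen (A : set (N.-tuple R)) : measurable A -> <<s rects >> A.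
Proof.
pose GT := g_sigma_algebraType rects.
have mid : measurable_fun [set: GT] (id : GT -> N.-tuple R).
  apply/measurable_fun_tnthP => i.
  move=> mD; apply: (measurability _ (RGenOInfty.measurableE R)) => //.
  move=> _ [_ [x ->] <-]; rewrite setTI.
  (* A half-space in one coordinate is the union of the rectangles whose other lower bounds are
     [- k]. *)
  rewrite (_ : _ @^-1` _ = \bigcup_k [set t : N.-tuple R | forall j, (if j == i then x else - k%:R) < tnth t j]).
    apply: bigcupT_measurable => k; apply: sub_sigma_algebra.
    by exists (fun j => if j == i then x else - k%:R).
  apply/seteqP; split => t /=; rewrite in_itv/= andbT.
    move=> xt; pose M := \sum_j `|tnth t j|.
    exists (Num.truncn M).+1 => //= j; case: eqP => [->//|_].
    rewrite ltrNl; apply: le_lt_trans (truncnS_gt M).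
    rewrite /M (bigD1 j)//=; apply: (le_trans (ler_norm _)); rewrite normrN lerDl.
    by apply: sumr_ge0 => ? _.
  by move=> [k _ /(_ i)]; rewrite eqxx.
by move=> mA; have := mid measurableT A mA; rewrite setTI.
Qed.

(** Uniqueness of measures on a generating family: upper rectangles are stable under intersection
    (take maxima of the corners), and those with corner [- k] exhaust the space. *)
Lemma same_law (A : set (N.-tuple R)) : measurable A -> P1 (tU @^-1` A) = P2 (tW @^-1` A).
Proof.
move=> /rects_gen; pose m1 : {measure set (N.-tuple R) -> \bar R} := measure_function_pushforward__canonical__measure_function_Measure P1 mtU.
pose m2 : {measure set (N.-tuple R) -> \bar R} := measure_function_pushforward__canonical__measure_function_Measure P2 mtW.
apply: (@g_sigma_algebra_measure_unique _ R _ rects rects_measurable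
  (fun k => [set t : N.-tuple R | forall j, - k%:R < tnth t j]) _ _ m1 m2).
- by move=> k; exists (fun=> - k%:R).
- apply/seteqP; split => // t _; pose M := \sum_j `|tnth t j|.
  exists (Num.truncn M).+1 => //= j.
  rewrite ltrNl; apply: le_lt_trans (truncnS_gt M).
  rewrite /M (bigD1 j)//=; apply: (le_trans (ler_norm _)); rewrite normrN lerDl.
  by apply: sumr_ge0 => ? _.
- move=> _ _ [a ->] [b ->]; exists (fun i => Num.max (a i) (b i)).
  apply/seteqP; split => t /=.
    by move=> [h1 h2] i; rewrite gt_max h1 h2.
  by move=> h; split=> i; have := h i; rewrite gt_max => /andP[].
- move=> _ [a ->]; have := same_rect a.
  rewrite /m1 /m2 /= /pushforward /=.
  rewrite (_ : [set x | forall i, a i < U i x] = tU @^-1` [set t | forall i, a i < tnth t i]); last first.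
    by apply/seteqP; split => x /= h i; have := h i; rewrite tnth_mktuple.
  rewrite (_ : [set x | forall i, a i < W i x] = tW @^-1` [set t | forall i, a i < tnth t i])//.
  by apply/seteqP; split => x /= h i; have := h i; rewrite tnth_mktuple.
- move=> k; rewrite -ge0_fin_numE// fin_num_measure//.
  rewrite -[X in measurable X]setTI; apply: mtU => //.
  by apply: rects_measurable; exists (fun=> - k%:R).
Qed.

Lemma same_integral (h : N.-tuple R -> \bar R) : measurable_fun setT h -> (forall t, 0 <= h t)%E ->
  (\int[P1]_x h (mktuple (fun i => U i x)) = \int[P2]_x h (mktuple (fun i => W i x)))%E.
Proof.
move=> mh h0.
rewrite -[LHS](@ge0_integral_pushforward _ _ _ _ _ _ mtU P1 setT h)//.
rewrite -[RHS](@ge0_integral_pushforward _ _ _ _ _ _ mtW P2 setT h)//.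
by apply: eq_measure_integral => A mA _; exact: same_law.
Qed.
End cramer_wold.

(** * Concentration of Gaussian suprema *)

Section gaussian_convolution.
Context (R : realType).
Local Notation mu := (@lebesgue_measure R).

(** The expectation of [h] under the centered normal law of deviation [s], a Dirac mass at 0 when
    [s] is 0. *)
Definition gauss_int (s : R) (h : R -> \bar R) : \bar R :=
  if s == 0 then h 0 else (\int[mu]_x (h x * (normal_pdf 0 s x)%:E))%E.

Lemma gauss_int_sq (s t : R) h : s ^+ 2 = t ^+ 2 -> gauss_int s h = gauss_int t h.
Proof.
move=> st; have e0 : (s == 0) = (t == 0) by rewrite -[LHS]sqrf_eq0 st sqrf_eq0.
by rewrite /gauss_int e0 (normal_pdf_sq st).
Qed.

Lemma integral_law_gauss_int d (T : measurableType d) (P : probability T R) f s (h : R -> \bar R) :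
  has_law P f 0 s -> (forall x, 0 <= h x)%E -> measurable_fun setT h ->
  (\int[P]_w h (f w))%E = gauss_int s h.
Proof. by move=> lf h0 mh; rewrite (integral_law lf h0 mh). Qed.

(** Independence is expressed by the product measure: Tonelli reduces the sum to a convolution. The
    cases [t = 0] and [s = 0] are apart because a Dirac mass has no density. *)
Lemma product_law d1 d2 (T1 : measurableType d1) (T2 : measurableType d2)
    (P1 : probability T1 R) (P2 : probability T2 R) (a : T1 -> R) (b : T2 -> R) (s t : R)
    (h : R -> R) :
  has_law P1 a 0 s -> has_law P2 b 0 t -> continuous h -> (forall x, 0 <= h x) ->
  (\int[P1 \x P2]_x (h (a x.1 + b x.2))%:E)%E =
  gauss_int (Num.sqrt (s ^+ 2 + t ^+ 2)) (fun x => (h x)%:E).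
Proof.
move=> la lb ch h0.
have mh : measurable_fun setT h by exact: continuous_measurable_fun.
have mhD (x : R) : measurable_fun setT (fun y => (h (x + y))%:E).
  by apply/measurable_EFinP; apply: measurableT_comp => //; exact: measurable_funD.
have m1 : measurable_fun setT (fun x : T1 * T2 => (h (a x.1 + b x.2))%:E).
  apply/measurable_EFinP; apply: measurableT_comp => //; apply: measurable_funD.
    by apply: measurableT_comp => //; exact: la.1.
  by apply: measurableT_comp => //; exact: lb.1.
rewrite fubini_tonelli1//; last by move=> x; rewrite lee_fin.
rewrite /fubini_F/=.
under eq_integral => x _.
  rewrite (@integral_law_gauss_int _ _ P2 b t (fun y => (h (a x + y))%:E))//; last by move=> y; rewrite lee_fin.
  over.
rewrite /=; case: (eqVneq t 0) => [t0|t0].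
  have e x : gauss_int t (fun y => (h (x + y))%:E) = (h x)%:E.
    by rewrite /gauss_int t0 eqxx addr0.
  transitivity (\int[P1]_x (h (a x))%:E)%E; first by apply: eq_integral => x _; exact: e.
  transitivity (gauss_int s (fun x => (h x)%:E)).
    apply: (@integral_law_gauss_int _ _ P1 a s (fun x => (h x)%:E)) => //.
    exact/measurable_EFinP.
  by apply: gauss_int_sq; rewrite t0 expr0n/= addr0 sqr_sqrtr// sqr_ge0.
have mF : measurable_fun setT (fun x : R => gauss_int t (fun y => (h (x + y))%:E)).
  rewrite /gauss_int (negbTE t0).
  apply: (@measurable_fun_fubini_tonelli_F _ _ _ _ _ mu
    (fun xy : R * R => ((h (xy.1 + xy.2))%:E * (normal_pdf 0 t xy.2)%:E)%E)).
    apply: emeasurable_funM; apply/measurable_EFinP; apply: measurableT_comp => //.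
      exact: measurable_funD.
    exact: measurable_normal_pdf.
  by move=> xy; rewrite -EFinM lee_fin mulr_ge0 ?normal_pdf_ge0.
have F0 x : (0 <= gauss_int t (fun y => (h (x + y))%:E))%E.
  rewrite /gauss_int (negbTE t0); apply: integral_ge0 => y _.
  by rewrite -EFinM lee_fin mulr_ge0 ?normal_pdf_ge0.
rewrite (@integral_law_gauss_int _ _ P1 a s (fun x => gauss_int t (fun y => (h (x + y))%:E)))//.
case: (eqVneq s 0) => [s0|s0].
  transitivity (gauss_int t (fun x => (h x)%:E)).
    rewrite [LHS]/gauss_int s0 eqxx; congr gauss_int.
    by apply/funext => x; rewrite add0r.
  by apply: gauss_int_sq; rewrite s0 expr0n/= add0r sqr_sqrtr// sqr_ge0.
rewrite /gauss_int (negbTE s0) (negbTE t0) ifF; last first.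
  apply/negbTE; rewrite gt_eqF// sqrtr_gt0 addr_gt0// exprn_even_gt0//.
exact: normal_conv.
Qed.
End gaussian_convolution.

(** * Rotation of two independent copies of a Gaussian vector *)

Section rotation.
Context d (T : measurableType d) (R : realType) (P : probability T R).
Context (M : nat) (V : 'I_M -> T -> R).
Hypothesis gV : forall l : 'I_M -> R, exists s, has_law P (fun w => \sum_i l i * V i w) 0 s.

Let mV i : measurable_fun setT (V i).
Proof.
have [s [ms _]] := gV (fun j => (j == i)%:R).
rewrite (_ : V i = fun w => \sum_j (j == i)%:R * V j w)//.
apply/funext => w; rewrite (bigD1 i)//= eqxx mul1r big1 ?addr0// => j /negbTE ->.
by rewrite mul0r.
Qed.

(* For independent copies of [V], the law of this family does not depend on [phi];
   increasing [phi] rotates the first half towards the second copy. *)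
Definition rot_fam (phi : R) (i : 'I_(M + M)) (x : T * T) : R :=
  match fintype.split i with
  | inl i => cos phi * V i x.1 + sin phi * V i x.2
  | inr i => - sin phi * V i x.1 + cos phi * V i x.2
  end.

Lemma measurable_rot_fam phi i : measurable_fun setT (rot_fam phi i).
Proof.
rewrite /rot_fam; case: fintype.split => j; apply: measurable_funD; apply: measurable_funM => //;
  exact: measurableT_comp.
Qed.

Lemma rot_fam_sum phi (l : 'I_(M + M) -> R) x :
  \sum_i l i * rot_fam phi i x =
  \sum_i (cos phi * l (lshift M i) - sin phi * l (rshift M i)) * V i x.1 +
  \sum_i (sin phi * l (lshift M i) + cos phi * l (rshift M i)) * V i x.2.
Proof.
rewrite big_split_ord/= -!big_split/=; apply: eq_bigr => i _.
by rewrite /rot_fam (unsplitK (inl i)) (unsplitK (inr i)); ring.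
Qed.

(** The rotation preserves the sum of the two squares at each point, before any integration, so the
    covariance of the two combinations never has to be computed. *)
Lemma rot_fam_var (phi : R) (l m : 'I_M -> R) (s t s' t' : R) :
  has_law P (fun w => \sum_i l i * V i w) 0 s ->
  has_law P (fun w => \sum_i m i * V i w) 0 t ->
  has_law P (fun w => \sum_i (cos phi * l i - sin phi * m i) * V i w) 0 s' ->
  has_law P (fun w => \sum_i (sin phi * l i + cos phi * m i) * V i w) 0 t' ->
  s' ^+ 2 + t' ^+ 2 = s ^+ 2 + t ^+ 2.
Proof.
move=> /law_sqr[i1 e1] /law_sqr[i2 e2] /law_sqr[i3 e3] /law_sqr[i4 e4].
apply: EFin_inj; rewrite !EFinD -e1 -e2 -e3 -e4 -!integralD//.
apply: eq_integral => w _; rewrite -!EFinD; congr EFin.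
have -> : \sum_i (cos phi * l i - sin phi * m i) * V i w =
    cos phi * \sum_i l i * V i w - sin phi * \sum_i m i * V i w.
  by rewrite !mulr_sumr -sumrB; apply: eq_bigr => i _; ring.
have -> : \sum_i (sin phi * l i + cos phi * m i) * V i w =
    sin phi * \sum_i l i * V i w + cos phi * \sum_i m i * V i w.
  by rewrite !mulr_sumr -big_split /=; apply: eq_bigr => i _; ring.
move: (\sum_i _) (\sum_i _) => A B.
rewrite -[RHS]mul1r -(cos2Dsin2 phi).
by ring.
Qed.

Lemma rot_fam_cos phi (l : 'I_(M + M) -> R) c :
  \int[(P \x P)%E]_x cos (\sum_i l i * rot_fam phi i x + c) =
  \int[(P \x P)%E]_x cos (\sum_i l i * rot_fam 0 i x + c).
Proof.
(* [1 + cos] is nonnegative, as [product_law] demands; the right-hand side does not contain [psi],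
   and the 1 is removed at the end. *)
have key psi s t : has_law P (fun w => \sum_i l (lshift M i) * V i w) 0 s ->
    has_law P (fun w => \sum_i l (rshift M i) * V i w) 0 t ->
    (\int[P \x P]_x (1 + cos (\sum_i l i * rot_fam psi i x + c))%:E)%E =
    gauss_int (Num.sqrt (s ^+ 2 + t ^+ 2)) (fun x => (1 + cos (x + c))%:E).
  move=> ls lt.
  have [s' ls'] := gV (fun i => cos psi * l (lshift M i) - sin psi * l (rshift M i)).
  have [t' lt'] := gV (fun i => sin psi * l (lshift M i) + cos psi * l (rshift M i)).
  under eq_integral do rewrite rot_fam_sum.
  rewrite (product_law (h := fun x => 1 + cos (x + c)) ls' lt').
  - by rewrite (rot_fam_var ls lt ls' lt').
  - move=> x; apply: cvgD; first exact: cvg_cst.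
    apply: (@continuous_comp _ _ _ (fun x => x + c) cos); last exact: continuous_cos.
    by apply: cvgD; [exact: cvg_id|exact: cvg_cst].
  - by move=> x; rewrite -lerBlDl sub0r cos_geN1.
have mc psi : measurable_fun setT (fun x => cos (\sum_i l i * rot_fam psi i x + c)).
  apply: measurableT_comp; first by apply: continuous_measurable_fun; exact: continuous_cos.
  apply: measurable_funD => //; apply: measurable_sum => i.
  by apply: measurable_funM => //; exact: measurable_rot_fam.
have ic psi : (P \x P)%E.-integrable setT (fun x => (cos (\sum_i l i * rot_fam psi i x + c))%:E).
  apply: (@bounded_integrable _ _ _ (P \x P)%E _ 1) => //.
  by move=> x; rewrite ler_norml cos_geN1 cos_le1.
have [s ls] := gV (fun i => l (lshift M i)).
have [t lt] := gV (fun i => l (rshift M i)).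
have e1 psi : (1 + \int[P \x P]_x (cos (\sum_i l i * rot_fam psi i x + c))%:E)%E =
    gauss_int (Num.sqrt (s ^+ 2 + t ^+ 2)) (fun x => (1 + cos (x + c))%:E).
  rewrite -(key psi s t ls lt); under [RHS]eq_integral do rewrite EFinD.
  have ic1 : (P \x P)%E.-integrable setT (cst 1%:E : T * T -> \bar R).
    by apply: (@bounded_integrable _ _ _ (P \x P)%E (cst 1) 1) => // x; rewrite normr1.
  rewrite (@integralD _ _ _ (P \x P)%E _ measurableT _ _ ic1 (ic psi)); congr (_ + _)%E.
  by rewrite integral_cst// mul1e; apply/esym; exact: (@probability_setT _ _ _ (P \x P)%E).
have := e1 phi; rewrite -(e1 0) /Rintegral.
have f1 psi : (\int[P \x P]_x (cos (\sum_i l i * rot_fam psi i x + c))%:E)%E \is a fin_num.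
  exact: integrable_fin_num.
move: (f1 phi) (f1 0); case: (\int[_]_x _)%E => // r _; case: (\int[_]_x _)%E => // r' _.
by move=> /(congr1 fine)/= /addrI.
Qed.

Lemma rot_fam_integral phi (h : (M + M).-tuple R -> \bar R) :
  measurable_fun setT h -> (forall t, 0 <= h t)%E ->
  (\int[P \x P]_x h (mktuple (fun i => rot_fam phi i x)) =
   \int[P \x P]_x h (mktuple (fun i => rot_fam 0 i x)))%E.
Proof.
apply: (@same_integral _ _ _ _ R (P \x P)%E (P \x P)%E).
- exact: measurable_rot_fam.
- exact: measurable_rot_fam.
- exact: rot_fam_cos.
Qed.

End rotation.

(** * Concentration of the maximum of a finite Gaussian family *)

Section concentration.
Context d (T : measurableType d) (R : realType) (P : probability T R).

Lemma expR_convex_comb (dl x : R) : 0 <= dl <= 1 -> expR (dl * x) <= 1 - dl + dl * expR x.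
Proof.
move=> /andP[d0 d1].
have h1 := expR_ge1Dx (- (dl * x)); have h2 := expR_ge1Dx (x - dl * x).
have e0 := expR_gt0 (dl * x).
have E : expR x = expR (dl * x) * expR (x - dl * x) by rewrite -expRD addrC subrK.
have E1 : 1 = expR (dl * x) * expR (- (dl * x)) by rewrite -expRD addrN expR0.
have -> : 1 - dl + dl * expR x = expR (dl * x) * ((1 - dl) * expR (- (dl * x)) + dl * expR (x - dl * x)).
  rewrite E {1}E1; move: E1; set a := expR _; set b := expR _; set c := expR _ => E1.
  rewrite {1}(_ : dl = dl * (a * b)); first by ring.
  by rewrite -E1 mulr1.
rewrite ler_peMr ?(ltW e0)//.
have h3 : (1 - dl) * (1 - dl * x) <= (1 - dl) * expR (- (dl * x)) by rewrite ler_wpM2l// subr_ge0.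
have h4 : dl * (1 + (x - dl * x)) <= dl * expR (x - dl * x) by rewrite ler_wpM2l.
lra.
Qed.

Lemma expR_jensen m (a : 'I_m.+1 -> R) :
  expR (\sum_i a i) <= m.+1%:R^-1 * \sum_i expR (m.+1%:R * a i).
Proof.
set s := \sum_i a i.
have m0 : (0 : R) < m.+1%:R by [].
rewrite mulrC ler_pdivlMr// mulrC.
have -> : m.+1%:R * expR s = \sum_(i < m.+1) expR s * (1 + (m.+1%:R * a i - s)).
  rewrite -mulr_sumr mulrC big_split/= sumrB sumr_const card_ord -mulr_sumr -/s.
  by rewrite sumr_const card_ord (mulr_natl s) addrN addr0.
apply: ler_sum => i _; rewrite -[X in _ <= expR X](subrK s) expRD mulrC [leRHS]mulrC.
rewrite mulrC.
by rewrite ler_wpM2l ?expR_ge0// expR_ge1Dx.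
Qed.

Lemma sin_le_id (x : R) : 0 <= x -> sin x <= x.
Proof.
move=> x0; pose f (y : R) := y - sin y.
have df (y : R) : is_derive y 1 f (1 - cos y) by rewrite /f; apply: is_deriveB.
suff : f 0 <= f x by rewrite /f sin0 subrr subr_ge0.
apply: (@ger0_derive1_le_cc R f 0 x) => //.
- by move=> y _; rewrite derive1E; have [_ ->] := df y; rewrite subr_ge0 cos_le1.
- apply: continuous_subspaceT => y; apply: differentiable_continuous.
  by apply/derivable1_diffP; have [] := df y.
- by rewrite in_itv/= lexx x0.
- by rewrite in_itv/= lexx x0.
Qed.

Lemma one_sub_cos_le (x : R) : 0 <= x -> x <= pi -> 0 <= 1 - cos x <= x ^+ 2 / 2.
Proof.
move=> x0 xpi; rewrite subr_ge0 cos_le1/=.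
have -> : cos x = 1 - 2 * sin (x / 2) ^+ 2.
  rewrite {1}(_ : x = x / 2 + x / 2); last by field.
  rewrite cosD -!expr2; have := cos2Dsin2 (x / 2); lra.
have h : sin (x / 2) ^+ 2 <= (x / 2) ^+ 2.
  rewrite lerXn2r ?nnegrE ?divr_ge0 ?sin_le_id ?divr_ge0//.
  apply: sin_ge0_pi; rewrite divr_ge0//= ler_pdivrMr//.
  by have := pi_ge0 R; lra.
lra.
Qed.

Context (M : nat) (V : 'I_M -> T -> R).
Hypothesis gV : forall l : 'I_M -> R, exists s, has_law P (fun w => \sum_i l i * V i w) 0 s.

Let mV i : measurable_fun setT (V i).
Proof.
have [s [ms _]] := gV (fun j => (j == i)%:R).
rewrite (_ : V i = fun w => \sum_j (j == i)%:R * V j w)//.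
apply/funext => w; rewrite (bigD1 i)//= eqxx mul1r big1 ?addr0// => j /negbTE ->.
by rewrite mul0r.
Qed.

Context (s2 : R).
Hypothesis lawV : forall i, exists2 s, has_law P (V i) 0 s & s ^+ 2 <= s2.

(* Ties are broken by the smallest index so that exactly one index is selected. *)
Definition first_max (u : 'I_M -> R) (i : 'I_M) : bool :=
  [forall j, (u j <= u i) && ((j < i)%N ==> (u j < u i))].

Lemma first_max_uniq u i j : first_max u i -> first_max u j -> i = j.
Proof.
move=> /forallP hi /forallP hj; apply/val_inj/eqP.
have /andP[_ h1] := hi j; have /andP[_ h2] := hj i.
have /andP[h3 _] := hi j; have /andP[h4 _] := hj i.
have [ij|ij|//] := ltngtP i j.
  by move: h2; rewrite ij/= ltNge h3.
by move: h1; rewrite ij/= ltNge h4.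
Qed.

Lemma first_max_ex u (i0 : 'I_M) : exists i, first_max u i.
Proof.
pose Q (n : nat) := [exists i : 'I_M, (val i == n) && [forall j, u j <= u i]].
have exQ : exists n, Q n.
  have [i _ hi] := @arg_maxP _ _ _ i0 xpredT u isT.
  exists i; apply/existsP; exists i; rewrite eqxx/=; apply/forallP => j; exact: hi.
have [n /existsP[i /andP[/eqP <- /forallP hi]] hn] := find_ex_minn exQ.
exists i; apply/forallP => j; rewrite hi/=; apply/implyP => ji.
rewrite lt_neqAle hi andbT; apply/eqP => e.
have : Q j by apply/existsP; exists j; rewrite eqxx/=; apply/forallP => k; rewrite e hi.
by move=> /hn; rewrite leqNgt ji.
Qed.

Lemma first_max_sum_le u (f : 'I_M -> R) (B : R) : 0 <= B -> (forall i, f i <= B) ->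
  \sum_i (first_max u i)%:R * f i <= B.
Proof.
move=> B0 fB; case: (pselect (exists i, first_max u i)) => [[i hi]|h].
  rewrite (bigD1 i)//= hi mul1r big1 ?addr0// => j ji.
  case: (boolP (first_max u j)) => [hj|]; last by rewrite mul0r.
  by rewrite (first_max_uniq hj hi) eqxx in ji.
rewrite big1// => i _; case: (boolP (first_max u i)) => [hi|]; last by rewrite mul0r.
by exfalso; apply: h; exists i.
Qed.

(* Bounds the exponential of the increment of the maximum along one rotation step:
   if [i] maximizes the rotated family [u], with orthogonal part [w], then before
   the step the maximum is at least [u i * cos th - w i * sin th]. *)
Definition Hfun (dl c : R) (t : (M + M).-tuple R) : R :=
  \sum_i (first_max (fun j => tnth t (lshift M j)) i)%:R *
    (expR (dl * tnth t (lshift M i)) * expR (c * tnth t (rshift M i))).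

Lemma measurable_first_max d' (T' : measurableType d') (u : 'I_M -> T' -> R) i :
  (forall j, measurable_fun setT (u j)) ->
  measurable_fun setT (fun x => (first_max (u^~ x) i)%:R : R).
Proof.
move=> mu; rewrite (_ : (fun x => _) = fun x => \prod_j (((u j x <= u i x)%R && ((j < i)%N ==> (u j x < u i x)%R))%:R : R)).
  apply: measurable_prod => j _.
  apply: (@measurableT_comp _ _ _ _ _ _ (fun b : bool => (b%:R : R))) => //.
  apply: measurable_and; first exact: measurable_fun_ler.
  by case: (ltnP j i) => _ /=; [exact: measurable_fun_ltr|exact: measurable_cst].
apply/funext => x; case: (boolP (first_max _ i)) => [/forallP h|].
  by rewrite big1// => j _; rewrite h.
by rewrite negb_forall => /existsP[j hj]; rewrite (bigD1 j)//= (negbTE hj) mul0r.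
Qed.

Lemma measurable_Hfun dl c : measurable_fun setT (Hfun dl c).
Proof.
apply: measurable_sum => i; apply: measurable_funM.
  by apply: (@measurable_first_max _ _ (fun j (t : (M + M).-tuple R) => tnth t (lshift M j))) => j; exact: measurable_tnth.
by apply: measurable_funM; apply: measurableT_comp => //; apply: measurable_funM => //; exact: measurable_tnth.
Qed.

Lemma Hfun_ge0 dl c t : 0 <= Hfun dl c t.
Proof. by apply: sumr_ge0 => i _; rewrite !mulr_ge0 ?expR_ge0. Qed.

Lemma integral_expR_le i c : (\int[P]_w (expR (c * V i w))%:E <= (expR (c ^+ 2 * s2 / 2))%:E)%E.
Proof.
have [s ls hs] := lawV i; rewrite (law_expR _ ls) lee_fin ler_expR mulr0 add0r.
by rewrite ler_wpM2r// ler_wpM2l// sqr_ge0.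
Qed.

(** At angle 0 the selected index depends on the first copy only and the orthogonal part on the
    second. Integrating out the second copy gives the exponential factor; the selection then costs
    at most [1 + dl * C] by convexity of the exponential. *)
Lemma integral_Hfun_le dl c : 0 <= dl <= 1 ->
  (\int[P \x P]_x (Hfun dl c (mktuple (fun i => rot_fam V 0 i x)))%:E <=
  (expR (c ^+ 2 * s2 / 2) * (1 + dl * (M%:R * expR (s2 / 2))))%:E)%E.
Proof.
move=> dl01; have /andP[dl0 dl1] := dl01.
pose g i (w : T) : R := (first_max (V^~ w) i)%:R * expR (dl * V i w).
have g0 i w : 0 <= g i w by rewrite mulr_ge0 ?expR_ge0.
have mg i : measurable_fun setT (g i).
  apply: measurable_funM; first exact: measurable_first_max.
  by apply: measurableT_comp => //; exact: measurable_funM.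
have E x : Hfun dl c (mktuple (fun i => rot_fam V 0 i x)) = \sum_i g i x.1 * expR (c * V i x.2).
  apply: eq_bigr => i _; rewrite !tnth_mktuple /g mulrA.
  have eu j : rot_fam V 0 (lshift M j) x = V j x.1.
    by rewrite /rot_fam (unsplitK (inl j)) cos0 sin0 mul1r mul0r addr0.
  have ew j : rot_fam V 0 (rshift M j) x = V j x.2.
    by rewrite /rot_fam (unsplitK (inr j)) cos0 sin0 mul1r oppr0 mul0r add0r.
  rewrite eu ew; congr ((first_max _ i)%:R * _ * _).
  by apply/funext => j; rewrite tnth_mktuple eu.
under eq_integral do rewrite E.
have me i : measurable_fun setT (fun w => (expR (c * V i w))%:E).
  by apply/measurable_EFinP; apply: measurableT_comp => //; exact: measurable_funM.
have mge i : measurable_fun setT (fun x : T * T => (g i x.1 * expR (c * V i x.2))%:E).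
  apply/measurable_EFinP; apply: measurable_funM; first exact: measurableT_comp.
  by apply: measurableT_comp => //; apply: measurable_funM => //; exact: measurableT_comp.
have h i : (\int[P \x P]_x (g i x.1 * expR (c * V i x.2))%:E <=
    (expR (c ^+ 2 * s2 / 2))%:E * \int[P]_w (g i w)%:E)%E.
  rewrite fubini_tonelli1//; last by move=> x; rewrite lee_fin mulr_ge0 ?expR_ge0.
  have mgi : measurable_fun setT (fun w => (g i w)%:E) by apply/measurable_EFinP; exact: mg.
  rewrite /fubini_F/= -ge0_integralZl//; last by move=> w _; rewrite lee_fin.
  apply: ge0_le_integral => //.
  - by move=> w _; apply: integral_ge0 => w' _; rewrite lee_fin mulr_ge0 ?expR_ge0.
  - apply: (@measurable_fun_fubini_tonelli_F _ _ _ _ _ P (fun x : T * T => (g i x.1 * expR (c * V i x.2))%:E)) => //.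
    by move=> x; rewrite lee_fin mulr_ge0 ?expR_ge0.
  - exact: emeasurable_funM.
  - move=> w _; under eq_integral do rewrite EFinM.
    rewrite ge0_integralZl//; last by rewrite lee_fin.
    by rewrite muleC lee_wpmul2r ?lee_fin// integral_expR_le.
under eq_integral do rewrite -sumEFin.
rewrite ge0_integral_sum//; last by move=> i x _; rewrite lee_fin mulr_ge0 ?expR_ge0.
apply: (@le_trans _ _ (\sum_i (expR (c ^+ 2 * s2 / 2))%:E * \int[P]_w (g i w)%:E)%E).
  by apply: lee_sum.
rewrite -ge0_sume_distrr; last by move=> i _; apply: integral_ge0 => w _; rewrite lee_fin.
rewrite EFinM lee_wpmul2l ?lee_fin ?expR_ge0//.
rewrite -ge0_integral_sum//; last 2 first.
- by move=> i; exact/measurable_EFinP.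
- by move=> i x _; rewrite lee_fin.
apply: (@le_trans _ _ (\int[P]_w (1%:E + dl%:E * (\sum_i (expR (V i w))%:E)))%E).
  apply: ge0_le_integral => //.
  - by move=> w _; rewrite sumEFin lee_fin sumr_ge0.
  - by apply: emeasurable_sum => i; exact/measurable_EFinP.
  - apply: emeasurable_funD => //; apply: emeasurable_funM => //; apply: emeasurable_sum => i.
    by apply/measurable_EFinP; exact: measurableT_comp.
  - move=> w _; rewrite !sumEFin -EFinM -EFinD lee_fin.
    apply: first_max_sum_le.
      by rewrite addr_ge0// mulr_ge0// sumr_ge0// => i _; rewrite expR_ge0.
    move=> i; apply: (le_trans (expR_convex_comb _ dl01)); apply: lerD; first by rewrite gerBl.
    by rewrite ler_wpM2l// (bigD1 i)//= lerDl sumr_ge0// => j _; rewrite expR_ge0.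
have ie i : P.-integrable setT (fun w => (expR (V i w))%:E).
  have [s ls _] := lawV i; have := law_integrable_expR 1 ls.
  by under eq_fun do rewrite mul1r.
have is_ : P.-integrable setT (fun w => \sum_i (expR (V i w))%:E)%E.
  by apply: integrable_sum => // i _; exact: ie.
rewrite integralD//; last 2 first.
- by apply: (@bounded_integrable _ _ _ P (cst 1) 1) => // x; rewrite normr1.
- exact: integrableZl.
rewrite integral_cst// mul1e [X in (X + _)%E](_ : _ = 1%E); last exact: probability_setT.
rewrite EFinD leeD2l// integralZl// EFinM lee_wpmul2l ?lee_fin//.
rewrite integral_sum//.
apply: (@le_trans _ _ (\sum_(i < M) (expR (s2 / 2))%:E)%E).
  apply: lee_sum => i _; have := integral_expR_le i 1; rewrite expr1n mul1r.
  by apply: le_trans; rewrite le_eqVlt; apply/orP; left; apply/eqP; apply: eq_integral => w _; rewrite mul1r.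
by rewrite sumEFin lee_fin sumr_const card_ord mulr_natl.
Qed.

Hypothesis M0 : (0 < M)%N.

Let mx (u : 'I_M -> R) : R := \big[Order.max/u (Ordinal M0)]_i u i.

Let mx_first u i : first_max u i -> mx u = u i.
Proof.
move=> /forallP h; apply/eqP; rewrite eq_le; apply/andP; split.
  apply: bigmax_le => [|j _]; first by have /andP[] := h (Ordinal M0).
  by have /andP[] := h j.
exact: le_bigmax.
Qed.

Let s2_ge0 : 0 <= s2.
Proof. by have [s _] := lawV (Ordinal M0); apply: le_trans; rewrite sqr_ge0. Qed.

Let rot_step (lam ph th : R) x : 0 <= lam ->
  expR (lam * (mx (fun i => rot_fam V (ph + th) (lshift M i) x) -
               mx (fun i => rot_fam V ph (lshift M i) x))) <=
  Hfun (lam * (1 - cos th)) (lam * sin th) (mktuple (fun i => rot_fam V (ph + th) i x)).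
Proof.
move=> lam0; set u := fun i => rot_fam V (ph + th) (lshift M i) x.
pose w i := rot_fam V (ph + th) (rshift M i) x.
have [i hi] := first_max_ex u (Ordinal M0).
rewrite /Hfun.
have -> : (fun j => tnth [tuple rot_fam V (ph + th) i x | i < M + M] (lshift M j)) = u.
  by apply/funext => j; rewrite tnth_mktuple.
rewrite (bigD1 i)//= hi mul1r !tnth_mktuple -expRD.
apply: (@le_trans _ _ (expR (lam * (1 - cos th) * u i + lam * sin th * w i))); last first.
  by rewrite lerDl sumr_ge0// => j _; rewrite !mulr_ge0 ?expR_ge0.
rewrite ler_expR (mx_first hi) -!mulrA -mulrDr ler_wpM2l//.
(* Rotating back by [th]: the family at angle [ph] is [cos th] times [u] minus [sin th] times
   [w]. *)
have -> : (1 - cos th) * u i + sin th * w i = u i - rot_fam V ph (lshift M i) x.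
  have cp : cos ph = cos (ph + th) * cos th + sin (ph + th) * sin th by rewrite -cosB addrK.
  have sp : sin ph = sin (ph + th) * cos th - cos (ph + th) * sin th by rewrite -sinB addrK.
  by rewrite /u /w /rot_fam (unsplitK (inl i)) (unsplitK (inr i)) cp sp; ring.
by rewrite lerD2l lerN2; exact: (le_bigmax _ (fun i => rot_fam V ph (lshift M i) x)).
Qed.

(** A quarter turn carries the first copy to the second. The increment of the maximum is telescoped
    over [m.+1] equal rotations, and Jensen turns the exponential of the sum into an average of
    exponentials. *)
Let rot_chain (lam : R) m x : 0 <= lam -> let th := pi / 2 / m.+1%:R in
  expR (lam * (mx (V^~ x.2) - mx (V^~ x.1))) <=
  m.+1%:R^-1 * \sum_(j < m.+1) Hfun (m.+1%:R * lam * (1 - cos th)) (m.+1%:R * lam * sin th)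
    (mktuple (fun i => rot_fam V (j.+1%:R * th) i x)).
Proof.
move=> lam0; set th := pi / 2 / m.+1%:R; rewrite /=.
pose F (j : nat) := mx (fun i => rot_fam V (j%:R * th) (lshift M i) x).
have F0 : F 0%N = mx (V^~ x.1).
  congr mx; apply/funext => i; rewrite mul0r /rot_fam (unsplitK (inl i)) cos0 sin0; ring.
have Fm : F m.+1 = mx (V^~ x.2).
  congr mx; apply/funext => i; rewrite /th mulrC divfK ?pnatr_eq0//.
  by rewrite /rot_fam (unsplitK (inl i)) cos_pihalf sin_pihalf; ring.
rewrite -Fm -F0.
have -> : lam * (F m.+1 - F 0%N) = \sum_(j < m.+1) lam * (F j.+1 - F j).
  rewrite -mulr_sumr -(big_mkord xpredT (fun j => F j.+1 - F j)).
  by rewrite telescope_sumr.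
apply: (le_trans (expR_jensen _)); rewrite ler_wpM2l//.
apply: ler_sum => j _; rewrite mulrA.
have := @rot_step (m.+1%:R * lam) (j%:R * th) th x.
have -> : j%:R * th + th = j.+1%:R * th by rewrite -[in RHS]natr1 mulrDl mul1r.
by apply; rewrite mulr_ge0.
Qed.

(** On the product of the two events, the maximum grows by at least [r - s] from the first copy to
    the second. By rotation invariance every term of [rot_chain] has the integral of angle 0. The
    size [M] enters only through the number of rotations, not through the bound. *)
Lemma sup_concentration (r s lam : R) : 0 <= lam ->
  (P [set w | exists i, (r < V i w)%R] * P [set w | forall i, (V i w <= s)%R] * (expR (lam * (r - s)))%:E
   <= (2 * expR (2 * lam ^+ 2 * s2))%:E)%E.
Proof.
move=> lam0.
set A := [set w | exists i, r < V i w]; set B := [set w | forall i, V i w <= s].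
have mA : measurable A.
  rewrite (_ : A = \bigcup_(i in [set: 'I_M]) (V i @^-1` `]r, +oo[)).
    apply: fin_bigcup_measurable => // i _; rewrite -[X in measurable X]setTI; exact: mV.
  apply/seteqP; split => w /=; first by move=> [i ri]; exists i => //=; rewrite in_itv/= ri.
  by move=> [i _]; rewrite /= in_itv/= andbT => ri; exists i.
have mB : measurable B.
  rewrite (_ : B = \bigcap_(i in [set: 'I_M]) (V i @^-1` `]-oo, s])).
    apply: fin_bigcap_measurable => // i _; rewrite -[X in measurable X]setTI; exact: mV.
  apply/seteqP; split => w /=; first by move=> h i _; rewrite /= in_itv/= h.
  by move=> h i; have := h i I; rewrite /= in_itv.
pose C := M%:R * expR (s2 / 2).
have C0 : 0 <= C by rewrite mulr_ge0 ?expR_ge0.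
(* With this many rotations [dl], which is at most [2 * lam / m.+1%:R] since [pi <= 4], satisfies
   [dl * C <= 1], so the selection factor is at most 2. *)
pose m := Num.truncn (2 * lam * (1 + C)).
have m0 : (0 : R) < m.+1%:R by [].
have hm : 2 * lam * (1 + C) <= m.+1%:R by apply/ltW; rewrite truncnS_gt.
pose th : R := pi / 2 / m.+1%:R.
have p0 := pi_ge0 R; have p4 : (pi : R) <= 4 by have /andP[_] := pihalf_02 R; lra.
have th0 : 0 <= th by rewrite !divr_ge0.
have thpi : th <= pi.
  rewrite /th ler_pdivrMr//; apply: (@le_trans _ _ pi); first lra.
  by rewrite ler_peMr// ler1n.
have /andP[c0 c1] := one_sub_cos_le th0 thpi.
have mth : m.+1%:R * th = pi / 2 by rewrite /th mulrC divfK ?pnatr_eq0.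
pose dl := m.+1%:R * lam * (1 - cos th).
have dl0 : 0 <= dl by rewrite !mulr_ge0.
have dlC : dl * (1 + C) <= 1.
  have h1 : dl <= lam * (pi ^+ 2 / 8) / m.+1%:R.
    apply: (@le_trans _ _ (m.+1%:R * lam * (th ^+ 2 / 2))); first by rewrite ler_wpM2l// mulr_ge0.
    by rewrite le_eqVlt; apply/orP; left; apply/eqP; rewrite /th; field; rewrite addrC natr1 pnatr_eq0.
  have h2 : lam * (pi ^+ 2 / 8) / m.+1%:R <= 2 * lam / m.+1%:R.
    rewrite ler_wpM2r ?invr_ge0// mulrC ler_wpM2r// ler_pdivrMr//.
    have : pi ^+ 2 <= (4 : R) ^+ 2 by rewrite lerXn2r ?nnegrE.
    lra.
  apply: (@le_trans _ _ (2 * lam / m.+1%:R * (1 + C))).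
    by rewrite ler_wpM2r ?addr_ge0// (le_trans h1 h2).
  by rewrite mulrAC ler_pdivrMr// mul1r.
have dl1 : dl <= 1 by apply: le_trans dlC; rewrite ler_peMr// lerDl.
have dlC1 : dl * C <= 1 by apply: le_trans dlC; rewrite ler_wpM2l// lerDr.
pose c := m.+1%:R * lam * sin th.
have sth0 : 0 <= sin th by rewrite sin_ge0_pi// th0.
(* Since [sin th <= th], the coefficient is at most [lam * pi / 2], whatever the number of
   rotations. *)
have cl : 0 <= c <= 2 * lam.
  rewrite /c !mulr_ge0//= mulrAC.
  apply: (@le_trans _ _ (m.+1%:R * th * lam)); first by rewrite ler_wpM2r// ler_wpM2l// sin_le_id.
  by rewrite mth ler_wpM2r//; lra.
have c2 : c ^+ 2 * s2 / 2 <= 2 * lam ^+ 2 * s2.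
  have /andP[cc0 cc] := cl.
  have : c ^+ 2 <= (2 * lam) ^+ 2 by rewrite lerXn2r ?nnegrE ?mulr_ge0.
  rewrite -subr_ge0 => h; rewrite -subr_ge0.
  have -> : 2 * lam ^+ 2 * s2 - c ^+ 2 * s2 / 2 = ((2 * lam) ^+ 2 - c ^+ 2) * s2 / 2 by field.
  by rewrite divr_ge0// mulr_ge0.
pose G j x := Hfun dl c (mktuple (fun i => rot_fam V (j.+1%:R * th) i x)).
have mtup ph : measurable_fun setT (fun x => mktuple (fun i => rot_fam V ph i x)).
  apply/measurable_fun_tnthP => i; rewrite (_ : _ \o _ = rot_fam V ph i).
    exact: (measurable_rot_fam gV).
  by apply/funext => x /=; rewrite tnth_mktuple.
have mG j : measurable_fun setT (G j).
  by apply: measurableT_comp; [exact: measurable_Hfun|exact: mtup].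
have IG j : (\int[P \x P]_x (G j x)%:E <= (2 * expR (2 * lam ^+ 2 * s2))%:E)%E.
  rewrite /G (@rot_fam_integral _ _ _ P M V gV (j.+1%:R * th) (fun t => (Hfun dl c t)%:E)).
  - apply: (le_trans (integral_Hfun_le _ _)); first by rewrite dl0 dl1.
    rewrite lee_fin mulrC ler_pM ?expR_ge0 ?ler_expR//.
      by rewrite addr_ge0// mulr_ge0.
    by rewrite -/C; lra.
  - by apply/measurable_EFinP; exact: measurable_Hfun.
  - by move=> t; rewrite lee_fin Hfun_ge0.
have -> : (P A * P B * (expR (lam * (r - s)))%:E =
    \int[P \x P]_x ((expR (lam * (r - s)))%:E * (\1_(B `*` A) x)%:E))%E.
  rewrite ge0_integralZl//; last first.
    by apply/measurable_EFinP; apply: measurable_indic; exact: measurableX.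
  rewrite integral_indic//; last exact: measurableX.
  rewrite setIT; have /= -> := product_measure1E P P mB mA.
  by rewrite muleC; congr (_ * _)%E; rewrite muleC.
apply: (@le_trans _ _ (\int[P \x P]_x (m.+1%:R^-1%:E * \sum_(j < m.+1) (G j x)%:E))%E).
  apply: ge0_le_integral => //.
  - by apply: emeasurable_funM => //; apply/measurable_EFinP; apply: measurable_indic; exact: measurableX.
  - by apply: emeasurable_funM => //; apply: emeasurable_sum => j; exact/measurable_EFinP.
  - move=> x _; rewrite sumEFin -!EFinM lee_fin indicE.
    have avg0 : 0 <= m.+1%:R^-1 * \sum_(j < m.+1) G j x.
      by rewrite mulr_ge0// sumr_ge0// => j _; rewrite Hfun_ge0.
    case: (boolP (x \in _)); rewrite ?mulr0// mulr1 inE => -[Bx [i ri]].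
    apply: le_trans (rot_chain m x lam0).
    rewrite ler_expR ler_wpM2l// lerD//.
      apply: (le_trans (ltW ri)); exact: (le_bigmax _ (V^~ x.2)).
    by rewrite lerN2; apply: bigmax_le => [|j _]; exact: Bx.
have mGE j : measurable_fun setT (fun x => (G j x)%:E) by apply/measurable_EFinP; exact: mG.
have G0 j x : (0 <= (G j x)%:E)%E by rewrite lee_fin Hfun_ge0.
rewrite ge0_integralZl//; last 2 first.
- exact: emeasurable_sum.
- by move=> x _; exact: sume_ge0.
rewrite ge0_integral_sum//.
apply: (@le_trans _ _ (m.+1%:R^-1%:E * \sum_(j < m.+1) (2 * expR (2 * lam ^+ 2 * s2))%:E)%E).
  by rewrite lee_wpmul2l ?lee_fin//; apply: lee_sum.
rewrite sumEFin -EFinM lee_fin sumr_const card_ord -[X in _ * X]mulr_natl mulrA mulVf ?pnatr_eq0//.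
by rewrite mul1r.
Qed.

End concentration.

(** * Discrete measures and the Legendre transform of a kernel *)

Section discrete_kernel.
Context (R : realType) (T : Type).
Implicit Types (K : T -> T -> R) (mu nu : seq (T * R)) (g h : T -> R).

(* The list [mu] of pairs (point, mass) stands for a discrete signed measure. *)
Definition pairing mu g : R := \sum_(p <- mu) p.2 * g p.1.
Definition dscale (s : R) mu := [seq (p.1, s * p.2) | p <- mu].
Definition kpath K mu (t : T) : R := pairing mu (K t).
Definition kform K mu nu : R := pairing mu (kpath K nu).
Definition legendre K mu g : R := pairing mu g - kform K mu mu / 2.

Lemma pairing_cat mu nu g : pairing (mu ++ nu) g = pairing mu g + pairing nu g.
Proof. by rewrite /pairing big_cat. Qed.

Lemma pairing_scale s mu g : pairing (dscale s mu) g = s * pairing mu g.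
Proof. by rewrite /pairing big_map mulr_sumr; apply: eq_bigr => p _ /=; rewrite mulrA. Qed.

Lemma pairingD mu g h : pairing mu (fun t => g t + h t) = pairing mu g + pairing mu h.
Proof. by rewrite /pairing -big_split; apply: eq_bigr => p _; rewrite mulrDr. Qed.

Lemma pairingZ mu s g : pairing mu (fun t => s * g t) = s * pairing mu g.
Proof. by rewrite /pairing mulr_sumr; apply: eq_bigr => p _; rewrite mulrCA. Qed.

Lemma pairing1 t g : pairing [:: (t, 1)] g = g t.
Proof. by rewrite /pairing big_seq1 mul1r. Qed.

Lemma pairing_nil g : pairing [::] g = 0.
Proof. by rewrite /pairing big_nil. Qed.

Lemma eq_pairing mu g h : g =1 h -> pairing mu g = pairing mu h.
Proof. by move=> gh; apply: eq_bigr => p _; rewrite gh. Qed.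

Definition dmass mu : R := \sum_(p <- mu) `|p.2|.

Lemma dmass_ge0 mu : 0 <= dmass mu.
Proof. by apply: sumr_ge0 => p _. Qed.

Lemma pairing_le mu g (B : R) : (forall t, `|g t| <= B) -> `|pairing mu g| <= dmass mu * B.
Proof.
move=> gB; apply: (le_trans (ler_norm_sum _ _ _)); rewrite /dmass mulr_suml.
by apply: ler_sum => p _; rewrite normrM ler_wpM2l.
Qed.

Lemma pairing_sub_le mu g h (B : R) : (forall t, `|g t - h t| <= B) ->
  `|pairing mu g - pairing mu h| <= dmass mu * B.
Proof.
move=> gB; have -> : pairing mu g - pairing mu h = pairing mu (fun t => g t - h t).
  by rewrite /pairing -sumrB; apply: eq_bigr => p _; rewrite mulrBr.
exact: pairing_le.
Qed.

Lemma kpath_cat K mu nu t : kpath K (mu ++ nu) t = kpath K mu t + kpath K nu t.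
Proof. exact: pairing_cat. Qed.

Lemma kpath_scale K s mu t : kpath K (dscale s mu) t = s * kpath K mu t.
Proof. exact: pairing_scale. Qed.

Lemma kform_catl K mu mu' nu : kform K (mu ++ mu') nu = kform K mu nu + kform K mu' nu.
Proof. exact: pairing_cat. Qed.

Lemma kform_catr K mu nu nu' : kform K mu (nu ++ nu') = kform K mu nu + kform K mu nu'.
Proof. by rewrite /kform -pairingD; apply: eq_pairing => t; rewrite kpath_cat. Qed.

Lemma kform_scalel K s mu nu : kform K (dscale s mu) nu = s * kform K mu nu.
Proof. exact: pairing_scale. Qed.

Lemma kform_scaler K s mu nu : kform K mu (dscale s nu) = s * kform K mu nu.
Proof. by rewrite /kform -pairingZ; apply: eq_pairing => t; rewrite kpath_scale. Qed.

Lemma kform_sub_le K L mu nu (B : R) : (forall s t, `|K s t - L s t| <= B) ->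
  `|kform K mu nu - kform L mu nu| <= dmass mu * (dmass nu * B).
Proof. by move=> KL; apply: pairing_sub_le => t; exact: pairing_sub_le. Qed.

Context (K : T -> T -> R).
Hypothesis Ksym : forall s t, K s t = K t s.
Hypothesis Kpos : forall mu, 0 <= kform K mu mu.

Lemma kform_sym mu nu : kform K mu nu = kform K nu mu.
Proof.
rewrite /kform /pairing.
under eq_bigr do rewrite /kpath /pairing mulr_sumr.
rewrite exchange_big/=; apply: eq_bigr => p _; rewrite /kpath /pairing mulr_sumr.
by apply: eq_bigr => p' _; rewrite Ksym mulrCA.
Qed.

Lemma kform1 t nu : kform K [:: (t, 1)] nu = kpath K nu t.
Proof. exact: pairing1. Qed.

Lemma kform11 t : kform K [:: (t, 1)] [:: (t, 1)] = K t t.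
Proof. by rewrite kform1 /kpath pairing1. Qed.

Lemma kdiag_ge0 t : 0 <= K t t.
Proof. by rewrite -kform11. Qed.

Lemma kdiff_ge0 s t : 0 <= K s s + K t t - 2 * K s t.
Proof.
have := Kpos ([:: (s, 1)] ++ dscale (-1) [:: (t, 1)]).
rewrite kform_catl !kform_catr !kform_scalel !kform_scaler !kform1 /kpath !pairing1 (Ksym t s); lra.
Qed.

Lemma legendre_cat mu nu s g : legendre K (mu ++ dscale s nu) g =
  legendre K mu g + s * (pairing nu g - kform K nu mu) - s ^+ 2 * kform K nu nu / 2.
Proof.
rewrite /legendre pairing_cat pairing_scale kform_catl !kform_catr !kform_scalel !kform_scaler.
by rewrite (kform_sym mu nu); field.
Qed.

(** The discriminant bound, taken at the maximizer [D / Q]. When [Q = 0] a linear function bounded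
    above must vanish. *)
Lemma quad_bound (D Q e : R) : 0 <= Q -> (forall s, s * D - s ^+ 2 * Q / 2 <= e) -> D ^+ 2 <= 2 * Q * e.
Proof.
move=> Q0 h; have [Q0'|Qn0] := eqVneq Q 0.
  rewrite Q0' mulr0 mul0r; case: (eqVneq D 0) => [->|D0]; first by rewrite expr0n.
  have := h ((e + 1) / D); rewrite Q0' divfK// mulr0 mul0r subr0; lra.
have Qgt0 : 0 < Q by rewrite lt_neqAle eq_sym Qn0.
have := h (D / Q); have -> : D / Q * D - (D / Q) ^+ 2 * Q / 2 = D ^+ 2 / (2 * Q) by field.
by rewrite ler_pdivrMr ?mulr_gt0// mulrC.
Qed.

Section near_maximizer.
Context (g : T -> R) (C : R).
Hypothesis gC : forall mu, legendre K mu g <= C.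

(** Moving from [mu] in the direction [nu] can gain at most [e]; the gain is a quadratic polynomial
    in the step, so [quad_bound] controls its linear coefficient. With [e = 0] this would say that
    [g] is represented by [mu]. *)
Lemma near_max mu nu (e : R) : C - e <= legendre K mu g ->
  (pairing nu g - kform K nu mu) ^+ 2 <= 2 * kform K nu nu * e.
Proof.
move=> h; apply: quad_bound => // s; have := gC (mu ++ dscale s nu).
rewrite legendre_cat; lra.
Qed.

Lemma near_max_path mu (e : R) t : C - e <= legendre K mu g ->
  (g t - kpath K mu t) ^+ 2 <= 2 * K t t * e.
Proof.
by move=> /(near_max [:: (t, 1)]); rewrite pairing1 kform11 kform1.
Qed.

(** The midpoint of two near maximizers cannot exceed [C]. By the parallelogram identity, maximizing
    sequences are Cauchy for the kernel norm. *)
Lemma near_max_dist mu nu (e : R) : C - e <= legendre K mu g -> C - e <= legendre K nu g ->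
  kform K (mu ++ dscale (-1) nu) (mu ++ dscale (-1) nu) <= 8 * e.
Proof.
move=> h1 h2; have := gC (dscale 2^-1 mu ++ dscale 2^-1 nu); move: h1 h2.
rewrite /legendre pairing_cat !pairing_scale !kform_catl !kform_catr !kform_scalel !kform_scaler (kform_sym nu mu); lra.
Qed.

Lemma near_max_norm mu (e : R) : 0 < e < 1 -> C - e ^+ 2 <= legendre K mu g ->
  C - e ^+ 2 - e * (C + e) / (1 - e) - e <= kform K mu mu / 2 <= (C + e) / (1 - e).
Proof.
move=> /andP[e0 e1] h; have h2 := near_max mu h.
have h3 := gC mu; have Q0 := Kpos mu; move: h h2 h3; rewrite /legendre.
set Q := kform K mu mu in Q0 *; set p := pairing mu g => h h2 h3.
have e1' : 0 < 1 - e by rewrite subr_gt0.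
(* [near_max] in the direction [mu] itself gives [2 * Q * e ^+ 2], which the arithmetic-geometric
   inequality bounds by a perfect square linear in [Q]. *)
have h4 : (p - Q) ^+ 2 <= (e * Q / 2 + e) ^+ 2.
  apply: (le_trans h2); rewrite -subr_ge0.
  have -> : (e * Q / 2 + e) ^+ 2 - 2 * Q * e ^+ 2 = (e * Q / 2 - e) ^+ 2 by field.
  exact: sqr_ge0.
have h5 : `|p - Q| <= e * Q / 2 + e.
  rewrite -[leRHS]ger0_norm; last by rewrite addr_ge0 ?(ltW e0)// divr_ge0// mulr_ge0// ltW.
  by rewrite -ler_sqr ?nnegrE// !real_normK ?num_real.
move: h5; rewrite ler_norml => /andP[h5 h6].
have h7 : Q / 2 <= (C + e) / (1 - e) by rewrite ler_pdivlMr//; lra.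
rewrite h7 andbT.
have : e * (Q / 2) <= e * ((C + e) / (1 - e)) by rewrite ler_wpM2l// ltW.
rewrite mulrA; lra.
Qed.
End near_maximizer.

Definition rate g : \bar R := ereal_sup (range (fun mu => (legendre K mu g)%:E)).

Lemma rate_leP g (a : R) : (rate g <= a%:E)%E <-> forall mu, legendre K mu g <= a.
Proof.
split=> [h mu|h].
  by rewrite -lee_fin; apply: le_trans h; apply: ereal_sup_ubound; exists mu.
by apply: ge_ereal_sup => _ [mu _ <-]; rewrite lee_fin.
Qed.

Lemma rate_gtP g (a : R) : (a%:E < rate g)%E <-> exists mu, a < legendre K mu g.
Proof.
split=> [/ereal_sup_gt[_ [mu _ <-]]|[mu h]]; first by rewrite lte_fin; exists mu.
by apply: (@lt_le_trans _ _ (legendre K mu g)%:E); [rewrite lte_fin|apply: ereal_sup_ubound; exists mu].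
Qed.

Lemma rate_ge0 g : (0 <= rate g)%E.
Proof.
apply: ereal_sup_ubound; exists [::] => //.
by rewrite /legendre /kform !pairing_nil mul0r subr0.
Qed.

(** Positivity of the form on [mu - nu] gives [K(mu,nu) - K(mu,mu)/2 <= K(nu,nu)/2]. *)
Lemma rate_kpath nu : (rate (kpath K nu) <= (kform K nu nu / 2)%:E)%E.
Proof.
apply/rate_leP => mu; rewrite /legendre -/(kform K mu nu).
have := Kpos (mu ++ dscale (-1) nu).
rewrite kform_catl !kform_catr !kform_scalel !kform_scaler (kform_sym nu mu); lra.
Qed.

(** The zero measure is within [a] of the bound, so [near_max] at [[::]], tested on a difference of
    two unit masses, bounds the increment of [g] by the kernel distance of the points. This makes
    sublevels of the rate equicontinuous. *)
Lemma rate_diff_le g (a : R) s t : (rate g <= a%:E)%E ->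
  (g s - g t) ^+ 2 <= 2 * (K s s + K t t - 2 * K s t) * a.
Proof.
move=> /rate_leP h; have := @near_max g a h [::] ([:: (s, 1)] ++ dscale (-1) [:: (t, 1)]) a.
rewrite subrr {1}/legendre /kform !pairing_nil mul0r subr0 lexx => /(_ isT).
rewrite -!/(kform _ _ _) pairing_cat pairing_scale !pairing1.
have -> : kform K ([:: (s, 1)] ++ dscale (-1) [:: (t, 1)]) [::] = 0.
  by rewrite kform_catl kform_scalel !kform1 /kpath !pairing_nil mulr0 addr0.
rewrite mulN1r subr0 kform_catl !kform_catr !kform_scalel !kform_scaler !kform1 /kpath !pairing1 (Ksym t s).
by move/le_trans; apply; rewrite le_eqVlt; apply/orP; left; apply/eqP; ring.
Qed.

Lemma rate_sqr_le g (a : R) t : (rate g <= a%:E)%E -> g t ^+ 2 <= 2 * K t t * a.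
Proof.
move=> /rate_leP h; have := @near_max_path g a h [::] a t.
by rewrite subrr /legendre /kform /kpath !pairing_nil mul0r subr0 lexx subr0 => /(_ isT).
Qed.

Lemma rate_near_max g (a e : R) : 0 < e -> (rate g <= a%:E)%E ->
  exists C, [/\ 0 <= C <= a, rate g = C%:E & exists mu, C - e <= legendre K mu g].
Proof.
move=> e0 ra; have r0 := rate_ge0 g; exists (fine (rate g)).
have rE : rate g = (fine (rate g))%:E.
  rewrite fineK// ge0_fin_numE//; exact: (le_lt_trans ra (ltry _)).
rewrite rE /= in ra r0 *; rewrite -!lee_fin ra r0; split => //.
have : ((fine (rate g) - e)%:E < rate g)%E by rewrite rE lte_fin ltrBlDr ltrDl.
by move=> /rate_gtP[mu h]; exists mu; exact: ltW.
Qed.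

(** Substitute for the Riesz representation of [g]: a near maximizer represents [g] up to [e], at
    the price of raising the energy from [a] to any [b] above it. *)
Lemma riesz_approx g (a b e B : R) : 0 < e -> a < b -> (rate g <= a%:E)%E ->
  (forall t, K t t <= B) ->
  exists mu, kform K mu mu / 2 <= b /\ forall t, `|g t - kpath K mu t| <= e.
Proof.
move=> e0 ab ra KB.
have B0' : 0 <= `|B| by [].
have b0 : 0 <= a by rewrite -lee_fin; exact: le_trans (rate_ge0 g) ra.
have b1 : 0 < 1 + b by lra.
(* The first bound keeps [1 - e1] positive, the second gives [(C + e1) / (1 - e1) <= b], and the
   third the uniform error, through [2 *]|B| <= (2 * [|B| + 1) ^+ 2]. *)
pose e1 := Num.min 2^-1 (Num.min ((b - a) / (1 + b)) (e / (2 * `|B| + 1))).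
have e1_gt0 : 0 < e1 by rewrite !lt_min invr_gt0 ltr0n !divr_gt0//; lra.
have e1_le : [/\ e1 <= 2^-1, e1 <= (b - a) / (1 + b) & e1 <= e / (2 * `|B| + 1)].
  by split; rewrite /e1 !ge_min lexx ?orbT.
case: e1_le => h1 h2 h3.
have [C [/andP[C0 Ca] rC [mu hmu]]] := rate_near_max (exprn_gt0 2 e1_gt0) ra.
have gC : forall nu, legendre K nu g <= C by apply/rate_leP; rewrite rC.
have e11 : 0 < e1 < 1 by rewrite e1_gt0; lra.
have /andP[_ h4] := near_max_norm gC e11 hmu.
exists mu; split.
  apply: (le_trans h4); rewrite ler_pdivrMr; last lra.
  by move: h2; rewrite ler_pdivlMr//; lra.
move=> t; rewrite -ler_sqr ?nnegrE ?(ltW e0)// real_normK ?num_real//.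
apply: (le_trans (near_max_path gC t hmu)).
move: h3; rewrite ler_pdivlMr; last by rewrite ltr_wpDl// mulr_ge0.
move=> h3; apply: (@le_trans _ _ ((e1 * (2 * `|B| + 1)) ^+ 2)); last first.
  by rewrite lerXn2r ?nnegrE ?(ltW e0)// mulr_ge0 ?(ltW e1_gt0)// addr_ge0// mulr_ge0.
rewrite exprMn mulrC ler_wpM2l ?sqr_ge0//.
apply: (@le_trans _ _ (2 * `|B|)); first by rewrite ler_wpM2l// (le_trans (KB t))// ler_norm.
have := sqr_ge0 `|B|; rewrite -subr_ge0 => hB; rewrite -subr_ge0.
have -> : (2 * `|B| + 1) ^+ 2 - 2 * `|B| = 4 * `|B| ^+ 2 + 2 * `|B| + 1 by ring.
by rewrite !addr_ge0// mulr_ge0// sqr_ge0.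
Qed.
End discrete_kernel.

(** * The space C([0,1]) *)

(** Heine-Cantor for a function controlled only along [A], as happens for a covariance known to be
    continuous on the quadrant only. *)
Lemma compact_unif (R : realType) (X : pseudoMetricType R) (A : set X) (F : X -> R) :
  compact A ->
  (forall x, A x -> forall d, 0 < d -> exists2 r : R, 0 < r & forall q, A q -> ball x r q -> `|F q - F x| < d) ->
  forall d, 0 < d -> exists2 r : R, 0 < r & forall p q, A p -> A q -> ball p r q -> `|F p - F q| < d.
Proof.
move=> cA cF d d0.
have d2 : 0 < d / 2 by rewrite divr_gt0.
have H : \forall r \near (0 : R)^'+, A `<=` (fun p => A p -> forall q, A q -> ball p r q -> `|F p - F q| < d).
  apply: ((@compact_near_coveringP X A).1 cA R (0^'+)
    (fun r p => A p -> forall q, A q -> ball p r q -> `|F p - F q| < d)) => x Ax.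
  have [r r0 hr] := cF x Ax _ d2.
  have r2 : 0 < r / 2 by rewrite divr_gt0.
  exists (ball x (r / 2), [set e : R | 0 < e < r / 2]) => /=.
    split; first exact: nbhsx_ballx.
    near=> e => /=; apply/andP; split; near: e; first exact: nbhs_right_gt.
    exact: nbhs_right_lt.
  move=> [p e] /= [xp /andP[e0 er]] Ap q Aq pq.
  rewrite (splitr d) (_ : F p - F q = (F p - F x) - (F q - F x)); last by ring.
  apply: (le_lt_trans (ler_normB _ _)); apply: ltrD; apply: hr => //.
    by apply: le_ball xp; lra.
  by rewrite (splitr r); apply: ball_triangle xp _; apply: le_ball pq; exact: ltW.
have [r [r0 hr]] : exists r : R, 0 < r /\ A `<=` (fun p => A p -> forall q, A q -> ball p r q -> `|F p - F q| < d).
  near (0 : R)^'+ => r; exists r; split; first by near: r; exact: nbhs_right_gt.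
  by near: r.
by exists r => // p q Ap Aq; exact: hr.
Unshelve. all: by end_near.
Qed.

Section continuous_paths.
Context (R : realType).
Implicit Types (h : C01 R) (s t : I01 R).

Lemma I01_ge0 t : 0 <= val t.
Proof. by have := set_valP t; rewrite /= in_itv/= => /andP[]. Qed.

Lemma I01_le1 t : val t <= 1.
Proof. by have := set_valP t; rewrite /= in_itv/= => /andP[]. Qed.

(** The nearest-point projection onto [0,1]: it makes [toI] total while remaining 1-Lipschitz. *)
Definition clip (x : R) : R := Num.max 0 (Num.min 1 x).

Lemma clip_itv x : clip x \in [set` `[0, 1]].
Proof. by rewrite inE/= in_itv/= /clip le_max lexx/= ge_max ler01 ge_min lexx. Qed.

Definition toI (x : R) : I01 R := exist _ (clip x) (clip_itv x).

Lemma val_toI x : 0 <= x <= 1 -> val (toI x) = x.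
Proof.
by move=> /andP[x0 x1]; rewrite /= /clip min_r// max_r.
Qed.

Lemma toI_val t : toI (val t) = t.
Proof. by apply/val_inj; rewrite val_toI// I01_ge0 I01_le1. Qed.

Lemma I01_nbhsP t (A : set (I01 R)) : nbhs t A <->
  exists2 r : R, 0 < r & forall s, `|val s - val t| < r -> A s.
Proof.
split.
  move=> [_ [[B oB <-] tB sub]].
  have : nbhs (val t) B by apply: open_nbhs_nbhs; split.
  move=> /nbhs_ballP[r r0 rB]; exists r => // s st; apply: sub; apply: rB.
  by rewrite /ball/= distrC.
move=> [r r0 h]; exists (val @^-1` ball (val t) r); split.
- by exists (ball (val t) r) => //; exact: ball_open.
- exact: ballxx.
- by move=> s /=; rewrite /ball/= distrC => /h.
Qed.

Lemma ev_continuous h t (d : R) : 0 < d ->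
  exists2 r : R, 0 < r & forall s, `|val s - val t| < r -> `|ev h s - ev h t| < d.
Proof.
move=> d0; have ch : continuous (ev h) by exact: cts_fun.
have /I01_nbhsP[r r0 hr] : nbhs t (ev h @^-1` ball (ev h t) d).
  by apply: ch; exact: nbhsx_ballx.
by exists r => // s /hr; rewrite /ball/= distrC.
Qed.

Lemma C01_nbhsP h (A : set (C01 R)) : nbhs h A <->
  exists2 d : R, 0 < d & forall h', (forall t, `|ev h' t - ev h t| < d) -> A h'.
Proof.
split.
  move=> /nbhsP[E [W [V entV WV] EW] sub].
  have : nbhs (0 : R) [set: R] by exact: filterT.
  move: entV; rewrite -entourage_ballE => -[d /= d0 dV]; exists d => // h' hh'.
  apply: sub; apply/mem_set; apply: EW; apply: WV => t /=.
  apply: dV => /=; rewrite /ball/= distrC; exact: hh'.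
move=> [d d0 hA]; apply/nbhsP.
exists [set fg : C01 R * C01 R | forall t, `|ev fg.2 t - ev fg.1 t| < d].
  exists [set fg : (I01 R -> R) * (I01 R -> R) | forall t, `|fg.2 t - fg.1 t| < d] => //.
  exists [set xy | `|xy.2 - xy.1| < d] => //.
  by rewrite -entourage_ballE; exists d => //= -[x y] /=; rewrite /ball/= distrC.
by move=> h' /set_mem/= /hA.
Qed.

Definition mkC01 (f : I01 R -> R) (cf : continuous f) : C01 R := mkcts cf : continuousType (I01 R) R.

Lemma ev_mkC01 f cf : ev (@mkC01 f cf) = f.
Proof. by []. Qed.

Lemma I01_continuous (f : I01 R -> R) : (forall t d, 0 < d ->
  exists2 r : R, 0 < r & forall s, `|val s - val t| < r -> `|f s - f t| < d) -> continuous f.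
Proof.
move=> hf t A /nbhs_ballP[d d0 dA]; apply/I01_nbhsP; have [r r0 hr] := hf t d d0.
by exists r => // s /hr st; apply: dA; rewrite /ball/= distrC.
Qed.

Lemma clip_lip x y : `|clip x - clip y| <= `|x - y|.
Proof.
rewrite /clip /Num.max /Num.min; do ![case: ifPn]; rewrite -?leNgt => *;
  rewrite ?ler_norml; do ?[apply/andP; split]; move: (ler_norm (x - y)) (ler_norm (y - x)); rewrite (distrC y); try lra.
Qed.

Lemma ev_unif h (d : R) : 0 < d ->
  exists2 r : R, 0 < r & forall s t, `|val s - val t| < r -> `|ev h s - ev h t| < d.
Proof.
move=> d0.
have [x x01 e e0|r r0 hr] := @compact_unif R R `[0, 1]%classic (ev h \o toI) (@segment_compact R 0 1) _ d d0.
  have [r r0 hr] := ev_continuous h (toI x) e0.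
  exists r => // q _ xq; apply: hr; apply: (le_lt_trans (clip_lip _ _)).
  by move: xq; rewrite /ball/= distrC.
exists r => // s t st; have := hr (val s) (val t); rewrite /= !toI_val; apply.
- exact: (set_valP s).
- exact: (set_valP t).
- by rewrite /ball/=.
Qed.

Definition ratI (j : nat) : I01 R := toI (if unpickle j is Some q then ratr q else 0).

Lemma ratI_dense t (d : R) : 0 < d -> exists j, `|val (ratI j) - val t| < d.
Proof.
move=> d0; have [q] : exists q, ratr q \in `]val t - d, val t + d[.
  by apply: rat_in_itvoo; lra.
rewrite in_itv/= => /andP[q1 q2]; exists (pickle q); rewrite /ratI pickleK.
have -> : val (toI (ratr q)) - val t = clip (ratr q) - clip (val t).
  by congr (_ - _); have /(congr1 val) := toI_val t.
apply: (le_lt_trans (clip_lip _ _)); rewrite distrC ltr_distlC; apply/andP; split=> //; lra.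
Qed.

Lemma ev_ratI_le h h' (d : R) : (forall j, `|ev h (ratI j) - ev h' (ratI j)| <= d) ->
  forall t, `|ev h t - ev h' t| <= d.
Proof.
move=> H t; apply/ler_addgt0Pr => e e0.
have e2 : 0 < e / 2 by rewrite divr_gt0.
have [r r0 hr] := ev_continuous h t e2; have [r' r'0 hr'] := ev_continuous h' t e2.
have rr : 0 < Num.min r r' by rewrite lt_min r0.
have [j] := ratI_dense t rr; rewrite lt_min => /andP[j1 j2].
have := hr _ j1; have := hr' _ j2; have := H j.
rewrite (_ : ev h t - ev h' t = (ev h (ratI j) - ev h' (ratI j)) +
  (ev h' (ratI j) - ev h' t) - (ev h (ratI j) - ev h t)); last by ring.
move=> h1 h2 h3; apply: (le_trans (ler_normB _ _)).
by apply: (le_trans (lerD (ler_normD _ _) (lexx _))); lra.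
Qed.

(** With mesh [1 / N.+1%:R] the useful indices are 0 to [N.+1], hence [N.+2] points; [grid_idx]
    chooses the left end, and the index [N.+1] is reached only at the time 1. *)
Definition grid (N : nat) (i : nat) : I01 R := toI (i%:R / N.+1%:R).

Definition grid_idx (N : nat) t : nat := Num.truncn (N.+1%:R * val t).

Lemma grid_idx_le N t : (grid_idx N t < N.+2)%N.
Proof.
rewrite /grid_idx truncn_lt_nat ?mulr_ge0 ?I01_ge0//.
apply: (@le_lt_trans _ _ N.+1%:R); first by rewrite ler_piMr// I01_le1.
by rewrite ltr_nat.
Qed.

Lemma grid_close N t : `|val t - val (grid N (grid_idx N t))| < N.+1%:R^-1.
Proof.
have N0 : (0 : R) < N.+1%:R by [].
have /truncn_itv/andP[h1 h2] : 0 <= N.+1%:R * val t by rewrite mulr_ge0 ?I01_ge0.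
rewrite -/(grid_idx N t) in h1 h2.
have e1 : (grid_idx N t)%:R / N.+1%:R <= val t by rewrite ler_pdivrMr// mulrC.
have e2 : val t < ((grid_idx N t).+1)%:R / N.+1%:R by rewrite ltr_pdivlMr// mulrC.
rewrite val_toI; last by rewrite divr_ge0//= (le_trans e1)// I01_le1.
rewrite ger0_norm ?subr_ge0// ltrBlDl (lt_le_trans e2)//.
by rewrite -natr1 mulrDl mul1r.
Qed.

Lemma exists_mesh (r : R) : 0 < r -> exists N : nat, (N.+1%:R)^-1 < r.
Proof.
move=> r0; exists (Num.truncn r^-1); rewrite -[ltRHS]invrK ltf_pV2 ?posrE ?invr_gt0//.
exact: truncnS_gt.
Qed.

Section measurability.
Context d (Omega : measurableType d) (Y : Omega -> C01 R).
Hypothesis mY : forall t, measurable_fun setT (fun w => ev (Y w) t).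

Let code : countType := (nat * seq rat * nat)%type.
(* Closed tubes around step functions with rational values; testing at rational
   times makes them measurable, and countably many of them exhaust an open set. *)
Let tube (c : code) : set (C01 R) :=
  [set h | forall j, `|ev h (ratI j) - ratr (nth 0 c.1.2 (grid_idx c.1.1 (ratI j)))| <= (c.2.+1%:R)^-1].

Let measurable_tube c : measurable (Y @^-1` tube c).
Proof.
rewrite (_ : _ @^-1` _ = \bigcap_j (fun w => ev (Y w) (ratI j)) @^-1`
  [set x : R | `|x - ratr (nth 0 c.1.2 (grid_idx c.1.1 (ratI j)))| <= (c.2.+1%:R)^-1]); last first.
  by apply/seteqP; split => w /= h j; [move=> _|]; exact: h.
apply: bigcapT_measurable => j; rewrite -[X in measurable X]setTI; apply: mY => //.
set a := ratr _; rewrite (_ : [set x | _] = `[a - (c.2.+1%:R)^-1, a + (c.2.+1%:R)^-1]%classic).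
  exact: measurable_itv.
by apply/seteqP; split => x /=; rewrite in_itv/= ler_distl.
Qed.

Lemma open_preimage_measurable (G : set (C01 R)) : open G -> measurable (Y @^-1` G).
Proof.
move=> oG.
have -> : Y @^-1` G = \bigcup_n (if unpickle n is Some c then
    if `[< tube c `<=` G >] then Y @^-1` tube c else set0 else set0).
  apply/seteqP; split => w /=; last first.
    move=> [n _]; case: unpickle => // c; case: asboolP => // cG; exact: cG.
  move=> Gw; have : nbhs (Y w) G by exact: open_nbhs_nbhs.
  move=> /C01_nbhsP[e e0 eG].
  have e2 : 0 < e / 2 by rewrite divr_gt0.
  (* Two members of a tube of radius [rad] differ by at most [2 * rad], which must be below [e].
     Half of [rad] is spent on the oscillation between grid points and half on rounding to
     rationals. *)
  have [k hk] := exists_mesh e2.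
  set rad : R := k.+1%:R^-1 in hk.
  have rad0 : 0 < rad by rewrite invr_gt0.
  have rad2 : 0 < rad / 2 by rewrite divr_gt0.
  have [r r0 hr] := ev_unif (Y w) rad2.
  have [N hN] := exists_mesh r0.
  have /choice[q hq] : forall i, exists q : rat, `|ev (Y w) (grid N i) - ratr q| < rad / 2.
    move=> i; have [q] : exists q, ratr q \in `]ev (Y w) (grid N i) - rad / 2, ev (Y w) (grid N i) + rad / 2[.
      by apply: rat_in_itvoo; lra.
    by rewrite in_itv/= -ltr_distl distrC => h; exists q.
  pose c : code := (N, mkseq q N.+2, k).
  have nq t : nth 0 (mkseq q N.+2) (grid_idx N t) = q (grid_idx N t).
    by rewrite nth_mkseq// grid_idx_le.
  have tw : tube c (Y w).
    move=> j; rewrite /= nq -/rad.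
    have h1 := hr (ratI j) (grid N (grid_idx N (ratI j))) (lt_trans (grid_close N _) hN).
    have h2 := hq (grid_idx N (ratI j)).
    rewrite -(subrK (ev (Y w) (grid N (grid_idx N (ratI j)))) (ev (Y w) (ratI j))) -addrA.
    by apply: (le_trans (ler_normD _ _)); lra.
  have tG : tube c `<=` G.
    move=> h' th'; apply: eG => t; apply: (@le_lt_trans _ _ (2 * rad)); last lra.
    apply: ev_ratI_le => j; have := th' j; have := tw j; rewrite /= -/rad.
    set z := ratr _ => h1 h2; rewrite (_ : _ - _ = (ev h' (ratI j) - z) - (ev (Y w) (ratI j) - z)); last by ring.
    by apply: (le_trans (ler_normB _ _)); lra.
  exists (pickle c) => //; rewrite pickleK.
  by case: asboolP.
apply: bigcupT_measurable => n; case: unpickle => // c.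
by case: asboolP.
Qed.
End measurability.

(** * Compactness of the sublevels of the rate *)

Section level_sets.
Variables (K : I01 R -> I01 R -> R) (m : I01 R -> R).
Hypothesis Ksym : forall s t, K s t = K t s.
Hypothesis Kpos : forall mu, 0 <= kform K mu mu.
Hypothesis Kdist : forall e, 0 < e -> exists2 r : R, 0 < r &
  forall s t, `|val s - val t| < r -> K s s + K t t - 2 * K s t <= e.
Hypothesis m_cont : forall t e, 0 < e -> exists2 r : R, 0 < r &
  forall s, `|val s - val t| < r -> `|m s - m t| < e.

Definition ldp_rate (h : C01 R) : \bar R := rate K (fun t => ev h t - m t).

Lemma level_modulus (a e : R) : 0 < e -> exists2 r : R, 0 < r &
  forall g, (rate K g <= a%:E)%E -> forall s t, `|val s - val t| < r -> `|g s - g t| <= e.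
Proof.
move=> e0; have a1 : 0 < 2 * (`|a| + 1) by rewrite mulr_gt0// ltr_wpDl.
have [r r0 hr] := Kdist (divr_gt0 (exprn_gt0 2 e0) a1).
exists r => // g ga s t st; rewrite -ler_sqr ?nnegrE ?(ltW e0)// real_normK ?num_real//.
have h := rate_diff_le Ksym Kpos s t ga.
apply: (le_trans h); have k0 := kdiff_ge0 Ksym Kpos s t; have := hr s t st.
move=> hD; move: (hD); rewrite ler_pdivlMr// => h2; apply: le_trans h2.
have : (K s s + K t t - 2 * K s t) * a <= (K s s + K t t - 2 * K s t) * (`|a| + 1).
  by rewrite ler_wpM2l//; have := ler_norm a; lra.
by rewrite -mulrA => h3; rewrite [leRHS]mulrCA ler_wpM2l.
Qed.

Lemma rate_path_cont (a : R) (g : I01 R -> R) : (rate K (fun t => (g t - m t)%R : R) <= a%:E)%E -> continuous g.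
Proof.
move=> ga; apply: I01_continuous => t e e0.
have e2 : 0 < e / 2 by rewrite divr_gt0.
have [r r0 hr] := level_modulus a e2; have [r' r'0 hr'] := m_cont t e2.
exists (Num.min r r'); first by rewrite lt_min r0.
move=> s; rewrite lt_min => /andP[s1 s2].
have h1 := hr _ ga s t s1; have h2 := hr' s s2.
rewrite (_ : g s - g t = ((g s - m s) - (g t - m t)) + (m s - m t)); last by ring.
by apply: (le_lt_trans (ler_normD _ _)); lra.
Qed.

(** Arzela-Ascoli with ultrafilters: boundedness gives pointwise limits along an ultrafilter. Each
    Legendre functional uses finitely many points, so the bound passes to the limit; equicontinuity
    then makes the convergence uniform. *)
Lemma ldp_rate_good : good_rate_function ldp_rate.
Proof.
split=> [h|a]; first exact: rate_ge0.
rewrite compact_ultra => F FU FL.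
have FF := @ultra_proper _ F FU.
have Kt : exists B, forall h, (ldp_rate h <= a%:E)%E -> forall t, `|ev h t - m t| <= B t.
  (* Avoids a square root: if a square is at most [z], its root is at most [1 + z]. *)
  exists (fun t => 1 + 2 * K t t * `|a|) => h ha t.
  have h1 := rate_sqr_le Ksym Kpos t ha.
  have h2 : 2 * K t t * a <= 2 * K t t * `|a|.
    by rewrite ler_wpM2l ?ler_norm// mulr_ge0// kdiag_ge0.
  have h3 : 0 <= 2 * K t t * `|a| by rewrite !mulr_ge0// kdiag_ge0.
  rewrite -ler_sqr ?nnegrE ?addr_ge0// real_normK ?num_real//.
  apply: (le_trans h1); apply: (le_trans h2).
  set z := 2 * K t t * `|a| in h3 *; have := sqr_ge0 z; nra.
have [B hB] := Kt.
have /choice[g hg] : forall t, exists x : R, ev h t @[h --> F] --> x.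
  move=> t; pose G : set_system R := ev h t @[h --> F].
  have GP : ProperFilter G by exact: fmap_proper_filter.
  have FB : F [set h | m t - B t <= ev h t <= m t + B t].
    apply: filterS FL => h /hB/(_ t); rewrite /= ler_norml.
    by move=> /andP[h1 h2]; apply/andP; split; lra.
  have GB : G `[m t - B t, m t + B t]%classic.
    change (F ((fun h : C01 R => ev h t) @^-1` `[m t - B t, m t + B t]%classic)).
    by apply: filterS FB => h /=; rewrite in_itv.
  have [x [_ cx]] := @segment_compact R _ _ G GP GB.
  exists (x : R) => A Ax; have [//|nA] := in_ultra_setVsetC ((fun h : C01 R => ev h t) @^-1` A) FU.
  by have [y [/= nAy Ay]] := cx (~` A) A nA Ax.
have cvg_pair mu : pairing mu (fun t => ev h t - m t) @[h --> F] --> pairing mu (fun t => g t - m t).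
  rewrite /pairing; elim: mu => [|p mu ih].
    under eq_fun do rewrite big_nil; rewrite big_nil; exact: cvg_cst.
  under eq_fun do rewrite big_cons; rewrite big_cons; apply: cvgD => //.
  by apply: cvgMr; apply: cvgB; [exact: hg|exact: cvg_cst].
have rg : (rate K (fun t => (g t - m t)%R : R) <= a%:E)%E.
  apply/rate_leP => mu.
  apply: (@cvgr_to_le _ F FF _ (fun h => legendre K mu (fun t => ev h t - m t))).
    by apply: cvgB; [exact: cvg_pair|exact: cvg_cst].
  by apply: filterS FL => h /rate_leP; exact.
have cg := rate_path_cont rg.
exists (mkC01 cg); split; first exact: rg.
move=> A /C01_nbhsP[e e0 eA].
have e4 : 0 < e / 4 by rewrite divr_gt0.
have [r r0 hr] := level_modulus a e4.
have [N hN] := exists_mesh r0.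
have HN : \forall h \near F, forall i : 'I_N.+2, `|ev h (grid N i) - g (grid N i)| < e / 4.
  apply: filter_forall => i.
  have hb : F ((fun h : C01 R => ev h (grid N i)) @^-1` ball (g (grid N i)) (e / 4)).
    exact: (hg (grid N i) (ball (g (grid N i)) (e / 4)) (nbhsx_ballx _ _ e4)).
  by apply: filterS hb => h; rewrite /ball/= distrC.
apply: filterS (filterI FL HN) => h [Lh Hh]; apply: eA => t; rewrite ev_mkC01.
pose i := Ordinal (grid_idx_le N t).
have st := lt_trans (grid_close N t) hN.
have h1 := hr _ Lh t (grid N i) st; have h2 := hr _ rg t (grid N i) st; have h3 := Hh i.
rewrite (_ : ev h t - g t = ((ev h t - m t) - (ev h (grid N i) - m (grid N i))) -
   ((g t - m t) - (g (grid N i) - m (grid N i))) + (ev h (grid N i) - g (grid N i))); last by ring.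
apply: (le_lt_trans (ler_normD _ _)); move: (ler_normB ((ev h t - m t) - (ev h (grid N i) - m (grid N i)))
   ((g t - m t) - (g (grid N i) - m (grid N i)))); lra.
Qed.

(** A closed set and a compact set that are disjoint lie at positive distance: otherwise the
    sublevel points at distance less than [e] from [F] cluster at a point of both. *)
Lemma level_dist (a : R) (F : set (C01 R)) : closed F ->
  (forall h, F h -> (a%:E < ldp_rate h)%E) ->
  exists2 e : R, 0 < e & forall h h', F h -> (ldp_rate h' <= a%:E)%E ->
    ~ (forall t, `|ev h t - ev h' t| < e).
Proof.
move=> cF aF; apply: contrapT => hn.
have [_ /(_ a) cL] := ldp_rate_good.
pose B (e : R) := [set h' : C01 R | (ldp_rate h' <= a%:E)%E /\
   exists h, F h /\ forall t, `|ev h t - ev h' t| < e].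
have B0 e : 0 < e -> B e !=set0.
  move=> e0; apply: contrapT => hB; apply: hn; exists e => // h h' Fh Lh' hh'.
  by apply: hB; exists h'; split => //; exists h.
pose G := filter_from [set e : R | 0 < e] B.
have GF : ProperFilter G.
  apply: filter_from_proper; last by move=> e /= /B0.
  apply: filter_from_filter; first by exists 1 => /=.
  move=> e e' /= e0 e'0; exists (Num.min e e') => /=; first by rewrite lt_min e0.
  move=> h' [Lh' [h [Fh hh']]]; split; split => //; exists h; split => // t;
    by have := hh' t; rewrite lt_min => /andP[].
have GL : G [set h | (ldp_rate h <= a%:E)%E] by exists 1 => //= h' [].
have [p [Lp cp]] := cL G GF GL.
have : closure F p.
  move=> A /C01_nbhsP[e e0 eA].
  have e2 : 0 < e / 2 by rewrite divr_gt0.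
  have GB : G (B (e / 2)) by exists (e / 2).
  have nA : nbhs p [set h | forall t, `|ev h t - ev p t| < e / 2] by apply/C01_nbhsP; exists (e / 2).
  have [h' [[_ [h [Fh hh']]] h'p]] := cp _ _ GB nA.
  exists h; split => //; apply: eA => t; rewrite (splitr e) -(subrK (ev h' t) (ev h t)) -addrA.
  by apply: (le_lt_trans (ler_normD _ _)); apply: ltrD; [exact: hh'|exact: h'p].
rewrite -(closure_id F).1// => /aF; rewrite ltNge => /negP; exact.
Qed.
End level_sets.

End continuous_paths.

(** * Gaussian families: Chernoff bounds, concentration and tilting *)

Section pairing_integral.
Context d (Omega : measurableType d) (R : realType) (P : {measure set Omega -> \bar R}) (T : Type).
Variables (D : set Omega) (mD : measurable D).
Implicit Types mu : seq (T * R).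

Lemma pairing_cons (p : T * R) mu (g : T -> R) : pairing (p :: mu) g = p.2 * g p.1 + pairing mu g.
Proof. by rewrite /pairing big_cons. Qed.

Lemma pairing_integral (F : T -> Omega -> R) mu : (forall t, P.-integrable D (EFin \o F t)) ->
  P.-integrable D (EFin \o (fun w => pairing mu (F^~ w))) /\
  (\int[P]_(w in D) pairing mu (F^~ w))%R = pairing mu (fun t => \int[P]_(w in D) F t w)%R.
Proof.
move=> iF; elim: mu => [|p mu [ih1 ih2]].
  rewrite pairing_nil; under eq_fun do rewrite pairing_nil; split.
    exact: integrable0.
  by rewrite /Rintegral integral0.
have i1 : P.-integrable D (EFin \o (fun w => p.2 * F p.1 w)).
  have -> : EFin \o (fun w => p.2 * F p.1 w) = (fun w => (p.2%:E * (EFin \o F p.1) w)%E) by [].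
  exact: integrableZl.
have E : (fun w => pairing (p :: mu) (F^~ w)) = (fun w => p.2 * F p.1 w + pairing mu (F^~ w)).
  by apply/funext => w; rewrite pairing_cons.
rewrite E pairing_cons; split.
  have -> : EFin \o (fun w => p.2 * F p.1 w + pairing mu (F^~ w)) =
     (EFin \o (fun w => p.2 * F p.1 w)) \+ (EFin \o (fun w => pairing mu (F^~ w))) by [].
  exact: integrableD.
by rewrite RintegralD// RintegralZl// ih2.
Qed.
End pairing_integral.

Section gaussian_family.
Context d (Omega : measurableType d) (R : realType) (P : probability Omega R) (T : Type).
Implicit Types mu nu : seq (T * R).

Lemma measurable_pairing (F : T -> Omega -> R) mu : (forall t, measurable_fun setT (F t)) ->
  measurable_fun setT (fun w => pairing mu (F^~ w)).
Proof. by move=> mF; rewrite /pairing; apply: measurable_sum => p; exact: measurable_funM. Qed.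

Variable W : T -> Omega -> R.
Hypothesis Wlaw : forall mu, exists s, has_law P (fun w => pairing mu (W^~ w)) 0 s.

Definition cov_kernel s t : R := (\int[P]_w (W s w * W t w))%R.

Let Wsqr mu : P.-integrable setT (EFin \o (fun w => pairing mu (W^~ w) ^+ 2)).
Proof. by have [s /law_sqr[]] := Wlaw mu. Qed.

Let mW t : measurable_fun setT (W t).
Proof. 
have [s [+ _]] := Wlaw [:: (t, 1)].
by under eq_fun do rewrite pairing1.
Qed.

(** Polarization, since only squares of linear combinations are known to be integrable so far. *)
Let Wprod s t : P.-integrable setT (EFin \o (fun w => W s w * W t w)).
Proof.
have h := (Wsqr ([:: (s, 1)] ++ [:: (t, 1)])).
have h' := (Wsqr ([:: (s, 1)] ++ [:: (t, -1)])).
have -> : EFin \o (fun w => W s w * W t w) = (fun w => (4^-1%:E *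
   ((EFin \o (fun w => pairing ([:: (s, 1%R)] ++ [:: (t, 1%R)]) (W^~ w) ^+ 2)%R) \-
   (EFin \o (fun w => pairing ([:: (s, 1%R)] ++ [:: (t, (-1)%R)]) (W^~ w) ^+ 2)%R)) w)%E).
  apply/funext => w /=; rewrite -EFinB -EFinM; congr (_%:E).
  by rewrite /pairing !big_cons !big_nil/=; field.
by apply: integrableZl => //; exact: integrableB.
Qed.

Lemma cov_kernelE mu nu :
  kform cov_kernel mu nu = (\int[P]_w (pairing mu (W^~ w) * pairing nu (W^~ w)))%R.
Proof.
have H s : (\int[P]_w (W s w * pairing nu (W^~ w)))%R = kpath cov_kernel nu s.
  rewrite /kpath /cov_kernel; have [_ <-] := pairing_integral measurableT nu (Wprod s).
  by congr Rintegral; apply/funext => w; rewrite -pairingZ.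
have H' s : P.-integrable setT (EFin \o (fun w => (W s w * pairing nu (W^~ w)))).
  have [+ _] := pairing_integral measurableT nu (Wprod s).
  by under eq_fun do rewrite pairingZ.
rewrite /kform -(eq_pairing mu H); have [_ <-] := pairing_integral measurableT mu H'.
congr Rintegral; apply/funext => w; rewrite mulrC -pairingZ; apply: eq_pairing => t.
by rewrite mulrC.
Qed.

Lemma cov_kernel_sym s t : cov_kernel s t = cov_kernel t s.
Proof. by rewrite /cov_kernel; congr Rintegral; apply/funext => w; rewrite mulrC. Qed.

Lemma cov_kernel_pos mu : 0 <= kform cov_kernel mu mu.
Proof. by rewrite cov_kernelE; apply: Rintegral_ge0 => w _; rewrite -expr2 sqr_ge0. Qed.

Lemma law_pairing mu s : has_law P (fun w => pairing mu (W^~ w)) 0 s -> s ^+ 2 = kform cov_kernel mu mu.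
Proof.
move=> ls; have [_ h] := law_sqr ls; rewrite cov_kernelE /Rintegral.
by under eq_integral do rewrite -expr2; rewrite h.
Qed.

Lemma pairing_expR mu c : (\int[P]_w (expR (pairing mu (W^~ w) + c))%:E =
  (expR (kform cov_kernel mu mu / 2 + c))%:E)%E.
Proof.
have [s ls] := Wlaw mu; have := law_expR 1 ls.
rewrite expr1n mulr0 add0r mul1r (law_pairing ls) => h.
under eq_integral do rewrite expRD EFinM; rewrite ge0_integralZr//.
  by rewrite expRD EFinM -h; congr (_ * _)%E; apply: eq_integral => w _; rewrite mul1r.
- by apply/measurable_EFinP; apply: measurableT_comp => //; exact: ls.1.
Qed.

Lemma measurable_halfspace mu r : measurable [set w | r < pairing mu (W^~ w)].
Proof.
rewrite -[X in measurable X]setTI.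
have -> : [set w | r < pairing mu (W^~ w)] = (fun w => pairing mu (W^~ w)) @^-1` `]r, +oo[%classic.
  by apply/seteqP; split => w /=; rewrite in_itv/= andbT.
by apply: measurable_pairing.
Qed.

Lemma measurable_halfspace_le mu r : measurable [set w | pairing mu (W^~ w) <= r].
Proof.
rewrite -[X in measurable X]setTI.
have -> : [set w | pairing mu (W^~ w) <= r] = (fun w => pairing mu (W^~ w)) @^-1` `]-oo, r]%classic.
  by apply/seteqP; split => w /=; rewrite in_itv/=.
by apply: measurable_pairing.
Qed.

Lemma chernoff mu r :
  (P [set w | (r < pairing mu (W^~ w))%R] <= (expR (kform cov_kernel mu mu / 2 - r))%:E)%E.
Proof.
have mA := measurable_halfspace mu r.
rewrite -pairing_expR -[X in P X]setIT -integral_indic//.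
apply: ge0_le_integral => //.
- by apply/measurable_EFinP.
- apply/measurable_EFinP; apply: measurableT_comp => //; apply: measurable_funD => //.
  exact: measurable_pairing.
move=> w _; rewrite lee_fin indicE; case: (boolP (w \in _)); last by rewrite expR_ge0.
by rewrite inE/= => rw; rewrite -expR0 ler_expR subr_ge0 ltW.
Qed.

(** The event [B] plays the part of a median: its probability turns the factor 2 of the finite bound
    into 4. The bound does not depend on the number of measures, so monotone convergence extends it
    to a sequence. *)
Lemma concentration (nu : nat -> seq (T * R)) (s2 r s lam : R) (B : set Omega) : 0 <= lam ->
  (forall k, kform cov_kernel (nu k) (nu k) <= s2) ->
  measurable B -> (2^-1%:E <= P B)%E -> (forall w k, B w -> pairing (nu k) (W^~ w) <= s) ->
  (P [set w | exists k, (r < pairing (nu k) (W^~ w))%R] <=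
    (4 * expR (2 * lam ^+ 2 * s2 - lam * (r - s)))%:E)%E.
Proof.
move=> lam0 ns2 mB PB Bs.
pose A (M : nat) := [set w | exists i : 'I_M.+1, (r < pairing (nu i) (W^~ w))%R].
have mA M : measurable (A M).
  rewrite (_ : A M = \bigcup_(i in [set: 'I_M.+1]) [set w | r < pairing (nu i) (W^~ w)]).
    apply: fin_bigcup_measurable => // i _; exact: measurable_halfspace.
  by apply/seteqP; split => w [i]; [exists i|move=> _; exists i].
have ndA : {homo A : n m / (n <= m)%N >-> (n <= m)%O}.
  move=> n m nm; apply/subsetPset => w [i ri].
  have im : (i < m.+1)%N by rewrite (leq_trans (ltn_ord i)).
  by exists (Ordinal im).
have AE : [set w | exists k, (r < pairing (nu k) (W^~ w))%R] = \bigcup_M A M.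
  apply/seteqP; split => w /=; first by move=> [k rk]; exists k => //; exists ord_max.
  by move=> [M _ [i ri]]; exists i.
rewrite AE; have cA := nondecreasing_cvg_mu mA (bigcupT_measurable _ mA) ndA.
have HM M : (P (A M) <= (4 * expR (2 * lam ^+ 2 * s2 - lam * (r - s)))%:E)%E.
  have gV (l : 'I_M.+1 -> R) : exists s, has_law P (fun w => \sum_i l i * pairing (nu i) (W^~ w)) 0 s.
    (* A linear combination of the pairings is the pairing with one concatenated, rescaled
       measure. *)
    have [s' ls'] := Wlaw (flatten [seq dscale (l i) (nu i) | i <- enum 'I_M.+1]).
    exists s'; move: ls'; congr has_law; apply/funext => w.
    rewrite -[RHS]big_enum/=; elim: (enum _) => [|i e ih] /=.
      by rewrite big_nil pairing_nil.
    by rewrite pairing_cat pairing_scale ih big_cons.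
  have lawV (i : 'I_M.+1) : exists2 s', has_law P (fun w => pairing (nu i) (W^~ w)) 0 s' & s' ^+ 2 <= s2.
    by have [s' ls'] := Wlaw (nu i); exists s' => //; rewrite (law_pairing ls').
  have := sup_concentration gV lawV (ltn0Sn M) r s lam0.
  have PB' : (2^-1%:E <= P [set w | forall i : 'I_M.+1, (pairing (nu i) (W^~ w) <= s)%R])%E.
    apply: (le_trans PB); apply: le_measure; rewrite ?inE//.
      rewrite (_ : [set w | _] = \bigcap_(i in [set: 'I_M.+1]) [set w | pairing (nu i) (W^~ w) <= s]).
        by apply: fin_bigcap_measurable => // i _; exact: measurable_halfspace_le.
      by apply/seteqP; split => w /= h i; [move=> _|]; exact: h.
    by move=> w Bw i; exact: Bs.
  rewrite -/(A M) => h.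
  have h2 : (P (A M) * 2^-1%:E * (expR (lam * (r - s)))%:E <= (2 * expR (2 * lam ^+ 2 * s2))%:E)%E.
    apply: le_trans h; apply: lee_wpmul2r; first by rewrite lee_fin expR_ge0.
    by apply: lee_wpmul2l.
  move: h2; rewrite -(fineK (fin_num_measure P _ (mA M))); set p := fine _.
  rewrite -!EFinM !lee_fin expRD expRN => h2.
  rewrite mulrA ler_pdivlMr ?expR_gt0//; lra.
rewrite -(cvg_lim (@ereal_hausdorff R) (cA _ P)).
by apply: lime_le; [exact: (cvgP _ (cA _ P))|apply: nearW => M; exact: HM].
Qed.

(* Integrates, against the tilted density exp(mu(W) - K(mu,mu)/2), the inequality
   1 <= 1_D + 1_A + sum_i 1(nu_i(W) >= r_i): the first term is bounded on [D] by the
   factor in [M], the second by AM-GM and the others as in [chernoff]. *)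
Lemma tilt_bound mu (I : finType) (nu : I -> seq (T * R)) (r : I -> R) (D A : set Omega) (M t : R) :
  measurable D -> measurable A -> 0 < t ->
  (forall w, ~ A w -> (forall i, pairing (nu i) (W^~ w) < r i) -> D w) ->
  (forall w, D w -> pairing mu (W^~ w) <= M) ->
  (1 <= (expR (M - kform cov_kernel mu mu / 2))%:E * P D + (t / 2)%:E * P A +
   (expR (kform cov_kernel mu mu) / (2 * t))%:E +
   \sum_i (expR (kform cov_kernel (nu i) (nu i) / 2 + kform cov_kernel (nu i) mu - r i))%:E)%E.
Proof.
move=> mD mA t0 cover DM; set q := kform cov_kernel mu mu.
have t20 : 0 < 2 * t by rewrite mulr_gt0.
pose f1 w := ((expR (M - q / 2))%:E * (\1_D w)%:E)%E.
pose f2 w := ((t / 2)%:E * (\1_A w)%:E)%E.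
pose f3 w := (expR (pairing (dscale 2 mu) (W^~ w) + (- q - ln (2 * t))))%:E.
pose f4 i w := (expR (pairing (mu ++ nu i) (W^~ w) + (- (q / 2) - r i)))%:E.
have mexp nu' c : measurable_fun setT (fun w => (expR (pairing nu' (W^~ w) + c))%:E).
  apply/measurable_EFinP; apply: measurableT_comp => //; apply: measurable_funD => //.
  exact: measurable_pairing.
have mf1 : measurable_fun setT f1.
  by apply: emeasurable_funM => //; apply/measurable_EFinP.
have mf2 : measurable_fun setT f2.
  by apply: emeasurable_funM => //; apply/measurable_EFinP.
have f10 w : (0 <= f1 w)%E by rewrite mule_ge0// lee_fin ?expR_ge0.
have f20 w : (0 <= f2 w)%E by rewrite mule_ge0// lee_fin// divr_ge0// ltW.
have f30 w : (0 <= f3 w)%E by rewrite lee_fin expR_ge0.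
have f40 i w : (0 <= f4 i w)%E by rewrite lee_fin expR_ge0.
have <- : (\int[P]_w f1 w = (expR (M - q / 2))%:E * P D)%E.
  rewrite /f1 ge0_integralZl ?lee_fin ?expR_ge0//; last exact/measurable_EFinP.
  by rewrite integral_indic// setIT.
have <- : (\int[P]_w f2 w = (t / 2)%:E * P A)%E.
  rewrite /f2 ge0_integralZl ?lee_fin ?divr_ge0 ?(ltW t0)//; last exact/measurable_EFinP.
  by rewrite integral_indic// setIT.
have <- : (\int[P]_w f3 w = (expR q / (2 * t))%:E)%E.
  rewrite /f3 pairing_expR kform_scalel kform_scaler -/q.
  rewrite (_ : _ + _ = q - ln (2 * t)); last by field.
  by rewrite expRD expRN lnK.
have F4 i : (\int[P]_w f4 i w = (expR (kform cov_kernel (nu i) (nu i) / 2 + kform cov_kernel (nu i) mu - r i))%:E)%E.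
  rewrite /f4 pairing_expR; congr (expR _)%:E.
  rewrite kform_catl !kform_catr -/q (kform_sym cov_kernel_sym mu (nu i)).
  by field.
under eq_bigr do rewrite -F4.
rewrite -ge0_integral_sum//; last by move=> i; exact: mexp.
have mf3 : measurable_fun setT f3 by exact: mexp.
have mf5 : measurable_fun setT (fun w => \sum_i f4 i w)%E.
  by apply: emeasurable_sum => i; exact: mexp.
have f50 w : (0 <= \sum_i f4 i w)%E by exact: sume_ge0.
have mf12 := emeasurable_funD mf1 mf2.
have mf123 := emeasurable_funD mf12 mf3.
have f120 w : (0 <= (f1 \+ f2) w)%E by rewrite adde_ge0.
have f1230 w : (0 <= (f1 \+ f2 \+ f3) w)%E by rewrite adde_ge0.
rewrite -ge0_integralD// -ge0_integralD// -ge0_integralD//.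
have -> : (1 = \int[P]_w (expR (pairing mu (W^~ w) + - (q / 2)))%:E :> \bar R)%E.
  by rewrite pairing_expR subrr expR0.
apply: ge0_le_integral => //.
  by apply: emeasurable_funD.
move=> w _; rewrite /f3 /= /f4 sumEFin /f1 /f2 !indicE -!EFinM -!EFinD lee_fin.
have e1 : 0 <= expR (M - q / 2) * (w \in D)%:R by rewrite mulr_ge0 ?expR_ge0.
have e3 : 0 <= expR (pairing (dscale 2 mu) (W^~ w) + (- q - ln (2 * t))) by exact: expR_ge0.
have e2 : 0 <= t / 2 * (w \in A)%:R by rewrite mulr_ge0// divr_ge0// ltW.
have e4 i : 0 <= expR (pairing (mu ++ nu i) (W^~ w) + (- (q / 2) - r i)) by exact: expR_ge0.
have e5 : 0 <= \sum_i expR (pairing (mu ++ nu i) (W^~ w) + (- (q / 2) - r i)) by exact: sumr_ge0.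
have [Aw|nAw] := pselect (A w).
  move: e2; rewrite (mem_set Aw) mulr1 => _.
  have -> : expR (pairing (dscale 2 mu) (W^~ w) + (- q - ln (2 * t))) =
     expR (pairing mu (W^~ w) - q / 2) ^+ 2 / (2 * t).
    rewrite addrA (expRD (_ - q)) (expRN (ln _)) lnK ?posrE// pairing_scale; congr (_ / _).
    by rewrite expr2 -expRD; congr expR; field.
  set u := expR (pairing mu (W^~ w) - q / 2); have : 0 <= (u - t) ^+ 2 / (2 * t).
    by rewrite divr_ge0 ?sqr_ge0// ltW.
  have -> : (u - t) ^+ 2 / (2 * t) = t / 2 + u ^+ 2 / (2 * t) - u by field; rewrite gt_eqF.
  lra.
have [[i hi]|hn] := pselect (exists i, r i <= pairing (nu i) (W^~ w)).
  suff : expR (pairing mu (W^~ w) - q / 2) <= \sum_i expR (pairing (mu ++ nu i) (W^~ w) + (- (q / 2) - r i)) by lra.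
  rewrite (bigD1 i)//=; apply: (le_trans _ (_ : expR (pairing (mu ++ nu i) (W^~ w) + (- (q / 2) - r i)) <= _)).
    by rewrite ler_expR pairing_cat; lra.
  by rewrite lerDl sumr_ge0.
have Dw : D w.
  apply: cover => // i; rewrite ltNge; apply/negP => hi; apply: hn; by exists i.
suff : expR (pairing mu (W^~ w) - q / 2) <= expR (M - q / 2) * (w \in D)%:R by lra.
by rewrite (mem_set Dw) mulr1 ler_expR lerB// DM.
Qed.

End gaussian_family.

Lemma expRN_le_inv (R : realType) (y : R) : 0 < y -> expR (- y) <= y^-1.
Proof.
move=> y0; rewrite expRN lef_pV2 ?posrE ?expR_gt0//.
by have := expR_ge1Dx y; lra.
Qed.

(** * Elementary inequalities used in the large deviation bounds *)

Section numeric_facts.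
Context (R : realType).

Lemma increment_var_le (a b b' c x y z om v : R) :
  `|a - v * x| <= om / 4 * v -> `|b - v * y| <= om / 4 * v -> `|b' - v * y| <= om / 4 * v ->
  `|c - v * z| <= om / 4 * v -> v * (x + z - 2 * y) <= v * om ->
  a + -1 * b + (-1 * b' + -1 * (-1 * c)) <= 2 * om * v.
Proof.
rewrite !ler_norml => /andP[a1 b1] /andP[a2 b2] /andP[a3 b3] /andP[a4 b4] h5; lra.
Qed.

Lemma sub_le_half (a b de : R) : `|b| <= de / 4 -> `|a| <= de / 4 -> a + -1 * b <= de / 2.
Proof. rewrite !ler_norml => /andP[a1 b1] /andP[a2 b2]; lra. Qed.

Lemma sum3_lt (z z1 z2 rho : R) : z1 < (rho - z) / 2 -> z2 < (rho - z) / 2 -> z1 + z + z2 < rho.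
Proof. by move=> *; lra. Qed.

Lemma approx_diff_le (a b a' b' x de : R) : `|a - a'| < x / 2 -> `|b - b'| < x / 2 ->
  a - b <= de -> b - a <= de -> `|a' - b'| <= de + x.
Proof.
rewrite !ltr_norml ler_norml => /andP[a1 b1] /andP[a2 b2] *; apply/andP; split; lra.
Qed.

Lemma sum4_lt (x1 x2 x3 x4 de : R) : 0 < de -> x1 <= de -> x2 <= de -> x3 <= de -> x4 < de ->
  x1 + x2 + (x3 + x4) < 8 * de.
Proof. by move=> *; lra. Qed.

(** Exponent of one grid constraint of slope [c / v] under the tilted law. The quadratic cost takes
    half of the gain [c * de], the tilted mean error a quarter, so at least [c * de / 2] remains for
    small variances. *)
Lemma tilted_exponent_le (v c de cii cmu g sg KB : R) : 0 < v -> 0 <= c -> sg = 1 \/ sg = -1 ->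
  c * (`|KB| + 1) <= de / 2 -> cii <= v * (`|KB| + 1) -> `|cmu - v * g| <= de / 4 * v ->
  (sg * c / v) * ((sg * c / v) * cii) / 2 + (sg * c / v) * (v^-1 * cmu) -
  (sg * c / v * g + c * de / v) <= - (c * de / 2 / v).
Proof.
move=> v0 c0 sg1 cKB h1 h2.
have sg2 : sg ^+ 2 = 1 by case: sg1 => ->; rewrite ?sqrrN expr1n.
have -> : (sg * c / v) * ((sg * c / v) * cii) / 2 + (sg * c / v) * (v^-1 * cmu) -
  (sg * c / v * g + c * de / v) =
  (sg ^+ 2 * c ^+ 2 * (cii / v) / 2 + c * (sg * ((cmu - v * g) / v)) - c * de) / v by field; rewrite gt_eqF.
rewrite -[leRHS]mulNr ler_pM2r ?invr_gt0// sg2 mul1r.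
have h3 : sg * ((cmu - v * g) / v) <= de / 4.
  apply: (le_trans (ler_norm _)); rewrite normrM (_ : `|sg| = 1); last by case: sg1 => ->; rewrite ?normrN1 ?normr1.
  by rewrite mul1r normrM normfV (gtr0_norm v0) ler_pdivrMr.
have h4 : cii / v <= `|KB| + 1 by rewrite ler_pdivrMr// mulrC.
have h5 : c ^+ 2 * (cii / v) <= c * (de / 2).
  apply: (@le_trans _ _ (c ^+ 2 * (`|KB| + 1))); first by rewrite ler_wpM2l// sqr_ge0.
  by rewrite expr2 -mulrA ler_wpM2l.
have h6 : c * (sg * ((cmu - v * g) / v)) <= c * (de / 4) by rewrite ler_wpM2l.
lra.
Qed.

Lemma sum5_lt (x1 x2 x3 de dd : R) : 0 < dd -> de <= dd / 8 -> x1 <= de -> x2 <= 3 * de ->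
  x3 <= dd / 8 -> x1 + x2 + x3 < dd.
Proof. by move=> *; lra. Qed.

Lemma diag_le (cii kii v eta KB : R) : 0 < v -> eta <= 1 -> kii <= KB ->
  `|cii - v * kii| <= eta * v -> cii <= v * (`|KB| + 1).
Proof.
move=> v0 e1 kK h; have h2 : cii - v * kii <= 1 * v.
  by apply: (le_trans (ler_norm _)); apply: (le_trans h); rewrite ler_wpM2r// ltW.
have h3 : v * kii <= v * `|KB| by rewrite ler_wpM2l ?(ltW v0)//; exact: le_trans kK (ler_norm _).
rewrite mulrDr; lra.
Qed.

Lemma two_sided_le (q x g de : R) : 0 < q -> q * x <= q * g + q * de -> - q * x <= - q * g + q * de ->
  `|x - g| <= de.
Proof.
move=> q0; rewrite !mulNr -mulrDr ler_pM2l// => h1 h2.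
have : - x <= - g + de by rewrite -(ler_pM2l q0) mulrDr !mulrN.
by move=> h3; rewrite ler_norml; lra.
Qed.

Lemma sum3_le (x1 x2 x3 de : R) : x1 <= de -> x2 <= de -> x3 <= de -> x1 + x2 + x3 <= 3 * de.
Proof. by move=> *; lra. Qed.

(** The three error terms sum to at most one half, so [expR (M - q / 2) * p >= 2^-1]. Here
    [M - q / 2] is close to [k / (2 v)], hence at most [(a + 3 * c) / v], and the lost factor one
    half is absorbed by [expR (- (c / v))]. *)
Lemma tilt_final (M q v k kv c a b t2 t3 t4 p : R) : 0 < v -> M = (k + c) / v -> q = kv / v ^+ 2 ->
  `|kv - v * k| <= c * v -> k / 2 <= a + c -> b = a + 8 * c -> 0 < c ->
  1 <= expR (M - q / 2) * p + t2 + t3 + t4 -> t2 <= 8^-1 -> t3 <= 8^-1 -> t4 <= 4^-1 ->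
  expR (- (c / v)) <= 2^-1 -> expR (- (b / v)) <= p.
Proof.
move=> v0 -> -> hk ka -> c0 h h2 h3 h4 h5.
set y := _ - _ in h.
have yl : y <= (a + 3 * c) / v.
  have -> : y = (k + c - kv / v / 2) / v by rewrite /y; field; rewrite gt_eqF.
  rewrite ler_pM2r ?invr_gt0//.
  have : k - c <= kv / v.
    by rewrite ler_pdivlMr// mulrBl mulrC; move: hk; rewrite ler_norml => /andP[]; lra.
  lra.
have hp : 2^-1 <= expR y * p by lra.
have hp2 : expR (- y) * 2^-1 <= p.
  by rewrite expRN ler_pdivrMl ?expR_gt0.
apply: le_trans hp2; apply: (@le_trans _ _ (expR (- y) * expR (- (c / v)))).
  rewrite -expRD ler_expR.
  have -> : - ((a + 8 * c) / v) = - ((a + 3 * c) / v) - 5 * (c / v) by field; rewrite gt_eqF.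
  have : 0 < c / v by rewrite divr_gt0.
  lra.
by rewrite ler_wpM2l// expR_ge0.
Qed.

End numeric_facts.

Lemma near_seq (T : eqType) (L : seq T) (S : Type) (F : set_system S) (Q : T -> S -> Prop) : Filter F ->
  (forall l, l \in L -> \forall x \near F, Q l x) -> \forall x \near F, forall l, l \in L -> Q l x.
Proof.
move=> FF; elim: L => [|l L ih] h; first by apply: filterE.
have h1 : \forall x \near F, Q l x by apply: h; rewrite mem_head.
have h2 : \forall x \near F, forall l, l \in L -> Q l x.
  by apply: ih => l' l'L; apply: h; rewrite in_cons l'L orbT.
by apply: filterS2 h1 h2 => x q1 q2 l'; rewrite in_cons => /orP[/eqP->//|/q2].
Qed.

Lemma measure_ex_le d (Omega : measurableType d) (R : realType) (P : {measure set Omega -> \bar R})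
    (T : eqType) (L : seq T) (B : T -> set Omega) : (forall l, measurable (B l)) ->
  measurable [set w | exists2 l, l \in L & B l w] /\
  (P [set w | exists2 l, l \in L & B l w] <= \sum_(l <- L) P (B l))%E.
Proof.
move=> mB; elim: L => [|l L [ih1 ih2]].
  rewrite (_ : [set w | _] = set0); last by apply/seteqP; split => w [].
  by rewrite measure0 big_nil.
have -> : [set w | exists2 k, k \in l :: L & B k w] = B l `|` [set w | exists2 k, k \in L & B k w].
  apply/seteqP; split => w /=.
    by move=> [k]; rewrite in_cons => /orP[/eqP->|kL] Bk; [left|right; exists k].
  by move=> [Bl|[k kL Bk]]; [exists l; rewrite ?mem_head|exists k; rewrite // in_cons kL orbT].
split; first exact: measurableU.
by rewrite big_cons; apply: (le_trans (measureU2 _ _ _)) => //; apply: leeD.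
Qed.

Lemma limf_esup_le (R : realType) (f : R -> \bar R) (F : set_system R) (b : \bar R) :
  (\forall e \near F, f e <= b)%E -> (limf_esup f F <= b)%E.
Proof.
move=> Fb; apply: (@le_trans _ _ (ereal_sup (f @` [set e | (f e <= b)%E]))).
  by apply: ereal_inf_lbound; exists [set e | (f e <= b)%E].
by apply: ge_ereal_sup => _ [e fb <-].
Qed.

Lemma mule_lne_le (R : realType) (v a : R) (p : \bar R) : 0 < v -> (0 <= p)%E ->
  (p <= (expR (- (a / v)))%:E)%E -> (v%:E * lne p <= (- a)%:E)%E.
Proof.
move=> v0 p0 h; have : (lne p <= lne (expR (- (a / v)))%:E)%E.
  by rewrite lee_lne// in_itv/= ?leey ?andbT// lee_fin expR_ge0.
rewrite lne_EFin ?expR_gt0// expRK => /(@lee_wpmul2l _ v%:E); rewrite lee_fin => /(_ (ltW v0)).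
by rewrite -EFinM mulrN mulrC divfK// gt_eqF.
Qed.

Lemma mule_lne_ge (R : realType) (v a : R) (p : \bar R) : 0 < v -> (0 <= p)%E ->
  ((expR (- (a / v)))%:E <= p)%E -> ((- a)%:E <= v%:E * lne p)%E.
Proof.
move=> v0 p0 h; have : (lne (expR (- (a / v)))%:E <= lne p)%E.
  by rewrite lee_lne// in_itv/= ?leey ?andbT// lee_fin expR_ge0.
rewrite lne_EFin ?expR_gt0// expRK => /(@lee_wpmul2l _ v%:E); rewrite lee_fin => /(_ (ltW v0)).
by rewrite -EFinM mulrN mulrC divfK// gt_eqF.
Qed.

(** * Large deviations of Gaussian paths *)

Section gaussian_ldp.
Context d (Omega : measurableType d) (R : realType) (P : probability Omega R).
Variables (Z : R -> I01 R -> Omega -> R) (v : R -> R) (K : I01 R -> I01 R -> R).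
Variables (m : I01 R -> R) (me : R -> I01 R -> R) (Y : R -> Omega -> C01 R) (KB : R).
Hypothesis Zlaw : forall e : R, 0 < e -> forall mu : seq (I01 R * R),
  exists s, has_law P (fun w => pairing mu (fun t => Z e t w)) 0 s.
Hypothesis v_gt0 : forall e : R, 0 < e -> 0 < v e.
Hypothesis v_cvg0 : v e @[e --> 0^'+] --> 0.
Hypothesis Zcov : forall eta : R, 0 < eta -> \forall e \near 0^'+, forall s t,
  `|cov_kernel P (Z e) s t - v e * K s t| <= eta * v e.
Hypothesis Zsmall : forall s : R, 0 < s -> \forall e \near 0^'+,
  exists2 B : set Omega, measurable B /\ (2^-1%:E <= P B)%E & forall w t, B w -> `|Z e t w| <= s.
Hypothesis K_le : forall t, K t t <= KB.
Hypothesis Ksym : forall s t, K s t = K t s.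
Hypothesis Kdist : forall e : R, 0 < e -> exists2 r : R, 0 < r &
  forall s t, `|val s - val t| < r -> K s s + K t t - 2 * K s t <= e.
Hypothesis m_cont : forall t (e : R), 0 < e -> exists2 r : R, 0 < r &
  forall s, `|val s - val t| < r -> `|m s - m t| < e.
Hypothesis Zcont : forall (e : R) w t, 0 < e -> forall x : R, 0 < x -> exists2 r : R, 0 < r &
  forall s, `|val s - val t| < r -> `|Z e s w - Z e t w| < x.
Hypothesis me_cvg : forall eta : R, 0 < eta -> \forall e \near 0^'+, forall t, `|me e t - m t| <= eta.
Hypothesis YE : forall (e : R) w t, 0 < e -> ev (Y e w) t = me e t + Z e t w.

Local Notation C e := (cov_kernel P (Z e)).

Lemma near_gt0 : \forall e \near (0 : R)^'+, 0 < e.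
Proof. exact: nbhs_right_gt. Qed.

Lemma near_v_lt (r : R) : 0 < r -> \forall e \near 0^'+, 0 < v e < r.
Proof.
move=> r0; near=> e; apply/andP; split; first by apply: v_gt0; near: e; exact: near_gt0.
near: e; have : nbhs (0 : R) [set x | x < r].
  by have /lt_nbhsl : 0 < r by [].
move=> /v_cvg0; exact.
Unshelve. all: by end_near. Qed.

Lemma near_exp_le (c x eps : R) : 0 < x -> 0 < eps ->
  \forall e \near 0^'+, c * expR (- (x / v e)) <= eps.
Proof.
move=> x0 eps0; near=> e.
have /andP[ve0 vle] : 0 < v e < eps * x / (`|c| + 1).
  by near: e; apply: near_v_lt; rewrite divr_gt0 ?mulr_gt0// ltr_wpDl.
apply: (@le_trans _ _ ((`|c| + 1) * (v e / x))).
  apply: (@le_trans _ _ ((`|c| + 1) * expR (- (x / v e)))).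
    by rewrite ler_wpM2r ?expR_ge0//; have := ler_norm c; lra.
  by rewrite ler_wpM2l ?addr_ge0//; rewrite -[leRHS]invrK invf_div expRN_le_inv// divr_gt0.
move: vle; rewrite ltr_pdivlMr ?ltr_wpDl// => h.
by rewrite mulrA ler_pdivrMr// mulrC ltW.
Unshelve. all: by end_near. Qed.

Lemma kform_cov_near mu nu (eta : R) : 0 < eta -> \forall e \near 0^'+,
  `|kform (C e) mu nu - v e * kform K mu nu| <= eta * v e.
Proof.
move=> eta0.
have M0 : 0 <= dmass mu * dmass nu by rewrite mulr_ge0// dmass_ge0.
have M1 : 0 < dmass mu * dmass nu + 1 by rewrite ltr_wpDl.
near=> e.
have /kform_sub_le h : forall s t, `|C e s t - (fun s t => v e * K s t) s t| <= eta / (dmass mu * dmass nu + 1) * v e.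
  by near: e; apply: Zcov; rewrite divr_gt0.
have ve0 : 0 < v e by apply: v_gt0; near: e; exact: near_gt0.
have := h mu nu; have -> : kform (fun s t => v e * K s t) mu nu = v e * kform K mu nu.
  by rewrite /kform -pairingZ; apply: eq_pairing => t; rewrite /kpath -pairingZ.
move=> /le_trans; apply; rewrite !mulrA ler_wpM2r ?ltW//.
by rewrite ltr_pdivrMr// [ltRHS]mulrC ltr_pM2r// ltrDl.
Unshelve. all: by end_near. Qed.

(** Pointwise limits of covariances divided by [v e] are positive, so positivity of [K] need not be
    a hypothesis. *)
Lemma kernel_pos mu : 0 <= kform K mu mu.
Proof.
apply/ler_addgt0Pr => eta eta0.
have [e [e0 h]] : exists e, 0 < e /\ `|kform (C e) mu mu - v e * kform K mu mu| <= eta * v e.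
  near (0 : R)^'+ => e; exists e; split; near: e; [exact: near_gt0|exact: kform_cov_near].
have c0 := cov_kernel_pos (Zlaw e0) mu; have ve0 := v_gt0 e0.
move: h; rewrite ler_norml => /andP[h1 h2]; rewrite -(pmulr_rge0 _ ve0) mulrDr; lra.
Unshelve. all: by end_near. Qed.

(** For times closer than [rho] an increment has variance at most [2 * omega * v e]. Taking [omega]
    small makes oscillations larger than [delta] negligible at any prescribed exponential rate. *)
Lemma osc_bad (omega rho delta : R) : 0 < omega -> 0 < delta ->
  (forall s t, `|val s - val t| < rho -> K s s + K t t - 2 * K s t <= omega) ->
  \forall e \near 0^'+, exists A : set Omega, [/\ measurable A,
    (P A <= (4 * expR (- (delta ^+ 2 / (64 * omega) / v e)))%:E)%E &
    forall w, ~ A w -> forall s t, `|val s - val t| < rho -> `|Z e s w - Z e t w| <= delta].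
Proof.
move=> om0 de0 Kom; near=> e.
have e0 : 0 < e by near: e; exact: near_gt0.
have ve0 := v_gt0 e0.
have cov4 : forall s t, `|C e s t - v e * K s t| <= omega / 4 * v e by near: e; apply: Zcov; rewrite divr_gt0.
have [B [mB PB] Bsm] : exists2 B : set Omega, measurable B /\ (2^-1%:E <= P B)%E & forall w t, B w -> `|Z e t w| <= delta / 4.
  by near: e; apply: Zsmall; rewrite divr_gt0.
(* Enumerates the increments over pairs of rational times closer than [rho]; all other codes give
   the zero measure, for which the bounds are trivial. *)
pose nu k : seq (I01 R * R) := if @unpickle (nat * nat)%type k is Some (i, j) then
  if `|val (ratI R i) - val (ratI R j)| < rho then [:: (ratI R i, 1)] ++ dscale (-1) [:: (ratI R j, 1)] else [::] else [::].
have nuP k : (exists s t, `|val s - val t| < rho /\ nu k = [:: (s, 1)] ++ dscale (-1) [:: (t, 1)]) \/ nu k = [::].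
  rewrite /nu; case: unpickle => [[i j]|]; last by right.
  by case: ifPn => h; [left; exists (ratI R i), (ratI R j)|right].
have nu_var k : kform (C e) (nu k) (nu k) <= 2 * omega * v e.
  case: (nuP k) => [[s [t [st ->]]]|->]; last by rewrite /kform pairing_nil !mulr_ge0// ltW.
  rewrite kform_catl !kform_catr !kform_scalel !kform_scaler !kform1 /kpath !pairing1.
  apply: (increment_var_le (cov4 s s) (cov4 s t) _ (cov4 t t)); first by rewrite (Ksym s t); exact: cov4.
  by rewrite ler_wpM2l ?(ltW ve0)//; exact: Kom.
have nu_le w k : B w -> pairing (nu k) (fun t => Z e t w) <= delta / 2.
  move=> Bw; case: (nuP k) => [[s [t [_ ->]]]|->]; last by rewrite pairing_nil divr_ge0// ltW.
  rewrite pairing_cat pairing_scale !pairing1.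
  by apply: sub_le_half; exact: Bsm.
(* The minimizer of [2 * lam ^+ 2 * (2 * omega * v e) - lam * (delta / 2)]; the minimum is the
   exponent in the statement. *)
pose lam := delta / (16 * omega * v e).
have lam0 : 0 <= lam by rewrite divr_ge0// ?mulr_ge0// ltW.
have := concentration (Zlaw e0) delta lam0 nu_var mB PB nu_le.
set A := [set w | _] => PA.
exists A; split.
- rewrite (_ : A = \bigcup_k [set w | (delta < pairing (nu k) (fun t => Z e t w))%R]).
    by apply: bigcupT_measurable => k; exact: (measurable_halfspace (Zlaw e0)).
  by apply/seteqP; split => w [k]; [exists k|move=> _; exists k].
- apply: (le_trans PA); rewrite lee_fin ler_pM2l// ler_expR le_eqVlt; apply/orP; left; apply/eqP.
  by rewrite /lam; field; rewrite !gt_eqF.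
- move=> w nAw.
  have close i j : `|val (ratI R i) - val (ratI R j)| < rho -> Z e (ratI R i) w - Z e (ratI R j) w <= delta.
    move=> ij; rewrite leNgt; apply/negP => h; apply: nAw; exists (pickle (i, j)).
    by rewrite /nu pickleK ij pairing_cat pairing_scale !pairing1 mulN1r.
  move=> s t st; apply/ler_addgt0Pr => x x0.
  have x2 : 0 < x / 2 by rewrite divr_gt0.
  have [r r0 hr] := Zcont w s e0 x2; have [r' r'0 hr'] := Zcont w t e0 x2.
  pose q := Num.min (Num.min r r') ((rho - `|val s - val t|) / 2).
  have q0 : 0 < q by rewrite !lt_min r0 r'0/= divr_gt0// subr_gt0.
  have [i] := ratI_dense s q0; have [j] := ratI_dense t q0.
  rewrite !lt_min => /andP[/andP[_ /hr' j2] j3] /andP[/andP[/hr i1 _] i3].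
  have ij : `|val (ratI R i) - val (ratI R j)| < rho.
    rewrite (_ : _ - _ = (val (ratI R i) - val s) + (val s - val t) - (val (ratI R j) - val t)); last by ring.
    apply: (le_lt_trans (ler_normB _ _)); apply: (le_lt_trans (lerD (ler_normD _ _) (lexx _))).
    exact: sum3_lt.
  apply: (approx_diff_le i1 j2); first exact: close.
  by apply: close; rewrite distrC.
Unshelve. all: by end_near. Qed.

Section sampling.
Variables (n : nat) (tt : 'I_n -> I01 R).

Definition push (l : seq ('I_n * R)) : seq (I01 R * R) := [seq (tt p.1, p.2) | p <- l].
Definition Ks : 'I_n -> 'I_n -> R := fun i j => K (tt i) (tt j).

Lemma pairing_push l g : pairing (push l) g = pairing l (g \o tt).
Proof. by rewrite /pairing big_map. Qed.

Lemma kpath_push l i : kpath K (push l) (tt i) = kpath Ks l i.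
Proof. by rewrite /kpath pairing_push. Qed.

Lemma kform_push l : kform K (push l) (push l) = kform Ks l l.
Proof. by rewrite /kform pairing_push; apply: eq_pairing => i; exact: kpath_push. Qed.

Lemma legendre_push l g : legendre K (push l) g = legendre Ks l (g \o tt).
Proof. by rewrite /legendre pairing_push kform_push. Qed.

(* On the grid, a point far from the sublevel [a2] has rate above [a1]; only a
   bounded set is covered by compactness, the rest by coordinate half-spaces. *)
Lemma half_spaces_cover (a1 a2 delta : R) : a1 < a2 -> 0 < delta ->
  exists L : seq (seq ('I_n * R)), forall p : 'I_n -> R,
    (forall g, (rate K g <= a2%:E)%E -> exists i, delta <= `|g (tt i) - p i|) ->
    exists2 l, l \in L & a1 < legendre Ks l p.
Proof.
move=> a12 de0.
have Kssym i j : Ks i j = Ks j i by rewrite /Ks Ksym.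
have Kspos l : 0 <= kform Ks l l by rewrite -kform_push kernel_pos.
(* Outside the box, a mass 1 or -1 at a coordinate gives a Legendre value of at least
   [|p i| - KB / 2], hence above [a1]. *)
pose M := a1 + KB / 2.
pose box := [set q : 'rV[R]_n | forall i, q ord0 i \in `[- M, M]].
pose far (q : 'I_n -> R) := forall g, (rate K g <= a2%:E)%E -> exists i, delta <= `|g (tt i) - q i|.
pose A := [set q : 'rV[R]_n | box q /\ far (fun i => q ord0 i)].
have cbox : compact box.
  by apply: (@rV_compact _  _ (fun=> `[(- M), M]%classic)) => _; exact: segment_compact.
have nearc (q : 'rV[R]_n) i (x : R) : 0 < x -> nbhs q [set q' : 'rV[R]_n | `|q' ord0 i - q ord0 i| < x].
  move=> x0.
  have hb : nbhs q [set q' : 'rV[R]_n | ball (q ord0 i) x (q' ord0 i)].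
    exact: (@coord_continuous R 1 n ord0 i q (ball (q ord0 i) x) (nbhsx_ballx _ _ x0)).
  by apply: filterS hb => q'; rewrite /ball/= distrC.
have cA : closed A.
  move=> q cq; split.
    apply: (compact_closed _ cbox); first exact: norm_hausdorff.
    by apply: closureS cq => q' [].
  move=> g rg; apply: contrapT => hn.
  have hlt i : `|g (tt i) - q ord0 i| < delta.
    by rewrite ltNge; apply/negP => h; apply: hn; exists i.
  have hN : nbhs q [set q' : 'rV[R]_n | forall i, `|g (tt i) - q' ord0 i| < delta].
    apply: (@filter_forall _ _ (fun i => [set q' : 'rV[R]_n | `|g (tt i) - q' ord0 i| < delta]) (nbhs q) (nbhs_filter q)) => i.
    have x0 : 0 < delta - `|g (tt i) - q ord0 i| by rewrite subr_gt0.
    apply: filterS (nearc q i _ x0) => q' /= h.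
    rewrite (_ : g (tt i) - q' ord0 i = (g (tt i) - q ord0 i) - (q' ord0 i - q ord0 i)); last by ring.
    by apply: (le_lt_trans (ler_normB _ _)); lra.
  have [q' [[_ Aq'] hq']] := cq _ hN.
  by have [i] := Aq' g rg; rewrite leNgt hq'.
have compA : compact A by apply: (subclosed_compact cA cbox) => q [].
have H q : far q -> exists l, a1 < legendre Ks l q.
  move=> fq; apply: contrapT => hn.
  have rq : (rate Ks q <= a1%:E)%E.
    by apply/rate_leP => l; rewrite leNgt; apply/negP => h; apply: hn; exists l.
  have d2 : 0 < delta / 2 by rewrite divr_gt0.
  (* If no half-space contained [q], then [q] would be within [delta / 2] on the grid of a kernel
     path of rate at most [a2], contradicting its distance from that sublevel. *)
  have [l [kl ql]] := riesz_approx Kssym Kspos d2 a12 rq (fun i => K_le (tt i)).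
  have rg : (rate K (kpath K (push l)) <= a2%:E)%E.
    apply: (le_trans (rate_kpath Ksym kernel_pos _)); by rewrite lee_fin kform_push.
  have [i] := fq _ rg; rewrite kpath_push distrC => h.
  by have := ql i; lra.
have opL (l : seq ('I_n * R)) : open [set q : 'rV[R]_n | a1 < legendre Ks l (fun i => q ord0 i)].
  rewrite openE => q /= hq; have D1 : 0 < dmass l + 1 by rewrite ltr_wpDl// dmass_ge0.
  pose x := (legendre Ks l (fun i => q ord0 i) - a1) / (dmass l + 1).
  have x0 : 0 < x by rewrite divr_gt0// subr_gt0.
  have := @filter_forall _ _ (fun i => [set q' : 'rV[R]_n | `|q' ord0 i - q ord0 i| < x])
    (nbhs q) (nbhs_filter q) (fun i => nearc q i x x0).
  apply: filterS => q' /= hq'.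
  have h : `|pairing l (fun i => q' ord0 i) - pairing l (fun i => q ord0 i)| <= dmass l * x.
    by apply: pairing_sub_le => i; exact: ltW.
  have hx : dmass l * x + x = legendre Ks l (fun i => q ord0 i) - a1.
    by rewrite /x; field; rewrite gt_eqF.
  by move: h hx; rewrite ler_norml /legendre => /andP[h1 h2] hx; lra.
move: compA; rewrite compact_cover => compA.
have [|D' _ AD'] := compA (seq ('I_n * R)%type) setT (fun l => [set q : 'rV[R]_n | a1 < legendre Ks l (fun i => q ord0 i)]) (fun l _ => opL l).
  by move=> q [_ /H[l hl]]; exists l.
exists (finmap.enum_fset D' ++ [seq [:: (i, 1)] | i <- enum 'I_n] ++ [seq [:: (i, -1)] | i <- enum 'I_n]) => p fp.
have [pM|/existsNP[i hi]] := pselect (forall i, p i \in `[- M, M]).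
  have : A (\row_i p i : 'rV[R]_n).
    split; first by move=> i; rewrite mxE; exact: pM.
    by move=> g /fp[i]; exists i; rewrite mxE.
  move=> /AD'[l /= lD' hl]; exists l; first by rewrite mem_cat lD'.
  by move: hl; congr (_ < legendre _ _ _); apply/funext => i; rewrite mxE.
have kb := K_le (tt i).
have leg1 c : legendre Ks [:: (i, c)] p = c * p i - c ^+ 2 * K (tt i) (tt i) / 2.
  rewrite /legendre /kform /kpath /pairing !big_cons !big_nil /= /Ks; by field.
have [pi|pi] := ltP M (p i).
  exists [:: (i, 1)]; first by rewrite !mem_cat map_f ?mem_enum// orbT.
  by move: pi; rewrite leg1 /M; lra.
exists [:: (i, -1)]; first by rewrite !mem_cat (map_f _ (_ : i \in enum _)) ?mem_enum// !orbT.
have : p i < - M by rewrite ltNge; apply/negP => h; apply: hi; rewrite in_itv/= h.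
by rewrite leg1 /M; lra.
Qed.
End sampling.

(** Chernoff with [l] divided by [v e]: the two halves of [K(l,l)] cancel and leave [- a / v e]. The
    gap [a - b] pays for replacing the actual covariance by its limit. *)
Lemma half_space_near l (a b : R) : b < a -> \forall e \near 0^'+,
  (P [set w | (a < legendre K l (fun t => Z e t w))%R] <= (expR (- (b / v e)))%:E)%E.
Proof.
move=> ba; have ab : 0 < 2 * (a - b) by rewrite mulr_gt0// subr_gt0.
near=> e.
have e0 : 0 < e by near: e; exact: near_gt0.
have ve0 := v_gt0 e0.
have : `|kform (C e) l l - v e * kform K l l| <= 2 * (a - b) * v e by near: e; exact: kform_cov_near.
rewrite ler_norml => /andP[_ h].
have -> : [set w | (a < legendre K l (fun t => Z e t w))%R] =
  [set w | ((a + kform K l l / 2) / v e < pairing (dscale (v e)^-1 l) (fun t => Z e t w))%R].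
  have H w : (a < legendre K l (fun t => Z e t w)) =
     ((a + kform K l l / 2) / v e < pairing (dscale (v e)^-1 l) (fun t => Z e t w)).
    by rewrite pairing_scale [(v e)^-1 * _]mulrC ltr_pM2r ?invr_gt0// /legendre ltrBrDr.
  by apply/seteqP; split => w /=; rewrite H.
apply: (le_trans (chernoff (Zlaw e0) _ _)).
rewrite lee_fin ler_expR kform_scalel kform_scaler.
have -> : (v e)^-1 * ((v e)^-1 * kform (C e) l l) / 2 - (a + kform K l l / 2) / v e =
  ((v e)^-1 * kform (C e) l l - 2 * a - kform K l l) / 2 / v e by field; rewrite gt_eqF.
rewrite -[leRHS]mulNr ler_pM2r ?invr_gt0// ler_pdivrMr//.
have : (v e)^-1 * kform (C e) l l <= kform K l l + 2 * (a - b).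
  by rewrite mulrC ler_pdivrMr//; lra.
lra.
Unshelve. all: by end_near. Qed.

Lemma measurable_Y (e : R) (G : set (C01 R)) : 0 < e -> open G -> measurable (Y e @^-1` G).
Proof.
move=> e0; apply: open_preimage_measurable => t; have [s [+ _]] := Zlaw e0 [:: (t, 1)].
under eq_fun do rewrite pairing1.
by move=> mZ; under eq_fun do rewrite YE//; exact: measurable_funD.
Qed.

Lemma ldp_upper_near (F : set (C01 R)) (a a2 : R) : closed F -> a < a2 ->
  (forall h, F h -> (a2%:E < ldp_rate K m h)%E) ->
  \forall e \near 0^'+, (P (Y e @^-1` F) <= (expR (- (a / v e)))%:E)%E.
Proof.
move=> cF aa2 Fa2.
have [dd dd0 hdd] := level_dist Ksym kernel_pos Kdist m_cont cF Fa2.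
pose de := dd / 8; have de0 : 0 < de by rewrite divr_gt0.
(* The gaps serve in turn: [a1 < a2] for the compactness on the grid, [b < a1] for the covariance
   error in each half-space, [a < b] for the number of half-spaces. *)
pose b := a + (a2 - a) / 3; pose a1 := a + (a2 - a) / 3 * 2.
have ab : a < b by rewrite /b; lra.
have ba1 : b < a1 by rewrite /b /a1; lra.
have a12 : a1 < a2 by rewrite /a1; lra.
have c0 : 0 < `|b| + 1 by rewrite ltr_wpDl.
(* Makes the exponent of [osc_bad] equal to [|b| + 1], so that oscillations are rarer than the
   half-space events. *)
pose om := de ^+ 2 / (64 * (`|b| + 1)).
have om0 : 0 < om by rewrite divr_gt0 ?exprn_gt0// mulr_gt0.
have [r1 r10 hr1] := Kdist om0.
have [r2 r20 hr2] := level_modulus Ksym kernel_pos Kdist a2 de0.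
pose rho := Num.min r1 r2.
have rho0 : 0 < rho by rewrite lt_min r10.
have [N hN] := exists_mesh rho0.
have [L hL] := half_spaces_cover (fun i : 'I_N.+2 => grid R N i) a12 de0.
have Kom s t : `|val s - val t| < rho -> K s s + K t t - 2 * K s t <= om.
  by rewrite lt_min => /andP[/hr1].
pose B e l := [set w | (a1 < legendre K (push (fun i : 'I_N.+2 => grid R N i) l) (fun t => Z e t w))%R].
near=> e.
have e0 : 0 < e by near: e; exact: near_gt0.
have ve0 := v_gt0 e0.
have [A [mA PA oA]] : exists A : set Omega, [/\ measurable A,
    (P A <= (4 * expR (- (de ^+ 2 / (64 * om) / v e)))%:E)%E &
    forall w, ~ A w -> forall s t, `|val s - val t| < rho -> `|Z e s w - Z e t w| <= de].
  by near: e; exact: osc_bad.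
have mcl : forall t, `|me e t - m t| <= de by near: e; exact: me_cvg.
have PB : forall l, l \in L -> (P (B e l) <= (expR (- (b / v e)))%:E)%E.
  near: e; apply: (near_seq (Q := fun l e => (P (B e l) <= (expR (- (b / v e)))%:E)%E)) => l _.
  exact: half_space_near.
have mB l : measurable (B e l).
  rewrite (_ : B e l = [set w | (a1 + kform K (push (fun i : 'I_N.+2 => grid R N i) l) (push (fun i : 'I_N.+2 => grid R N i) l) / 2 < pairing (push (fun i : 'I_N.+2 => grid R N i) l) (fun t => Z e t w))%R]).
    exact: (measurable_halfspace (Zlaw e0)).
  by apply/seteqP; split => w; rewrite /B /= /legendre ltrBrDr.
have [mBL PBL] := measure_ex_le P L mB.
have sub : Y e @^-1` F `<=` A `|` [set w | exists2 l, l \in L & B e l w].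
  move=> w /= FY; have [Aw|nA] := pselect (A w); [by left|right].
  have [|l lL hl] := hL (fun i => Z e (grid R N i) w); last first.
    by exists l => //; rewrite /B /= legendre_push.
  (* Were the grid values close to a path [g] of rate at most [a2], small oscillations would bring
     the whole path [Y e w] within [dd] of [m + g], against the choice of [dd]. *)
  move=> g rg; apply: contrapT => hn.
  have hlt (i : 'I_N.+2) : `|g (grid R N i) - Z e (grid R N i) w| < de.
    by rewrite ltNge; apply/negP => h; apply: hn; exists i.
  have rg' : (rate K (fun t => ((m t + g t) - m t)%R : R) <= a2%:E)%E.
    by rewrite (_ : (fun t => _) = g)//; apply/funext => t; ring.
  have cg := rate_path_cont Ksym kernel_pos Kdist m_cont rg'.
  apply: (hdd (Y e w) (mkC01 cg) FY rg') => t; rewrite ev_mkC01 YE//.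
  pose i := Ordinal (grid_idx_le N t).
  have st := lt_trans (grid_close N t) hN.
  have h1 := oA w nA t (grid R N i) st.
  have h2 : `|g t - g (grid R N i)| <= de by apply: (hr2 _ rg); move: st; rewrite lt_min => /andP[].
  have h3 := hlt i; have h4 := mcl t.
  have -> : me e t + Z e t w - (m t + g t) = (me e t - m t) + (Z e t w - Z e (grid R N i) w) -
    ((g t - g (grid R N i)) + (g (grid R N i) - Z e (grid R N i) w)) by ring.
  have dde : dd = 8 * de by rewrite /de; field.
  apply: (le_lt_trans (ler_normB _ _)); apply: (le_lt_trans (lerD (ler_normD _ _) (ler_normD _ _))).
  by rewrite dde; exact: sum4_lt.
have mY : measurable (Y e @^-1` F).
  have := measurableC (measurable_Y e0 (closed_openC cF)); by rewrite preimage_setC setCK.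
apply: (@le_trans _ _ (P (A `|` [set w | exists2 l, l \in L & B e l w]))).
  by apply: le_measure; rewrite ?inE//; exact: measurableU.
apply: (le_trans (measureU2 _ _ _)) => //.
have sumB : (\sum_(l <- L) P (B e l) <= ((size L)%:R * expR (- (b / v e)))%:E)%E.
  apply: (@le_trans _ _ (\sum_(l <- L) (expR (- (b / v e)))%:E)%E).
    by rewrite !big_seq; apply: lee_sum => l lL; exact: PB.
  by rewrite sumEFin lee_fin big_const_seq count_predT iter_addr addr0 mulr_natl.
apply: (le_trans (leeD PA (le_trans PBL sumB))).
rewrite -EFinD lee_fin.
have E1 : expR (- (de ^+ 2 / (64 * om) / v e)) <= expR (- (b / v e)).
  rewrite ler_expR lerN2 ler_pM2r ?invr_gt0//.
  rewrite (_ : de ^+ 2 / (64 * om) = `|b| + 1); first by have := ler_norm b; lra.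
  by rewrite /om; field; rewrite gt_eqF// gt_eqF//.
have : (4 + (size L)%:R) * expR (- ((b - a) / v e)) <= 1.
  by near: e; apply: near_exp_le => //; rewrite subr_gt0.
rewrite (_ : - ((b - a) / v e) = - (b / v e) + a / v e); last by field; rewrite gt_eqF.
rewrite expRD mulrA -ler_pdivlMr ?expR_gt0// div1r -expRN => h.
by apply: (le_trans _ h); rewrite [leRHS]mulrDl lerD2r ler_wpM2l.
Unshelve. all: by end_near. Qed.

Lemma ldp_lower_near (G : set (C01 R)) (h : C01 R) (a b : R) : open G -> G h ->
  (ldp_rate K m h <= a%:E)%E -> a < b ->
  \forall e \near 0^'+, ((expR (- (b / v e)))%:E <= P (Y e @^-1` G))%E.
Proof.
move=> oG Gh ra ab.
have /C01_nbhsP[dd dd0 ddG] : nbhs h G by exact: open_nbhs_nbhs.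
have dd8 : 0 < dd / 8 by rewrite divr_gt0.
pose c' := (b - a) / 8; have c'0 : 0 < c' by rewrite divr_gt0// subr_gt0.
have ac' : a < a + c' by rewrite ltrDl.
have [mu [kmu gmu]] := riesz_approx Ksym kernel_pos dd8 ac' ra K_le.
set k := kform K mu mu in kmu.
have k0 : 0 <= k := kernel_pos mu.
have D0 := dmass_ge0 mu; have D1 : 0 < dmass mu + 1 by rewrite ltr_wpDl.
(* The first bound keeps the path in the ball around [h]; the second keeps [mu(Z)] within [c'] of
   [K(mu,mu)] when [Z] is within [3 * de] of [K mu]. *)
pose de := Num.min (dd / 8) (c' / (3 * (dmass mu + 1))).
have de0 : 0 < de by rewrite lt_min dd8/= divr_gt0// mulr_gt0.
have de_dd : de <= dd / 8 by rewrite ge_min lexx.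
have de_c' : 3 * de * dmass mu <= c'.
  have : de <= c' / (3 * (dmass mu + 1)) by rewrite ge_min lexx orbT.
  rewrite ler_pdivlMr ?mulr_gt0// => hde; apply: le_trans hde.
  by rewrite mulrA [de * 3]mulrC ler_wpM2l ?mulr_ge0 ?(ltW de0)// lerDl.
(* Gives the oscillation event the exponent [(k + 2) / v e], which must beat its weight [tau / 2]
   below. *)
pose om := de ^+ 2 / (64 * (k + 2)).
have k2 : 0 < k + 2 by rewrite ltr_wpDl.
have om0 : 0 < om by rewrite divr_gt0 ?exprn_gt0// mulr_gt0.
have omE : de ^+ 2 / (64 * om) = k + 2 by rewrite /om; field; rewrite !gt_eqF.
have [r1 r10 hr1] := Kdist om0.
have [r2 r20 hr2] := level_modulus Ksym kernel_pos Kdist (k / 2) de0.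
pose rho := Num.min r1 r2.
have rho0 : 0 < rho by rewrite lt_min r10.
have [N hN] := exists_mesh rho0.
have Kom s t : `|val s - val t| < rho -> K s s + K t t - 2 * K s t <= om.
  by rewrite lt_min => /andP[/hr1].
have KB1 : 0 < `|KB| + 1 by rewrite ltr_wpDl.
(* The slope at which the quadratic cost of a grid constraint takes at most half of its gain. *)
pose c := de / (2 * (`|KB| + 1)).
have c0 : 0 < c by rewrite divr_gt0// mulr_gt0.
have cKB : c * (`|KB| + 1) <= de / 2.
  by rewrite le_eqVlt; apply/orP; left; apply/eqP; rewrite /c; field; rewrite gt_eqF.
pose I := ('I_N.+2 * bool)%type.
pose sg (x : bool) : R := if x then 1 else -1.
have sgP x : sg x = 1 \/ sg x = -1 by case: x; [left|right].
pose g0 := kpath K mu.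
have eta1 : 0 < Num.min c' 2^-1 by rewrite lt_min c'0/=.
have eta2 : 0 < Num.min 1 (de / (4 * (dmass mu + 1))) by rewrite lt_min ltr01/= divr_gt0// mulr_gt0.
near=> e.
have e0 : 0 < e by near: e; exact: near_gt0.
have ve0 := v_gt0 e0.
have [A [mA PA oA]] : exists A : set Omega, [/\ measurable A,
    (P A <= (4 * expR (- (de ^+ 2 / (64 * om) / v e)))%:E)%E &
    forall w, ~ A w -> forall s t, `|val s - val t| < rho -> `|Z e s w - Z e t w| <= de].
  by near: e; exact: osc_bad.
have mcl : forall t, `|me e t - m t| <= de by near: e; exact: me_cvg.
have cov1 : `|kform (C e) mu mu - v e * k| <= Num.min c' 2^-1 * v e.
  by near: e; exact: kform_cov_near.
have cov2 : forall s t, `|C e s t - v e * K s t| <= Num.min 1 (de / (4 * (dmass mu + 1))) * v e.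
  by near: e; exact: Zcov.
have small1 : 2 * expR (- (1 / v e)) <= 8^-1 by near: e; exact: near_exp_le.
have small2 : 2^-1 * expR (- (2^-1 / v e)) <= 8^-1 by near: e; exact: near_exp_le.
have small3 : #|{: I}|%:R * expR (- (c * de / 2 / v e)) <= 4^-1.
  by near: e; apply: near_exp_le => //; rewrite divr_gt0// mulr_gt0.
have small4 : 1 * expR (- (c' / v e)) <= 2^-1 by near: e; exact: near_exp_le.
have Cii t : C e t t <= v e * (`|KB| + 1).
  by apply: diag_le (K_le t) (cov2 t t); rewrite // ge_min lexx.
have Cmu t : `|kpath (C e) mu t - v e * g0 t| <= de / 4 * v e.
  rewrite /g0 /kpath -pairingZ.
  apply: (le_trans (pairing_sub_le _ (fun s => cov2 t s))).
  rewrite mulrA ler_wpM2r ?(ltW ve0)//.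
  have : Num.min 1 (de / (4 * (dmass mu + 1))) <= de / (4 * (dmass mu + 1)) by rewrite ge_min lexx orbT.
  move=> hmin; apply: (le_trans (ler_wpM2l D0 hmin)).
  rewrite mulrA ler_pdivrMr ?mulr_gt0// (_ : de / 4 * _ = de * (dmass mu + 1)); last by field.
  by rewrite mulrC ler_wpM2l ?(ltW de0)// lerDl.
(* With [r], the two sides of [|Z - g0| <= de] at a grid point, multiplied by [c / v e] so that each
   violation is exponentially small under the tilt. *)
pose nu (i : I) := dscale (sg i.2 * c / v e) [:: (grid R N i.1, 1)].
pose r (i : I) := sg i.2 * c / v e * g0 (grid R N i.1) + c * de / v e.
pose D := ~` A `&` [set w | forall i, pairing (nu i) (fun t => Z e t w) <= r i].
have mD : measurable D.
  apply: measurableI; first exact: measurableC.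
  rewrite (_ : [set w | _] = \bigcap_(i in [set: I]) [set w | pairing (nu i) (fun t => Z e t w) <= r i]).
    by apply: fin_bigcap_measurable => [|i _]; [exact: finite_finset|exact: (measurable_halfspace_le (Zlaw e0))].
  by apply/seteqP; split => w /= hw i; [move=> _|]; exact: hw.
have rg0 : (rate K g0 <= (k / 2)%:E)%E by exact: (rate_kpath Ksym kernel_pos).
have Dclose w : D w -> forall t, `|Z e t w - g0 t| <= 3 * de.
  move=> [nA Dw] t; pose i := Ordinal (grid_idx_le N t).
  have st := lt_trans (grid_close N t) hN.
  have h1 := oA w nA t (grid R N i) st.
  have h2 : `|g0 t - g0 (grid R N i)| <= de by apply: (hr2 _ rg0); move: st; rewrite lt_min => /andP[].
  have h3 : `|Z e (grid R N i) w - g0 (grid R N i)| <= de.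
    have cv0 : 0 < c / v e by rewrite divr_gt0.
    have q1 : pairing (nu (i, true)) (fun t => Z e t w) <= r (i, true) := Dw (i, true).
    have q2 : pairing (nu (i, false)) (fun t => Z e t w) <= r (i, false) := Dw (i, false).
    move: q1 q2; rewrite /nu /r !pairing_scale !pairing1 /=.
    by rewrite mul1r mulN1r (mulrAC c de) [- c / v e]mulNr; exact: two_sided_le.
  have -> : Z e t w - g0 t = (Z e t w - Z e (grid R N i) w) + (Z e (grid R N i) w - g0 (grid R N i)) -
     (g0 t - g0 (grid R N i)) by ring.
  apply: (le_trans (ler_normB _ _)); apply: (le_trans (lerD (ler_normD _ _) (lexx _))).
  exact: sum3_le.
have DG : D `<=` Y e @^-1` G.
  move=> w Dw; apply: ddG => t; rewrite YE//.
  have -> : me e t + Z e t w - ev h t = (me e t - m t) + (Z e t w - g0 t) - ((ev h t - m t) - g0 t) by ring.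
  apply: (le_lt_trans (ler_normB _ _)); apply: (le_lt_trans (lerD (ler_normD _ _) (lexx _))).
  have h1 := mcl t; have h2 := Dclose w Dw t; have h3 := gmu t.
  rewrite -/g0 in h3; move: dd0 de_dd h1 h2 h3; exact: sum5_lt.
have mG := measurable_Y e0 oG.
apply: (@le_trans _ _ (P D)); last by apply: le_measure; rewrite ?inE.
pose mu' := dscale (v e)^-1 mu.
pose M := (k + c') / v e.
have DM w : D w -> pairing mu' (fun t => Z e t w) <= M.
  move=> Dw; rewrite /mu' pairing_scale mulrC ler_pM2r ?invr_gt0//.
  have := ler_normlW (pairing_sub_le mu (Dclose w Dw)).
  rewrite (_ : pairing mu g0 = k)// => h1.
  by rewrite -lerBlDl (le_trans h1)// mulrC.
(* Balances two errors: [tau * P A] is small because [P A] decays with exponent [(k + 2) / v e], and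
   [expR kv / tau] because [kv] is at most [(k + 2^-1) / v e]. *)
pose tau := expR ((k + 1) / v e).
have tau0 : 0 < tau by exact: expR_gt0.
have Dcov w : ~ A w -> (forall i, pairing (nu i) (fun t => Z e t w) < r i) -> D w.
  by move=> nA hr; split => // i; exact: ltW.
have := tilt_bound (Zlaw e0) mD mA tau0 Dcov DM.
have PDE : P D = (fine (P D))%:E by rewrite fineK// fin_num_measure.
have PAE : P A = (fine (P A))%:E by rewrite fineK// fin_num_measure.
rewrite sumEFin PDE PAE -!EFinM -!EFinD !lee_fin.
set kv := kform (C e) mu' mu'; set p := fine (P D); set pA := fine (P A) => main.
have kvE : kv = kform (C e) mu mu / v e ^+ 2.
  by rewrite /kv /mu' kform_scalel kform_scaler; field; rewrite gt_eqF.
have cov1' : `|kform (C e) mu mu - v e * k| <= c' * v e.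
  by apply: (le_trans cov1); rewrite ler_wpM2r ?(ltW ve0)// ge_min lexx.
apply: (tilt_final ve0 (erefl M) kvE cov1' kmu _ c'0 main).
- by rewrite /c'; field.
- move: PA; rewrite PAE lee_fin -/pA omE => PA.
  apply: le_trans small1.
  have -> : expR (- (1 / v e)) = tau * expR (- ((k + 2) / v e)).
    by rewrite -expRD; congr expR; field; rewrite gt_eqF.
  rewrite [leRHS](_ : _ = tau / 2 * (4 * expR (- ((k + 2) / v e)))); last by field.
  by rewrite ler_wpM2l// divr_ge0// ltW.
- apply: le_trans small2; rewrite invfM mulrCA ler_pM2l ?invr_gt0// /tau -expRN -expRD ler_expR.
  rewrite -subr_ge0 (_ : _ - _ = (k + 2^-1 - kform (C e) mu mu / v e) / v e); last first.
    by rewrite kvE; field; rewrite gt_eqF.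
  apply: divr_ge0; last exact: ltW.
  rewrite subr_ge0 ler_pdivrMr// mulrDl -lerBlDl mulrC.
  apply: (le_trans (ler_norm _)); apply: (le_trans cov1).
  by rewrite ler_wpM2r ?(ltW ve0)// ge_min lexx orbT.
- apply: le_trans small3.
  apply: (@le_trans _ _ (\sum_(i : I) expR (- (c * de / 2 / v e)))); last first.
    by rewrite big_const iter_addr addr0 mulr_natl.
  apply: ler_sum => i _.
  rewrite ler_expR /nu /mu' kform_scalel kform_scaler kform_scalel kform_scaler !kform1 /kpath !pairing1.
  exact: (tilted_exponent_le ve0 (ltW c0) (sgP i.2) cKB (Cii _) (Cmu _)).
- by rewrite -[expR _]mul1r.
Unshelve. all: by end_near. Qed.

Lemma gaussian_LDP : LDP P Y v (ldp_rate K m).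
Proof.
split => //.
- by move=> e e0 G oG; exact: measurable_Y.
- exact: (ldp_rate_good Ksym kernel_pos Kdist m_cont).
- move=> G oG; rewrite /limf_einf leeN2; apply: le_ereal_inf_tmp => _ [h Gh <-].
  have r0 : (0 <= ldp_rate K m h)%E by exact: rate_ge0.
  have [->|rfin] := eqVneq (ldp_rate K m h) +oo%E; first by rewrite leey.
  have rE : ldp_rate K m h = (fine (ldp_rate K m h))%:E.
    by rewrite fineK// ge0_fin_numE// lt_neqAle rfin leey.
  rewrite rE; apply/lee_addgt0Pr => x x0; apply: limf_esup_le.
  have rle : (ldp_rate K m h <= (fine (ldp_rate K m h))%:E)%E by rewrite -rE.
  near=> e; have e0 : 0 < e by near: e; exact: near_gt0.
  rewrite -EFinD leeNl -EFinN; apply: mule_lne_ge => //; first exact: v_gt0.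
  near: e; apply: (ldp_lower_near oG Gh rle); by rewrite ltrDl.
- move=> F cF; set i := ereal_inf _.
  have i0 : (0 <= i)%E by apply: le_ereal_inf_tmp => _ [h _ <-]; exact: rate_ge0.
  have H (a a2 : R) : a < a2 -> (a2%:E < i)%E ->
      (limf_esup (fun e => ((v e)%:E * lne (P (Y e @^-1` F)))%E) 0^'+ <= (- a)%:E)%E.
    move=> aa2 a2i; apply: limf_esup_le.
    have Fa2 h : F h -> (a2%:E < ldp_rate K m h)%E.
      by move=> Fh; apply: (lt_le_trans a2i); apply: ereal_inf_lbound; exists h.
    near=> e; have e0 : 0 < e by near: e; exact: near_gt0.
    apply: mule_lne_le => //; first exact: v_gt0.
    by near: e; exact: (ldp_upper_near cF aa2 Fa2).
  move: i0 H; case: i => [i| |]// _ H.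
    rewrite -EFinN; apply/lee_addgt0Pr => x x0; rewrite -EFinD (_ : - i + x = - (i - x)); last by ring.
    by apply: (H (i - x) (i - x / 2)); rewrite ?lte_fin; lra.
  (* The infimum is [+oo], so [H] holds at every level. A finite upper limit [l] would be at most
     [l - 1], and the value [+oo] is excluded by the level 0. *)
  set l := limf_esup _ _ in H *; move: H; case: l => [l| |]// H.
    have ll : (1 - l)%R < (2 - l)%R by lra.
    by exfalso; have := H _ _ ll (ltry _); rewrite lee_fin; lra.
  by have := H _ _ ltr01 (ltry _).
Unshelve. all: by end_near. Qed.

End gaussian_ldp.

(** * The reproducing kernel Hilbert space norm *)

Section riemann_sums.
Context (R : realType).
Implicit Types (f : R -> R) (t : I01 R).

Definition unif_cont f := forall e : R, 0 < e -> exists2 r : R, 0 < r &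
  forall s t : I01 R, `|val s - val t| < r -> `|f (val s) - f (val t)| <= e.

(** Half-open, so that the cells are disjoint; the one of index [N.+1] is the single point 1, which
    is why [sampled] has [N.+2] terms. *)
Definition cell (N i : nat) : set R :=
  `[0, 1]%classic `&` `[i%:R / N.+1%:R, i.+1%:R / N.+1%:R[%classic.

Definition sampled (nu : set R -> \bar R) (N : nat) : seq (I01 R * R) :=
  [seq (grid R N i, fine (nu (cell N i))) | i <- iota 0 N.+2].

Lemma measurable_cell N i : measurable (cell N i).
Proof. by apply: measurableI; exact: measurable_itv. Qed.

Lemma cellE N i t : (val t \in cell N i) = (grid_idx N t == i).
Proof.
have N0 : (0 : R) < N.+1%:R by [].
rewrite /grid_idx truncn_eq ?mulr_ge0 ?I01_ge0//.
apply/idP/idP; first rewrite inE => -[_ /=]; rewrite ?in_itv/=.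
  by rewrite ler_pdivrMr// ltr_pdivlMr// [val t * _]mulrC.
move=> h; rewrite inE; split; first exact: (set_valP t).
by rewrite /= in_itv/= ler_pdivrMr// ltr_pdivlMr// [val t * _]mulrC.
Qed.

Lemma pairing_sampled nu N (g : I01 R -> R) :
  pairing (sampled nu N) g = \sum_(i <- iota 0 N.+2) fine (nu (cell N i)) * g (grid R N i).
Proof. by rewrite /pairing big_map. Qed.

Lemma unif_cont_measurable f : unif_cont f -> measurable_fun (`[0, 1]%classic : set R) f.
Proof.
move=> uf; have cf : continuous (f \o @clip R).
  move=> x; apply/cvgrPdist_lt => e e0; have e2 : 0 < e / 2 by rewrite divr_gt0.
  have [r r0 hr] := uf _ e2; near=> y; apply: (@le_lt_trans _ _ (e / 2)); last lra.
  apply: (hr (toI x) (toI y)) => /=; apply: (le_lt_trans (clip_lip _ _)).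
  by near: y; exact: cvgr_dist_lt.
apply: (eq_measurable_fun (f \o @clip R)).
  move=> x; rewrite inE => x01 /=; congr f.
  by move: x01; rewrite /= in_itv => /(@val_toI R x).
by apply: measurable_funTS; exact: continuous_measurable_fun.
Unshelve. all: by end_near. Qed.

Lemma unif_cont_cst (c : R) : unif_cont (fun=> c).
Proof. by move=> e e0; exists 1 => // s t _; rewrite subrr normr0 ltW. Qed.

Section finite_measure.
Variable nu : {finite_measure set R -> \bar R}.
Local Notation D := (`[0%R, 1%R]%classic : set R).

Let mD : measurable D. Proof. exact: measurable_itv. Qed.

Let nuD : (nu D < +oo)%E.
Proof. by rewrite -ge0_fin_numE// fin_num_measure. Qed.

Lemma unif_cont_integrable f : unif_cont f -> nu.-integrable D (EFin \o f).
Proof.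
move=> uf; apply: measurable_bounded_integrable => //; first exact: unif_cont_measurable.
have [r r0 hr] := uf _ ltr01; have [N hN] := exists_mesh r0.
exists (1 + \sum_(i < N.+2) `|f (val (grid R N i))|); split; first exact: num_real.
move=> y hy x x01 /=; apply: (le_trans _ (ltW hy)).
pose t := toI x; have xt : x = val t by rewrite /t val_toI//; move: x01; rewrite /= in_itv.
rewrite xt -(subrK (f (val (grid R N (grid_idx N t)))) (f (val t))).
apply: (le_trans (ler_normD _ _)); apply: lerD.
  by apply: hr; exact: lt_trans (grid_close N t) hN.
rewrite (bigD1 (Ordinal (grid_idx_le N t)))//= lerDl; exact: sumr_ge0.
Qed.

Lemma riemann_sum f N (w : R) : unif_cont f ->
  (forall t, `|f (val t) - f (val (grid R N (grid_idx N t)))| <= w) ->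
  `|\int[nu]_(x in D) f x - pairing (sampled nu N) (f \o val)| <= w * fine (nu D).
Proof.
(* The step function equal on each cell to the value of [f] at its left end; its integral is exactly
   the Riemann sum. *)
move=> uf fw; pose phi x := pairing [seq (i, f (val (grid R N i))) | i <- iota 0 N.+2] (fun i => \1_(cell N i) x : R).
have i1 (i : nat) : nu.-integrable D (EFin \o (\1_(cell N i) : R -> R)).
  apply: measurable_bounded_integrable => //; first by apply: measurable_indic; exact: measurable_cell.
  exists 1; split; first exact: num_real.
  move=> y y1 x _ /=; rewrite indicE; case: (_ \in _); rewrite ?normr1 ?normr0 ltW//.
  exact: lt_trans y1.
have phiE t : phi (val t) = f (val (grid R N (grid_idx N t))).
  rewrite /phi /pairing big_map (bigD1_seq (grid_idx N t)) ?iota_uniq ?mem_iota ?grid_idx_le//.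
  rewrite big1 => [|i ne]; last by rewrite indicE cellE eq_sym (negbTE ne) mulr0.
  by rewrite indicE cellE eqxx mulr1; exact: addr0.
have [iphi phiI] := pairing_integral mD [seq (i, f (val (grid R N i))) | i <- iota 0 N.+2] i1.
have -> : pairing (sampled nu N) (f \o val) = \int[nu]_(x in D) phi x.
  rewrite /phi phiI pairing_sampled /pairing big_map; apply: eq_bigr => i _ /=.
  rewrite mulrC; congr (_ * _); rewrite /Rintegral integral_indic//; last exact: measurable_cell.
  by rewrite setIAC setIid.
have int_f := unif_cont_integrable uf.
rewrite -RintegralB//.
have iB : nu.-integrable D (EFin \o (fun x => f x - phi x)).
  exact: (integrableB mD int_f iphi).
apply: (le_trans (le_normr_Rintegral mD iB)).
rewrite -Rintegral_cst//; apply: le_Rintegral => //.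
- exact: integrable_norm.
- by apply: unif_cont_integrable; exact: unif_cont_cst.
move=> x x01; pose t := toI x; have xt : x = val t by rewrite /t val_toI//; move: x01; rewrite /= in_itv.
by rewrite xt phiE.
Qed.

Lemma sum_cells N : \sum_(i <- iota 0 N.+2) fine (nu (cell N i)) = fine (nu D).
Proof.
have := @riemann_sum (fun=> 1) N 0 (unif_cont_cst 1).
rewrite mul0r => /(_ _)/wrap[]; first by move=> t; rewrite subrr normr0.
rewrite normr_le0 subr_eq0 Rintegral_cst// mul1r => /eqP ->.
by rewrite pairing_sampled; apply: eq_bigr => i _; rewrite mulr1.
Qed.
End finite_measure.

Section charges.
Variable lam : {charge set R -> \bar R}.
Local Notation D := (`[0%R, 1%R]%classic : set R).
Let nu1 : {finite_measure set R -> \bar R} := jordan_pos (hahnP lam).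
Let nu2 : {finite_measure set R -> \bar R} := jordan_neg (hahnP lam).

Definition variation : R := fine (nu1 D) + fine (nu2 D).

Lemma variation_ge0 : 0 <= variation.
Proof. by rewrite addr_ge0// fine_ge0. Qed.

Lemma charge_cell N i : fine (lam (cell N i)) = fine (nu1 (cell N i)) - fine (nu2 (cell N i)).
Proof.
have mc := measurable_cell N i.
rewrite (jordan_decomp (hahnP lam) mc) /cadd/= cscaleN1 fineB//; exact: fin_num_measure.
Qed.

Lemma dmass_sampled N : dmass (sampled lam N) <= variation.
Proof.
rewrite /dmass big_map /variation -!(sum_cells _ N) -big_split/=; apply: ler_sum => i _.
rewrite charge_cell; apply: (le_trans (ler_normB _ _)).
by rewrite !ger0_norm ?fine_ge0.
Qed.

Lemma charge_riemann f N (w : R) : unif_cont f ->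
  (forall t, `|f (val t) - f (val (grid R N (grid_idx N t)))| <= w) ->
  `|charge_integral lam D f - pairing (sampled lam N) (f \o val)| <= w * variation.
Proof.
move=> uf fw; have h1 := riemann_sum nu1 uf fw; have h2 := riemann_sum nu2 uf fw.
have -> : pairing (sampled lam N) (f \o val) =
  pairing (sampled nu1 N) (f \o val) - pairing (sampled nu2 N) (f \o val).
  by rewrite !pairing_sampled -sumrB; apply: eq_bigr => i _; rewrite charge_cell mulrBl.
have -> : charge_integral lam D f - (pairing (sampled nu1 N) (f \o val) - pairing (sampled nu2 N) (f \o val)) =
  (\int[nu1]_(x in D) f x - pairing (sampled nu1 N) (f \o val)) -
  (\int[nu2]_(x in D) f x - pairing (sampled nu2 N) (f \o val)).
  by rewrite /charge_integral -/nu1 -/nu2; ring.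
by apply: (le_trans (ler_normB _ _)); rewrite /variation mulrDr lerD.
Qed.

Lemma charge_riemann_cvg f : unif_cont f -> forall e : R, 0 < e ->
  exists N0, forall N, (N0 <= N)%N -> `|charge_integral lam D f - pairing (sampled lam N) (f \o val)| <= e.
Proof.
move=> uf e e0; have V1 : 0 < variation + 1 by rewrite ltr_wpDl// variation_ge0.
have [r r0 hr] := uf _ (divr_gt0 e0 V1); have [N0 hN0] := exists_mesh r0.
exists N0 => N NN.
apply: (le_trans (@charge_riemann f N (e / (variation + 1)) uf _)).
  move=> t; apply: hr; apply: lt_trans (grid_close N t) _; apply: le_lt_trans hN0.
  by rewrite lef_pV2 ?posrE// ler_nat.
by rewrite mulrAC ler_pdivrMr// ler_wpM2l ?(ltW e0)// lerDl.
Qed.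

End charges.

Lemma sampled_add (lam lam' : {charge set R -> \bar R}) (c : R) N g :
  pairing (sampled (cadd lam (cscale c lam')) N) g =
  pairing (sampled lam N) g + c * pairing (sampled lam' N) g.
Proof.
rewrite !pairing_sampled mulr_sumr -big_split/=; apply: eq_bigr => i _.
have mc := measurable_cell N i.
have f1 := fin_num_measure lam _ mc; have f2 := fin_num_measure lam' _ mc.
by rewrite /cadd /cscale/= fineD// ?fin_numM// fineM//=; ring.
Qed.

Lemma unif_cvgP (F : nat -> I01 R -> R) (g : I01 R -> R) : {uniform, F @ \oo --> g} <->
  forall w : R, 0 < w -> exists N, forall j, (N <= j)%N -> forall t, `|g t - F j t| <= w.
Proof.
split=> [hF w w0|hF].
  have : nbhs (g : {uniform I01 R -> R}) [set h | forall t, `|g t - h t| <= w].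
    apply/uniform_nbhs; exists [set xy | ball xy.1 w xy.2]; split.
      exact: entourage_ball (PosNum w0).
    by move=> h /= hh t; apply: ltW; exact: (hh t I).
  by move=> /hF[N _ hN]; exists N => j Nj; exact: hN.
move=> P /uniform_nbhs[E [entE subP]].
move: entE; rewrite -entourage_ballE => -[w /= w0 wE].
have w2 : 0 < w / 2 by rewrite divr_gt0.
have [N hN] := hF _ w2; exists N => // j /= Nj; apply: subP => t _; apply: wE => /=.
by apply: (le_lt_trans (hN j Nj t)); lra.
Qed.

Lemma le_eps_eq (x y c : R) : (forall e : R, 0 < e -> `|x - y| <= c * e) -> x = y.
Proof.
move=> h; apply/eqP; rewrite -subr_eq0 -normr_le0; apply/ler_addgt0Pr => e e0.
have c1 : 0 < `|c| + 1 by rewrite ltr_wpDl.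
apply: (le_trans (h _ (divr_gt0 e0 c1))); rewrite add0r mulrCA -[leRHS]mulr1 ler_wpM2l ?(ltW e0)//.
by rewrite ler_pdivrMr// mul1r; have := ler_norm c; lra.
Qed.

(** The Jordan decomposition is not additive in the charge. Riemann sums are, because they use the
    charge of each cell, so linearity is proved in the limit. *)
Lemma charge_integral_add (lam lam' : {charge set R -> \bar R}) (c : R) f : unif_cont f ->
  charge_integral (cadd lam (cscale c lam')) `[0, 1] f =
  charge_integral lam `[0, 1] f + c * charge_integral lam' `[0, 1] f.
Proof.
move=> uf; apply: (@le_eps_eq _ _ (2 + `|c|)) => e e0.
have [N1 h1] := charge_riemann_cvg (cadd lam (cscale c lam')) uf e0.
have [N2 h2] := charge_riemann_cvg lam uf e0.
have [N3 h3] := charge_riemann_cvg lam' uf e0.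
pose N := maxn N1 (maxn N2 N3).
have {}h1 := h1 N; have {}h2 := h2 N; have {}h3 := h3 N.
move: h1 h2 h3; rewrite !leq_max !leqnn !orbT => /(_ isT) + /(_ isT) + /(_ isT).
rewrite sampled_add; set x := charge_integral _ _ _; set y := charge_integral _ _ _.
set z := charge_integral _ _ _; set x' := pairing _ _; set y' := pairing _ _ => h1 h2 h3.
rewrite (_ : x - (y + c * z) = (x - (x' + c * y')) - ((y - x') + c * (z - y'))); last by ring.
apply: (le_trans (ler_normB _ _)); apply: (le_trans (lerD (lexx _) (ler_normD _ _))).
have : `|c * (z - y')| <= `|c| * e by rewrite normrM ler_wpM2l.
lra.
Qed.

Lemma charge_integral_dirac (t : I01 R) f : unif_cont f ->
  charge_integral (charge_of_finite_measure \d_(val t)) `[0, 1] f = f (val t).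
Proof.
move=> uf; apply: (@le_eps_eq _ _ 2) => e e0.
have [N1 h1] := charge_riemann_cvg (charge_of_finite_measure \d_(val t)) uf e0.
have [r r0 hr] := uf e e0; have [N2 hN2] := exists_mesh r0.
pose N := maxn N1 N2; have {}h1 := h1 N (leq_maxl _ _).
have : pairing (sampled (charge_of_finite_measure \d_(val t)) N) (f \o val) = f (val (grid R N (grid_idx N t))).
  rewrite pairing_sampled (bigD1_seq (grid_idx N t)) ?iota_uniq ?mem_iota ?grid_idx_le//.
  have cv i : charge_of_finite_measure \d_(val t) (cell N i) = ((grid_idx N t == i)%:R)%:E :> \bar R.
    by rewrite -cellE; exact: diracE.
  rewrite big1 => [|i ne]; last by rewrite cv eq_sym (negbTE ne) mul0r.
  by rewrite cv eqxx mul1r; exact: addr0.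
move=> hE; rewrite hE in h1.
have h2 : `|f (val t) - f (val (grid R N (grid_idx N t)))| <= e.
  apply: hr; apply: lt_trans (grid_close N t) _; apply: le_lt_trans hN2.
  by rewrite lef_pV2 ?posrE// ler_nat; exact: leq_maxr.
move: h1 h2; set x := charge_integral _ _ _; set y := f _; set z := f _ => h1 h2.
rewrite (_ : x - z = (x - y) - (z - y)); last by ring.
by apply: (le_trans (ler_normB _ _)); lra.
Qed.

Lemma charge_integral_zero f : unif_cont f -> charge_integral (czero : {charge set R -> \bar R}) `[0, 1] f = 0.
Proof.
move=> uf; apply: (@le_eps_eq _ _ 1) => e e0.
have [N /(_ N (leqnn _))] := charge_riemann_cvg (czero : {charge set R -> \bar R}) uf e0.
by rewrite pairing_sampled big1 ?mul1r// => i _; rewrite /czero mul0r.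
Qed.

Fixpoint dcharge (mu : seq (I01 R * R)) : {charge set R -> \bar R} :=
  if mu is p :: mu' then
    cadd (dcharge mu') (cscale p.2 (charge_of_finite_measure \d_(val p.1)))
  else czero.

Lemma charge_integral_dcharge mu f : unif_cont f ->
  charge_integral (dcharge mu) `[0, 1] f = pairing mu (f \o val).
Proof.
move=> uf; elim: mu => [|p mu ih]; first by rewrite pairing_nil charge_integral_zero.
by rewrite /= charge_integral_add// ih charge_integral_dirac// pairing_cons addrC.
Qed.

End riemann_sums.

(** * Energies of signed measures and the identification of the rate *)

Section kernel_space.
Context (R : realType) (q : R -> R -> R) (KB : R).
Let K (s t : I01 R) : R := q (val s) (val t).
Hypothesis Ksym : forall s t, K s t = K t s.
Hypothesis Kpos : forall mu, 0 <= kform K mu mu.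
Hypothesis K_le : forall t, K t t <= KB.
Hypothesis quc : forall e : R, 0 < e -> exists2 r : R, 0 < r &
  forall s t u : I01 R, `|val s - val t| < r -> `|K u s - K u t| <= e.
Implicit Types (lam : {charge set R -> \bar R}) (g : I01 R -> R).

(* The square of [kernel_norm lam]. *)
Definition energy lam : R :=
  charge_integral lam `[0, 1] (fun t => charge_integral lam `[0, 1] (fun s => q t s)).

Lemma row_unif_cont (u : I01 R) : unif_cont (q (val u)).
Proof. by move=> e /quc[r r0 hr]; exists r => // s t; exact: hr. Qed.

Lemma path_near lam (e : R) : 0 < e -> exists N0, forall N, (N0 <= N)%N ->
  forall t, `|kernel_path q lam t - kpath K (sampled lam N) t| <= e.
Proof.
move=> e0; have V1 : 0 < variation lam + 1 by rewrite ltr_wpDl// variation_ge0.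
have [r r0 hr] := quc (divr_gt0 e0 V1); have [N0 hN0] := exists_mesh r0.
exists N0 => N NN t.
apply: (le_trans (@charge_riemann _ lam (q (val t)) N (e / (variation lam + 1)) (row_unif_cont t) _)).
  move=> s; apply: hr; apply: lt_trans (grid_close N s) _; apply: le_lt_trans hN0.
  by rewrite lef_pV2 ?posrE// ler_nat.
by rewrite mulrAC ler_pdivrMr// ler_wpM2l ?(ltW e0)// lerDl.
Qed.

Lemma path_unif_cont lam :
  unif_cont (fun t => charge_integral lam `[0, 1] (fun s => q t s)).
Proof.
move=> e e0; have e3 : 0 < e / 3 by rewrite divr_gt0.
have V1 : 0 < variation lam + 1 by rewrite ltr_wpDl// variation_ge0.
have [r r0 hr] := quc (divr_gt0 e3 V1); have [N0 /(_ N0 (leqnn _)) hN] := path_near lam e3.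
exists r => // s t st; have hs := hN s; have ht := hN t.
rewrite (_ : _ - _ = (kernel_path q lam s - kpath K (sampled lam N0) s) -
  (kernel_path q lam t - kpath K (sampled lam N0) t) +
  (kpath K (sampled lam N0) s - kpath K (sampled lam N0) t)); last first.
  by rewrite /kernel_path; ring.
have h3 : `|kpath K (sampled lam N0) s - kpath K (sampled lam N0) t| <= e / 3.
  apply: (@le_trans _ _ (dmass (sampled lam N0) * (e / 3 / (variation lam + 1)))).
    by apply: pairing_sub_le => u; rewrite (Ksym s) (Ksym t); exact: hr.
  rewrite mulrCA -[leRHS]mulr1 ler_wpM2l ?(ltW e3)// ler_pdivrMr// mul1r.
  by apply: (le_trans (dmass_sampled lam N0)); rewrite lerDl.
apply: (le_trans (ler_normD _ _)); apply: (le_trans (lerD (ler_normB _ _) (lexx _))); lra.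
Qed.

(** Two errors: the outer integral against a Riemann sum, then the inner path against its
    discretization. The second is multiplied by a mass bounded by the variation, uniformly in
    [N]. *)
Lemma energy_near lam (e : R) : 0 < e -> exists N0, forall N, (N0 <= N)%N ->
  `|energy lam - kform K (sampled lam N) (sampled lam N)| <= e.
Proof.
move=> e0; have e2 : 0 < e / 2 by rewrite divr_gt0.
have V1 : 0 < variation lam + 1 by rewrite ltr_wpDl// variation_ge0.
have [N1 h1] := charge_riemann_cvg lam (path_unif_cont lam) e2.
have [N2 h2] := path_near lam (divr_gt0 e2 V1).
exists (maxn N1 N2) => N; rewrite geq_max => /andP[/h1 {}h1 /h2 {}h2].
have h3 := pairing_sub_le (sampled lam N) h2.
rewrite -(subrK (pairing (sampled lam N) (kernel_path q lam)) (energy lam)) -addrA.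
apply: (le_trans (ler_normD _ _)); rewrite [leRHS](splitr e); apply: lerD => //.
apply: (le_trans h3); rewrite mulrCA -[leRHS]mulr1 ler_wpM2l ?(ltW e2)// ler_pdivrMr// mul1r.
by apply: (le_trans (dmass_sampled lam N)); rewrite lerDl.
Qed.

Lemma kform_congr mu mu' nu nu' : (forall g, pairing mu g = pairing mu' g) ->
  (forall g, pairing nu g = pairing nu' g) -> kform K mu nu = kform K mu' nu'.
Proof. by move=> h h'; rewrite /kform h; apply: eq_pairing => t; exact: h'. Qed.

Definition cdiff (lam lam' : {charge set R -> \bar R}) : {charge set R -> \bar R} := cadd lam (cscale (-1) lam').

Lemma near_all lam lam' (e : R) : 0 < e -> exists N,
  let x := sampled lam N in let y := sampled lam' N in
  [/\ forall t, `|kernel_path q lam' t - kpath K y t| <= e,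
      `|energy lam - kform K x x| <= e, `|energy lam' - kform K y y| <= e &
      `|energy (cdiff lam lam') - (kform K x x + kform K y y - 2 * kform K x y)| <= e].
Proof.
move=> e0; have [N1 h1] := path_near lam' e0; have [N2 h2] := energy_near lam e0.
have [N3 h3] := energy_near lam' e0; have [N4 h4] := energy_near (cdiff lam lam') e0.
pose N := maxn (maxn N1 N2) (maxn N3 N4); exists N => x y; split.
- by apply: h1; rewrite !leq_max leqnn.
- by apply: h2; rewrite !leq_max leqnn orbT.
- by apply: h3; rewrite !leq_max leqnn orbT.
- have <- : kform K (sampled (cdiff lam lam') N) (sampled (cdiff lam lam') N) =
    kform K x x + kform K y y - 2 * kform K x y.
    rewrite (@kform_congr _ (x ++ dscale (-1) y) _ (x ++ dscale (-1) y)).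
    + rewrite kform_catl !kform_catr !kform_scalel !kform_scaler (kform_sym Ksym y x); ring.
    + by move=> g; rewrite sampled_add pairing_cat pairing_scale.
    + by move=> g; rewrite sampled_add pairing_cat pairing_scale.
  by apply: h4; rewrite !leq_max leqnn !orbT.
Qed.

(** Equivalent to positivity of the energy of [2 * lam - lam'], after discretization. It bounds
    energies along a Cauchy sequence. *)
Lemma energy_le_double lam lam' : energy lam' <= 2 * energy (cdiff lam lam') + 2 * energy lam.
Proof.
apply/ler_addgt0Pr => e e0; have e5 : 0 < e / 5 by rewrite divr_gt0.
have [N [_ h1 h2 h3]] := near_all lam lam' e5.
set x := sampled lam N in h1 h2 h3; set y := sampled lam' N in h2 h3.
have := Kpos (dscale 2 x ++ dscale (-1) y).
rewrite kform_catl !kform_catr !kform_scalel !kform_scaler (kform_sym Ksym y x).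
move: h1 h2 h3; rewrite !ler_norml => /andP[h1 h1'] /andP[h2 h2'] /andP[h3 h3']; lra.
Qed.

Lemma legendre_path_le mu g lam (w : R) : (forall t, `|g t - kernel_path q lam t| <= w) ->
  legendre K mu g <= energy lam / 2 + dmass mu * w.
Proof.
move=> gw; apply/ler_addgt0Pr => e e0.
have D1 : 0 < dmass mu + 1 by rewrite ltr_wpDl// dmass_ge0.
have e1 : 0 < e / (dmass mu + 1) by rewrite divr_gt0.
have [N [h1 _ h2 _]] := near_all lam lam e1.
set y := sampled lam N in h1 h2.
have /rate_leP/(_ mu) := rate_kpath Ksym Kpos y.
have q1 := pairing_sub_le mu gw; have q2 := pairing_sub_le mu h1.
have ee : dmass mu * (e / (dmass mu + 1)) + e / (dmass mu + 1) = e by field; rewrite gt_eqF.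
rewrite /legendre; move: q1 q2 h2; rewrite !ler_norml => /andP[_ a1] /andP[_ a2] /andP[a3 _]; lra.
Qed.

(** Tests the Legendre transform at [lam], not at [lam']: [K(x,y) - K(x,x)/2] is half of
    [K(y,y) - K(x-y,x-y)]. The uniform error is thus multiplied by the variation of a fixed charge,
    while that of [lam'] may blow up along an approximating sequence. *)
Lemma le_rate_path g lam lam' (w : R) : (forall t, `|g t - kernel_path q lam' t| <= w) ->
  (((energy lam' - energy (cdiff lam lam')) / 2 - variation lam * w)%:E <= rate K g)%E.
Proof.
move=> gw; apply/lee_addgt0Pr => e e0.
have V0 := variation_ge0 lam; have V1 : 0 < variation lam + 1 by rewrite ltr_wpDl.
have e1 : 0 < e / (variation lam + 1) by rewrite divr_gt0.
have [N [h1 h2 h3 h4]] := near_all lam lam' e1.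
set x := sampled lam N in h2 h4; set y := sampled lam' N in h1 h3 h4.
apply: (@le_trans _ _ ((legendre K x g)%:E + e%:E)%E); last first.
  by apply: leeD => //; apply: ereal_sup_ubound; exists x.
rewrite -EFinD lee_fin /legendre.
have q1 := pairing_sub_le x gw; have q2 := pairing_sub_le x h1.
have dx := dmass_sampled lam N; rewrite -/x in dx.
have w0 : 0 <= w by apply: le_trans (gw (toI 0)); exact: normr_ge0.
have m1 : dmass x * w <= variation lam * w by rewrite ler_wpM2r.
have m2 : dmass x * (e / (variation lam + 1)) <= variation lam * (e / (variation lam + 1)).
  by rewrite ler_wpM2r// ltW.
have ee : variation lam * (e / (variation lam + 1)) + e / (variation lam + 1) = e by field; rewrite gt_eqF.
move: q1 q2 h3 h4; rewrite -/(kform K x y) !ler_norml => /andP[a1 _] /andP[a2 _] /andP[a3 a4] /andP[a5 a6].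
lra.
Qed.

(** Along any approximating sequence half the energy tends to the Legendre transform of the limit
    path, so the norm does not depend on the sequence. The lower estimate fixes an early term of the
    sequence in [le_rate_path], the upper one a near maximizing discrete measure. *)
Lemma approx_rate g (lam : nat -> {charge set R -> \bar R}) : rkhs_approx q lam g ->
  exists C : R, [/\ 0 <= C, rate K g = C%:E & energy (lam i) @[i --> \oo] --> 2 * C].
Proof.
move=> [cauchy /unif_cvgP unif].
have cau e : 0 < e -> exists N, forall i j, (N <= i)%N -> (N <= j)%N -> energy (cdiff (lam i) (lam j)) < e.
  move=> e0; have [|N hN] := cauchy (Num.sqrt e); first by rewrite sqrtr_gt0.
  exists N => i j Ni Nj; have := hN i j Ni Nj; rewrite /kernel_norm ltr_sqrt//.
have [N1 hN1] := cau 1 ltr01.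
pose B := 1 + energy (lam N1).
have EB j : (N1 <= j)%N -> energy (lam j) / 2 <= B.
  by move=> Nj; have := energy_le_double (lam N1) (lam j); have := hN1 N1 j (leqnn _) Nj; rewrite /B; lra.
have leg mu e : 0 < e -> exists N, forall j, (N <= j)%N -> legendre K mu g <= energy (lam j) / 2 + e.
  move=> e0; have D1 : 0 < dmass mu + 1 by rewrite ltr_wpDl// dmass_ge0.
  have [N hN] := unif _ (divr_gt0 e0 D1); exists N => j Nj.
  apply: (le_trans (legendre_path_le mu (hN j Nj))); rewrite lerD2l mulrCA.
  by rewrite -[leRHS]mulr1 ler_wpM2l ?(ltW e0)// ler_pdivrMr// mul1r lerDl.
have rB : (rate K g <= B%:E)%E.
  apply/rate_leP => mu; apply/ler_addgt0Pr => e e0; have [N hN] := leg mu e e0.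
  apply: (le_trans (hN _ (leq_maxl N N1))); by rewrite lerD2r EB// leq_maxr.
have [C [/andP[C0 _] rC _]] := rate_near_max ltr01 rB.
exists C; split => //.
suff H : energy (lam i) / 2 @[i --> \oo] --> C.
  rewrite (_ : (fun i => energy (lam i)) = (fun i => 2 * (energy (lam i) / 2))).
    by apply: cvgM => //; exact: cvg_cst.
  by apply/funext => i; field.
apply/cvgrPdist_le => e e0.
have e2 : 0 < e / 2 by rewrite divr_gt0.
have [N hN] := cau e e0.
have V0 := variation_ge0 (lam N); have V1 : 0 < variation (lam N) + 1 by rewrite ltr_wpDl.
have [N' hN'] := unif _ (divr_gt0 e2 V1).
have : (rate K g <= C%:E)%E by rewrite rC.
move=> /(rate_near_max e2)[C' [_ rC' [mu hmu]]].
have CC : C' = C by move: rC'; rewrite rC => -[].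
have [N'' hN''] := leg mu _ e2.
exists (maxn N (maxn N' N'')) => // j /=; rewrite !geq_max => /and3P[Nj N'j N''j].
have h1 := hN'' j N''j; have := le_rate_path (lam N) (hN' j N'j).
rewrite rC lee_fin => h2; have h3 := hN N j (leqnn _) Nj.
have h4 : variation (lam N) * (e / 2 / (variation (lam N) + 1)) <= e / 2.
  by rewrite mulrCA -[leRHS]mulr1 ler_wpM2l ?(ltW e2)// ler_pdivrMr// mul1r lerDl.
by rewrite ler_norml; apply/andP; split; lra.
Qed.

Lemma kernel_path_dcharge mu t : kernel_path q (dcharge mu) t = kpath K mu t.
Proof. by rewrite /kernel_path charge_integral_dcharge//; exact: row_unif_cont. Qed.

Lemma energy_cdiff_dcharge mu nu :
  energy (cdiff (dcharge mu) (dcharge nu)) = kform K (mu ++ dscale (-1) nu) (mu ++ dscale (-1) nu).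
Proof.
have uf := path_unif_cont (cdiff (dcharge mu) (dcharge nu)).
rewrite /energy {1}/cdiff charge_integral_add// !charge_integral_dcharge//.
rewrite -pairing_scale -pairing_cat /kform; apply: eq_pairing => t /=.
rewrite /cdiff charge_integral_add; last exact: row_unif_cont.
by rewrite !charge_integral_dcharge ?kpath_cat ?kpath_scale//; exact: row_unif_cont.
Qed.

(** A maximizing sequence of discrete measures is Cauchy by [near_max_dist], and its kernel paths
    converge uniformly to [g] by [near_max_path]. *)
Lemma rkhs_of_rate g (C : R) : rate K g = C%:E -> rkhs q g.
Proof.
move=> rC; have gC : forall mu, legendre K mu g <= C by apply/rate_leP; rewrite rC.
have /choice[mu hmu] : forall n : nat, exists mu, C - n.+1%:R^-1 <= legendre K mu g.
  move=> n; have n0 : (0 : R) < n.+1%:R^-1 by rewrite invr_gt0.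
  have rC' : (rate K g <= C%:E)%E by rewrite rC.
  by have [C' [_ + [mu h]]] := rate_near_max n0 rC'; rewrite rC => -[->]; exists mu.
have hmu' (n N : nat) : (N <= n)%N -> C - N.+1%:R^-1 <= legendre K (mu n) g.
  by move=> Nn; apply: le_trans (hmu n); rewrite lerB// lef_pV2 ?posrE// ler_nat.
exists (fun n => dcharge (mu n)); split.
  move=> e e0; have e8 : 0 < e ^+ 2 / 8 by rewrite divr_gt0 ?exprn_gt0.
  have [N hN] := exists_mesh e8; exists N => i j Ni Nj.
  rewrite -[ltRHS]ger0_norm ?(ltW e0)// -sqrtr_sqr ltr_sqrt ?exprn_gt0//.
  have := near_max_dist Ksym gC (hmu' i N Ni) (hmu' j N Nj).
  rewrite -energy_cdiff_dcharge => h; apply: (le_lt_trans h).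
  by move: hN; rewrite ltr_pdivlMr// mulrC.
apply/unif_cvgP => w w0; have KB1 : 0 < 2 * (`|KB| + 1) by rewrite mulr_gt0// ltr_wpDl.
have w2 : 0 < w ^+ 2 / (2 * (`|KB| + 1)) by rewrite divr_gt0 ?exprn_gt0.
have [N hN] := exists_mesh w2; exists N => j Nj t; rewrite kernel_path_dcharge.
have h := near_max_path Ksym Kpos gC t (hmu' j N Nj).
rewrite -ler_sqr ?nnegrE ?(ltW w0)// real_normK ?num_real//; apply: (le_trans h).
move: hN; rewrite ltr_pdivlMr// => /ltW hN; apply: le_trans hN.
rewrite mulrC ler_wpM2l ?invr_ge0// ler_wpM2l//.
by apply: (le_trans (K_le t)); have := ler_norm KB; lra.
Qed.

Lemma rkhs_rateE (m : I01 R -> R) (h : C01 R) : rkhs_rate q m h = ldp_rate K m h.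
Proof.
rewrite /rkhs_rate /ldp_rate; set g := fun t => _; case: asboolP => [[lam hlam]|ng].
  have [C [C0 rC EC]] := approx_rate hlam; rewrite rC.
  (* [rkhs_norm] picks a limit by choice; every approximating sequence gives this same one. *)
  have rnorm (lam' : nat -> {charge set R -> \bar R}) : rkhs_approx q lam' g ->
      kernel_norm q (lam' i) @[i --> \oo] --> Num.sqrt (2 * C).
    move=> /approx_rate[C' [_ rC' EC']].
    have <- : C' = C by move: rC'; rewrite rC => -[].
    exact: (continuous_cvg _ (@sqrt_continuous R (2 * C')) EC').
  have : [set r : R | exists2 lam, rkhs_approx q lam g &
                   kernel_norm q (lam i) @[i --> \oo] --> r] (rkhs_norm q g).
    by apply: getPex; exists (Num.sqrt (2 * C)); exists lam => //; exact: rnorm.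
  move=> [lam' hl' cvr]; rewrite (cvg_unique (@norm_hausdorff R R) cvr (rnorm _ hl')).
  by congr (_%:E); rewrite sqr_sqrtr ?mulr_ge0//; field.
have [rfin|rinf] := boolP (rate K g \is a fin_num).
  by exfalso; apply: ng; apply: (@rkhs_of_rate _ (fine (rate K g))); rewrite fineK.
by apply/esym/eqP; move: rinf; rewrite ge0_fin_numE ?rate_ge0// -leNgt leye_eq.
Qed.
End kernel_space.

(** * The conditioned process *)

Section conditioned_process.
Context d (Omega : measurableType d) (R : realType) (P : probability Omega R).
Variables (X : R -> {RV P >-> R}) (k : R -> R -> R).
Hypothesis hX : continuous_centered_gaussian_process X k.

(* The absolute value makes the process Gaussian on the whole line, as discrete
   measures on [R] require. *)
Definition absproc (u : R) (w : Omega) : R := X `|u| w.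

Let centered (t : R) : 0 <= t -> (\int[P]_w (X t w)%:E = 0)%E.
Proof. by move=> t0; have [_ /(_ t t0)] := hX; rewrite expectation_def. Qed.

Let absproc_law_mean mu : exists m s, has_law P (fun w => pairing mu (absproc^~ w)) m s.
Proof.
have [gp _ _ _ _] := hX.
have [m [s H]] := gp (size mu) (fun i => `|(tnth (in_tuple mu) i).1|)
  (fun i => (tnth (in_tuple mu) i).2) (fun i => normr_ge0 _).
exists m, s; have E : (fun w => pairing mu (absproc^~ w)) =
  (fun w => \sum_(i < size mu) (tnth (in_tuple mu) i).2 * X `|(tnth (in_tuple mu) i).1| w).
  by apply/funext => w; rewrite /pairing big_tnth.
split; last by move=> A mA; rewrite E H.
by rewrite E; apply: measurable_sum => i; exact: measurable_funM.
Qed.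

Lemma absproc_mean mu : (\int[P]_w (pairing mu (absproc^~ w))%:E = 0)%E.
Proof.
have iW u : P.-integrable setT (EFin \o absproc u).
  have [m [s l1]] := absproc_law_mean [:: (u, 1)]; have := law_integrable l1.
  by under eq_fun do rewrite pairing1.
have [ip Ip] := pairing_integral measurableT mu iW.
rewrite -[LHS]fineK; last exact: integrable_fin_num.
rewrite -[fine _]/(Rintegral _ _ _) Ip -[X in _ = X]/(0%:E); congr (_%:E).
by rewrite /pairing big1// => p _; rewrite /Rintegral centered//= mulr0.
Qed.

(** The definition of a Gaussian process leaves the mean of a combination unspecified; linearity of
    expectation makes it zero, and [law_centered] transfers this to the parameter of the law. *)
Lemma absproc_law mu : exists s, has_law P (fun w => pairing mu (absproc^~ w)) 0 s.
Proof.
have [m [s lm]] := absproc_law_mean mu.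
by have m0 := law_centered lm (absproc_mean mu); exists s; rewrite -m0.
Qed.

Local Notation C := (cov_kernel P absproc).

Lemma covariance_int (f g : Omega -> R) : ('E_P[f] = 0)%E -> ('E_P[g] = 0)%E ->
  fine (covariance P f g) = (\int[P]_w (f w * g w))%R.
Proof.
move=> f0 g0; rewrite unlock f0 g0 unlock /Rintegral; congr fine; apply: eq_integral => w _.
by transitivity (((f w - 0) * (g w - 0))%:E); [|rewrite !subr0].
Qed.

Lemma absproc_cov (u s : R) : 0 <= u -> 0 <= s -> C u s = k u s.
Proof.
move=> u0 s0; have [_ cen _ cv _] := hX; have := cv u s u0 s0.
move=> /(congr1 fine); rewrite covariance_int ?cen//= => <-.
by rewrite /cov_kernel /absproc !ger0_norm.
Qed.

Variables (T : nat -> R) (n : nat).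
Hypothesis T_gt0 : forall j, (1 <= j <= n)%N -> 0 < T j.
Hypothesis k_neq0 : forall j, (1 <= j <= n)%N -> cond_cov k T j.-1 (T j) (T j) != 0.

(* X^j_u, conditioned on zero values, as a linear combination of values of X. *)
Fixpoint cond_measure (j : nat) (u : R) : seq (R * R) :=
  if j is i.+1 then
    cond_measure i u ++ dscale (- cond_alpha k T i.+1 u) (cond_measure i (T i.+1))
  else [:: (u, 1)].

Lemma cond_measure_proc j (u : R) w : (j <= n)%N -> 0 <= u ->
  pairing (cond_measure j u) (absproc^~ w) =
  cond_proc k T (fun u => X u : Omega -> R) (fun=> 0) j u w.
Proof.
elim: j u => [|j ih] u jn u0 /=; first by rewrite pairing1 /absproc ger0_norm.
have Tj : 0 < T j.+1 by rewrite T_gt0.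
by rewrite pairing_cat pairing_scale !ih ?(ltW Tj) ?(ltnW jn)// subr0 mulNr.
Qed.

Lemma cond_measure_cov j (u s : R) : (j <= n)%N -> 0 <= u -> 0 <= s ->
  kform C (cond_measure j u) (cond_measure j s) = cond_cov k T j u s.
Proof.
elim: j u s => [|j ih] u s jn u0 s0 /=; first by rewrite kform1 /kpath pairing1 absproc_cov.
have T0 : 0 <= T j.+1 by rewrite ltW// T_gt0.
have knz : cond_cov k T j (T j.+1) (T j.+1) != 0 by exact: (k_neq0 (j := j.+1)).
have jn' := ltnW jn.
rewrite kform_catl !kform_catr !kform_scalel !kform_scaler.
rewrite (kform_sym (@cov_kernel_sym _ _ _ P _ absproc) (cond_measure j (T j.+1)) (cond_measure j s)).
by rewrite !ih// /cond_alpha /=; field.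
Qed.

Lemma cond_cov_sym j (u s : R) : (j <= n)%N -> 0 <= u -> 0 <= s ->
  cond_cov k T j u s = cond_cov k T j s u.
Proof.
by move=> jn u0 s0; rewrite -!cond_measure_cov// kform_sym//; exact: cov_kernel_sym.
Qed.

Lemma cond_cov_ge0 j (u : R) : (j <= n)%N -> 0 <= u -> 0 <= cond_cov k T j u u.
Proof. by move=> jn u0; rewrite -cond_measure_cov//; exact: (cov_kernel_pos absproc_law). Qed.

Lemma cond_cov_le j (u : R) : (j <= n)%N -> 0 <= u -> cond_cov k T j u u <= k u u.
Proof.
elim: j => [//|j ih] jn u0 /=; apply: le_trans (ih (ltnW jn) u0).
have T0 : 0 <= T j.+1 by rewrite ltW// T_gt0.
rewrite gerBl mulrAC -expr2 divr_ge0 ?sqr_ge0//; exact: cond_cov_ge0 (ltnW jn) T0.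
Qed.

(** Positivity on the sum and the difference of the two measures bounds twice the covariance by the
    sum of the variances, and conditioning only lowers variances. *)
Lemma cond_cov_bound j (u s : R) : (j <= n)%N -> 0 <= u -> 0 <= s ->
  `|cond_cov k T j u s| <= k u u + k s s.
Proof.
move=> jn u0 s0; have h1 := cond_cov_le jn u0; have h2 := cond_cov_le jn s0.
have h3 := cond_cov_ge0 jn u0; have h4 := cond_cov_ge0 jn s0.
have P1 := cov_kernel_pos absproc_law (cond_measure j u ++ dscale 1 (cond_measure j s)).
have P2 := cov_kernel_pos absproc_law (cond_measure j u ++ dscale (-1) (cond_measure j s)).
move: P1 P2; rewrite !kform_catl !kform_catr !kform_scalel !kform_scaler !cond_measure_cov//.
rewrite (cond_cov_sym jn s0 u0) => P1 P2; rewrite ler_norml; apply/andP; split; lra.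
Qed.

(* The recursion of X^j applied to the zero process, on a one-point space. *)
Definition cond_mean (x : nat -> R) j u := cond_proc k T (fun _ (_ : unit) => 0) x j u tt.

(** The recursion is affine in the conditioning values, so they produce only a deterministic term
    and leave the centered part unchanged. *)
Lemma cond_proc_split x j u w :
  cond_proc k T (fun u => X u : Omega -> R) x j u w =
  cond_proc k T (fun u => X u : Omega -> R) (fun=> 0) j u w + cond_mean x j u.
Proof.
rewrite /cond_mean; elim: j u => [|j ih] u /=; first by rewrite addr0.
by rewrite (ih u) (ih (T j.+1)); ring.
Qed.
End conditioned_process.

(** * Expansion of the bridge covariance *)

Section uniform_smallness.
Context (R : realType).
Implicit Types f g : R -> R -> R -> R.

(* [f e t s] tends to 0, respectively stays bounded, as [e] decreases to 0,
   uniformly in [t] and [s] in [0, 1]. *)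
Definition usmall f := forall eta : R, 0 < eta -> \forall e \near 0^'+,
  forall t s : R, 0 <= t <= 1 -> 0 <= s <= 1 -> `|f e t s| <= eta.

Definition ubounded f := exists M : R, \forall e \near 0^'+,
  forall t s : R, 0 <= t <= 1 -> 0 <= s <= 1 -> `|f e t s| <= M.

Lemma usmall_bounded f : usmall f -> ubounded f.
Proof. by move=> /(_ _ ltr01) h; exists 1. Qed.

Lemma usmall_eq f g : (\forall e \near 0^'+, forall t s : R, 0 <= t <= 1 -> 0 <= s <= 1 ->
  f e t s = g e t s) -> usmall f -> usmall g.
Proof.
move=> E h eta eta0; apply: filterS2 E (h _ eta0) => e h1 h2 t s t01 s01.
by rewrite -h1// h2.
Qed.

Lemma usmallD f g : usmall f -> usmall g -> usmall (fun e t s => f e t s + g e t s).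
Proof.
move=> hf hg eta eta0; have e2 : 0 < eta / 2 by rewrite divr_gt0.
apply: filterS2 (hf _ e2) (hg _ e2) => e h1 h2 t s t01 s01.
by rewrite (splitr eta); apply: (le_trans (ler_normD _ _)); apply: lerD; [exact: h1|exact: h2].
Qed.

Lemma uboundedD f g : ubounded f -> ubounded g -> ubounded (fun e t s => f e t s + g e t s).
Proof.
move=> [M1 h1] [M2 h2]; exists (M1 + M2); apply: filterS2 h1 h2 => e h1 h2 t s t01 s01.
by apply: (le_trans (ler_normD _ _)); apply: lerD; [exact: h1|exact: h2].
Qed.

Lemma usmallM f g : usmall f -> ubounded g -> usmall (fun e t s => f e t s * g e t s).
Proof.
move=> hf [M hg] eta eta0; have M1 : 0 < `|M| + 1 by rewrite ltr_wpDl.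
apply: filterS2 (hf _ (divr_gt0 eta0 M1)) hg => e h1 h2 t s t01 s01.
rewrite normrM; apply: (@le_trans _ _ (eta / (`|M| + 1) * (`|M| + 1))).
  apply: ler_pM => //; first exact: h1.
  by apply: (le_trans (h2 t s t01 s01)); have := ler_norm M; lra.
by rewrite divfK// gt_eqF.
Qed.

Lemma uboundedM f g : ubounded f -> ubounded g -> ubounded (fun e t s => f e t s * g e t s).
Proof.
move=> [M1 h1] [M2 h2]; exists (M1 * M2); apply: filterS2 h1 h2 => e h1 h2 t s t01 s01.
by rewrite normrM; apply: ler_pM => //; [exact: h1|exact: h2].
Qed.

Lemma uboundedT f (M : R) : (forall e t s : R, 0 <= t <= 1 -> 0 <= s <= 1 -> `|f e t s| <= M) -> ubounded f.
Proof. by move=> h; exists M; apply: nearW => e t s; exact: h. Qed.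

Lemma ubounded_cst (c : R) : ubounded (fun _ _ _ => c).
Proof. exact: (@uboundedT _ `|c|). Qed.

Lemma ubounded_fst : ubounded (fun _ t _ => t).
Proof. by apply: (@uboundedT _ 1) => e t s /andP[t0 t1] _; rewrite ger0_norm. Qed.

Lemma ubounded_snd : ubounded (fun _ _ s => s).
Proof. by apply: (@uboundedT _ 1) => e t s _ /andP[t0 t1]; rewrite ger0_norm. Qed.

Lemma usmallZ (c : R) f : usmall f -> usmall (fun e t s => c * f e t s).
Proof.
move=> hf; apply: usmall_eq (usmallM hf (ubounded_cst c)).
by apply: nearW => e t s _ _; rewrite mulrC.
Qed.

Lemma usmallB f g : usmall f -> usmall g -> usmall (fun e t s => f e t s - g e t s).
Proof.
move=> hf hg; apply: usmall_eq (usmallD hf (usmallZ (-1) hg)).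
by apply: nearW => e t s _ _; rewrite mulN1r.
Qed.

Lemma usmall0 : usmall (fun _ _ _ => 0).
Proof. by move=> eta eta0; apply: nearW => e t s _ _; rewrite normr0 ltW. Qed.

Lemma usmall_sum (I : Type) (r : seq I) (F : I -> R -> R -> R -> R) : (forall i, usmall (F i)) ->
  usmall (fun e t s => \sum_(i <- r) F i e t s).
Proof.
move=> hF; elim: r => [|i r ih].
  by apply: usmall_eq usmall0; apply: nearW => e t s _ _; rewrite big_nil.
by apply: usmall_eq (usmallD (hF i) ih); apply: nearW => e t s _ _; rewrite big_cons.
Qed.

Lemma usmall_cvg0 (h : R -> R) : h e @[e --> 0^'+] --> 0 -> usmall (fun e _ _ => h e).
Proof.
move=> /cvgrPdist_le h0 eta eta0; apply: filterS (h0 _ eta0) => e he t s _ _.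
by move: he; rewrite sub0r normrN.
Qed.

Lemma usmall_cvg f (t s l : R) : 0 <= t <= 1 -> 0 <= s <= 1 -> usmall (fun e t s => f e t s - l) ->
  f e t s @[e --> 0^'+] --> l.
Proof.
move=> t01 s01 h; apply/cvgrPdist_le => eta eta0; apply: filterS (h _ eta0) => e /(_ t s t01 s01).
by rewrite distrC.
Qed.

Lemma usmall_swap f : usmall f -> usmall (fun e t s => f e s t).
Proof. by move=> h eta eta0; apply: filterS (h _ eta0) => e he t s t01 s01; exact: he. Qed.

Lemma usmall_fst1 f : usmall f -> usmall (fun e t s => f e t 1).
Proof. by move=> h eta eta0; apply: filterS (h _ eta0) => e he t s t01 s01; apply: he; rewrite ?ler01 ?lexx. Qed.

Lemma usmall_snd1 f : usmall f -> usmall (fun e t s => f e 1 s).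
Proof. by move=> h eta eta0; apply: filterS (h _ eta0) => e he t s t01 s01; apply: he; rewrite ?ler01 ?lexx. Qed.

Lemma ubounded_swap f : ubounded f -> ubounded (fun e t s => f e s t).
Proof. by move=> [M h]; exists M; apply: filterS h => e he t s t01 s01; exact: he. Qed.

Lemma ubounded_fst1 f : ubounded f -> ubounded (fun e t s => f e t 1).
Proof. by move=> [M h]; exists M; apply: filterS h => e he t s t01 s01; apply: he; rewrite ?ler01 ?lexx. Qed.

Lemma ubounded_snd1 f : ubounded f -> ubounded (fun e t s => f e 1 s).
Proof. by move=> [M h]; exists M; apply: filterS h => e he t s t01 s01; apply: he; rewrite ?ler01 ?lexx. Qed.

(** The difference of inverses is [f - A] times [- 1 / (f * A)], which is bounded as soon as [f] is
    at least half of [A] in absolute value. *)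
Lemma usmall_inv f (A : R) : A != 0 -> usmall (fun e t s => f e t s - A) ->
  usmall (fun e t s => (f e t s)^-1 - A^-1) /\ \forall e \near 0^'+,
    forall t s : R, 0 <= t <= 1 -> 0 <= s <= 1 -> f e t s != 0.
Proof.
move=> A0 h; have A2 : 0 < `|A| / 2 by rewrite divr_gt0// normr_gt0.
have far : \forall e \near 0^'+, forall t s : R, 0 <= t <= 1 -> 0 <= s <= 1 -> `|A| / 2 <= `|f e t s|.
  apply: filterS (h _ A2) => e he t s t01 s01; have := he t s t01 s01.
  by have := lerB_dist A (f e t s); rewrite distrC; lra.
have fne : \forall e \near 0^'+, forall t s : R, 0 <= t <= 1 -> 0 <= s <= 1 -> f e t s != 0.
  by apply: filterS far => e he t s t01 s01; rewrite -normr_gt0 (lt_le_trans A2)// he.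
split => //.
have bi : ubounded (fun e t s => - ((f e t s)^-1 / A)).
  exists ((`|A| / 2)^-1 / `|A|); apply: filterS far => e he t s t01 s01.
  rewrite normrN normrM !normfV ler_wpM2r ?invr_ge0// lef_pV2 ?posrE//; first exact: he.
  exact: lt_le_trans (he t s t01 s01).
apply: usmall_eq (usmallM h bi).
by apply: filterS fne => e he t s t01 s01; have := he t s t01 s01 => f0; field; rewrite A0.
Qed.

Lemma ubounded_sum (I : Type) (r : seq I) (F : I -> R -> R -> R -> R) : (forall i, ubounded (F i)) ->
  ubounded (fun e t s => \sum_(i <- r) F i e t s).
Proof.
move=> hF; elim: r => [|i r [M2 h2]].
  by exists 0; apply: nearW => e t s _ _; rewrite big_nil normr0.
have [M1 h1] := hF i; exists (M1 + M2); apply: filterS2 h1 h2 => e h1 h2 t s t01 s01.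
by rewrite big_cons; apply: (le_trans (ler_normD _ _)); apply: lerD; [exact: h1|exact: h2].
Qed.

Lemma ereal_sup_near (I : Type) (F : R -> I -> R) (p : R -> R) (D : set I) :
  ereal_sup [set (`|F e i| / p e)%:E | i in D] @[e --> 0^'+] --> 0%E ->
  (forall e : R, 0 < e -> 0 < p e) ->
  forall eta : R, 0 < eta -> \forall e \near 0^'+, forall i, D i -> `|F e i / p e| <= eta.
Proof.
move=> hF p0 eta eta0.
have /hF hlt : nbhs (0%E : \bar R) [set x | (x < eta%:E)%E].
  by apply: open_nbhs_nbhs; split; [exact: open_ereal_lt_ereal|rewrite /= lte_fin].
near=> e => i Di.
have e0 : 0 < e by near: e; exact: nbhs_right_gt.
have h : (ereal_sup [set (`|F e i| / p e)%:E | i in D] < eta%:E)%E by near: e; exact: hlt.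
rewrite normrM normfV (gtr0_norm (p0 e e0)) -lee_fin; apply: le_trans (ltW h).
by apply: ereal_sup_ubound; exists i.
Unshelve. all: by end_near. Qed.

End uniform_smallness.

(** * Continuity of covariances on the quadrant *)

Section quadrant_continuity.
Context (R : realType).

Let Q : set (R * R) := `[0, +oo[%classic `*` `[0, +oo[%classic.

Definition quadrant_cont (F : R -> R -> R) := forall t s : R, 0 <= t -> 0 <= s ->
  F y.1 y.2 @[y --> within Q (nbhs (t, s))] --> F t s.

Lemma quadrant_contP (F : R -> R -> R) : quadrant_cont F <->
  forall t s e : R, 0 <= t -> 0 <= s -> 0 < e -> exists2 r : R, 0 < r &
    forall t' s' : R, 0 <= t' -> 0 <= s' -> `|t' - t| < r -> `|s' - s| < r -> `|F t' s' - F t s| < e.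
Proof.
split=> [cF t s e t0 s0 e0|cF t s t0 s0].
  have /cvgrPdist_lt/(_ e e0) := cF t s t0 s0.
  rewrite /within/= => /nbhs_ballP[r r0 hr]; exists r => // t' s' t'0 s'0 tt' ss'.
  rewrite distrC; apply: (hr (t', s')).
    by split; rewrite /ball/= distrC.
  by split; rewrite /= in_itv/= andbT.
apply/cvgrPdist_lt => e e0; have [r r0 hr] := cF t s e t0 s0 e0.
rewrite /within/=; apply/nbhs_ballP; exists r => // -[t' s'] [/= h1 h2] [/=].
rewrite !in_itv/= !andbT => t'0 s'0; rewrite distrC; apply: hr => //; rewrite distrC; [exact: h1|exact: h2].
Qed.

Lemma quadrant_cont_fst (F : R -> R -> R) (S : R) : quadrant_cont F -> 0 <= S ->
  quadrant_cont (fun t _ => F t S).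
Proof.
move=> /quadrant_contP cF S0; apply/quadrant_contP => t s e t0 s0 e0.
have [r r0 hr] := cF t S e t0 S0 e0; exists r => // t' s' t'0 _ tt' _; apply: hr => //.
by rewrite subrr normr0.
Qed.

Lemma quadrant_cont_snd (F : R -> R -> R) (S : R) : quadrant_cont F -> 0 <= S ->
  quadrant_cont (fun _ s => F s S).
Proof.
move=> /quadrant_contP cF S0; apply/quadrant_contP => t s e t0 s0 e0.
have [r r0 hr] := cF s S e s0 S0 e0; exists r => // t' s' _ s'0 _ ss'; apply: hr => //.
by rewrite subrr normr0.
Qed.

Lemma quadrant_cont_diag (F : R -> R -> R) (a b : R) : 0 <= a -> quadrant_cont F ->
  {within `[a, b], continuous (fun u => F u u)}.
Proof.
move=> a0 /quadrant_contP cF; apply/subspace_continuousP => u /=; rewrite in_itv/= => /andP[au _].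
apply/cvgrPdist_lt => e e0; have u0 : 0 <= u by exact: le_trans au.
have [r r0 hr] := cF u u e u0 u0 e0; rewrite /within/=; apply/nbhs_ballP; exists r => // u' uu'.
rewrite in_itv/= => /andP[au' _]; have u'0 : 0 <= u' by exact: le_trans au'.
by rewrite distrC; apply: hr => //; rewrite distrC.
Qed.

Lemma quadrant_cont_unif (F : R -> R -> R) (a b e : R) : 0 <= a -> quadrant_cont F -> 0 < e ->
  exists2 r : R, 0 < r & forall t s s' : R, a <= t <= b -> a <= s <= b -> a <= s' <= b ->
    `|s' - s| < r -> `|F t s' - F t s| < e.
Proof.
move=> a0 /quadrant_contP cF e0.
have cA : compact (`[a, b]%classic `*` `[a, b]%classic : set (R * R)).
  by apply: compact_setX; exact: segment_compact.
have [|r r0 hr] := @compact_unif R (R * R)%type _ (fun y => F y.1 y.2) cA _ e e0.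
  move=> [t s] [/=]; rewrite !in_itv/= => /andP[at' _] /andP[as' _] x x0.
  have [r r0 hr] := cF t s x (le_trans a0 at') (le_trans a0 as') x0.
  exists r => // -[t' s'] [/=]; rewrite !in_itv/= => /andP[at2 _] /andP[as2 _] [/= h1 h2].
  by apply: hr; rewrite ?(le_trans a0)//= distrC; [exact: h1|exact: h2].
exists r => // t s s' t1 s1 s'1 ss'.
have A1 : (`[a, b]%classic `*` `[a, b]%classic : set (R * R)) (t, s') by split; rewrite /= in_itv.
have A2 : (`[a, b]%classic `*` `[a, b]%classic : set (R * R)) (t, s) by split; rewrite /= in_itv.
apply: (hr _ _ A1 A2); split; [exact: ballxx|exact: ss'].
Qed.

Lemma cond_cov_cont (k : R -> R -> R) (T : nat -> R) (n j : nat) :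
  (forall i, (1 <= i <= n)%N -> 0 < T i) -> quadrant_cont k -> (j <= n)%N ->
  quadrant_cont (cond_cov k T j).
Proof.
move=> T0 ck; elim: j => [//|j ih] jn; have {}ih := ih (ltnW jn).
have Tj : 0 <= T j.+1 by rewrite ltW// T0.
move=> t s t0 s0 /=; apply: cvgB; first exact: ih.
apply: cvgM; last exact: (quadrant_cont_snd ih Tj).
by apply: cvgM; [exact: (quadrant_cont_fst ih Tj)|exact: cvg_cst].
Qed.
End quadrant_continuity.

(** * Small-time expansions and the verification of the large deviation hypotheses *)

Section expansions.
Context d (Omega : measurableType d) (R : realType) (P : probability Omega R).
Variables (X : R -> {RV P >-> R}) (k : R -> R -> R) (n : nat) (T x : nat -> R) (y : R).
Variables (alpha a b : R) (phi : R -> R -> R) (c dd : R -> R) (psi : R -> R -> R).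
Variables (R1 : R -> R -> R -> R) (R2 : R -> R -> R -> R).
Hypothesis hX : continuous_centered_gaussian_process X k.
Hypothesis n_ge1 : (1 <= n)%N.
Hypothesis T_gt0 : forall j, (1 <= j <= n)%N -> 0 < T j.
Hypothesis k_neq0 : forall j, (1 <= j <= n)%N -> cond_cov k T j.-1 (T j) (T j) != 0.
Hypothesis bar_k_neq0 : bar_k k T n 1 1 != 0.
Hypothesis alpha_gt0 : 0 < alpha.
Hypothesis alpha_le1 : alpha <= 1.
Hypothesis incr_cov : forall e t s : R, 0 < e -> t \in `[0, 1] -> s \in `[0, 1] ->
  covariance P (fun w => X (T n + e * t) w - X (T n) w) (fun w => X (T n + e * s) w - X (T n) w) =
  (e ^+ 2 * (a ^+ 2 * t * s + b * (t ^+ 2 * s + t * s ^+ 2) * e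
             + phi t s * e `^ (1 + alpha) + R1 e t s))%:E.
Hypothesis R1_sup :
  ereal_sup [set (`|R1 e ts.1 ts.2| / e `^ (1 + alpha))%:E
               | ts in [set ts : R * R | ts.1 \in `[0, 1] /\ ts.2 \in `[0, 1]]]
    @[e --> 0^'+] --> 0%E.
Hypothesis incr_k : forall S e t : R, 0 < S -> 0 < e -> t \in `[0, 1] ->
  k (T n + e * t) S - k (T n) S =
  e * (c S * t + dd S * t ^+ 2 * e + psi t S * e `^ (1 + alpha) + R2 e t S).
Hypothesis R2_sup : forall S : R, 0 < S ->
  ereal_sup [set (`|R2 e t S| / e `^ (1 + alpha))%:E | t in [set t : R | t \in `[0, 1]]]
    @[e --> 0^'+] --> 0%E.

Local Notation kc := (cond_cov k T).
Local Notation p e := (e `^ (1 + alpha)).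
Let u (e t : R) : R := T n + e * t.

Let Tn_gt0 : 0 < T n. Proof. by rewrite T_gt0// n_ge1 leqnn. Qed.

Let u_ge0 (e t : R) : 0 <= e -> 0 <= t -> 0 <= u e t.
Proof. by move=> e0 t0; rewrite addr_ge0 ?(ltW Tn_gt0)// mulr_ge0. Qed.

Let p_gt0 (e : R) : 0 < e -> 0 < p e. Proof. exact: powR_gt0. Qed.

Let near0 : \forall e \near (0 : R)^'+, 0 < e. Proof. exact: nbhs_right_gt. Qed.

Lemma usmall_id : usmall (fun e _ _ : R => e).
Proof. by apply: usmall_cvg0; apply: cvg_within_filter; exact: cvg_id. Qed.

Lemma usmall_p : usmall (fun e _ _ : R => p e).
Proof. by apply: usmall_cvg0; apply: powR_cvg0; rewrite addr_gt0. Qed.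

Lemma usmall_theta : usmall (fun e _ _ : R => e ^+ 2 / p e - (alpha == 1)%:R).
Proof.
case: eqP => [a1|/eqP an1].
  apply: usmall_eq (@usmall0 R); apply: filterS near0 => e e0 t s _ _.
  by rewrite a1 -[1 + 1]/(2%:R) powR_mulrn ?(ltW e0)// divff ?subrr// expf_neq0// gt_eqF.
apply: (@usmall_eq _ (fun e _ _ => e `^ (1 - alpha))); last first.
  by apply: usmall_cvg0; apply: powR_cvg0; rewrite subr_gt0 lt_neqAle an1.
apply: filterS near0 => e e0 t s _ _; rewrite subr0 -powR_mulrn ?(ltW e0)//.
rewrite -powRB; last by apply/implyP => _; rewrite gt_eqF.
by congr (_ `^ _); ring.
Qed.

Lemma usmall_R1 : usmall (fun e t s => R1 e t s / p e).
Proof.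
move=> eta eta0; apply: filterS (ereal_sup_near R1_sup p_gt0 eta0) => e he t s t01 s01.
by apply: (he (t, s)); rewrite /= !in_itv.
Qed.

Lemma usmall_R2 (S : R) : 0 < S -> usmall (fun e t _ => R2 e t S / p e).
Proof.
move=> S0 eta eta0.
apply: filterS (ereal_sup_near (F := fun e t => R2 e t S) (R2_sup S0) p_gt0 eta0) => e he t s t01 s01.
by apply: (he t); rewrite /= in_itv.
Qed.

Lemma k_quadrant_cont : quadrant_cont k.
Proof.
have [_ _ _ _ /subspace_continuousP ck] := hX => t s t0 s0.
by apply: (ck (t, s)); split; rewrite /= in_itv/= andbT.
Qed.

Lemma k_diag_bound : exists MM, forall v, T n <= v <= T n + 1 -> k v v <= MM.
Proof.
have [||w _ hw] := @EVT_max R (fun v => k v v) (T n) (T n + 1).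
- by rewrite lerDl.
- by apply: quadrant_cont_diag; [exact: ltW|exact: k_quadrant_cont].
- by exists (k w w) => v hv; apply: hw; rewrite in_itv.
Qed.

Let u_itv (e t : R) : 0 < e -> e <= 1 -> 0 <= t <= 1 -> T n <= u e t <= T n + 1.
Proof.
move=> e0 e1 /andP[t0 t1]; rewrite lerDl mulr_ge0 ?(ltW e0)//= lerD2l.
by rewrite mulr_ile1// ltW.
Qed.

(** Fix one [e] at which the remainder is uniformly controlled and solve the expansion for [psi]:
    everything else is bounded, the covariances by those on a compact interval. *)
Lemma psi_bounded (S : R) : 0 < S -> exists M : R, forall t : R, 0 <= t <= 1 -> `|psi t S| <= M.
Proof.
move=> S0; have [MM hMM] := k_diag_bound.
have [e [[e0 e1] he]] : exists e : R, (0 < e /\ e <= 1) /\ forall t s : R, 0 <= t <= 1 -> 0 <= s <= 1 -> `|R2 e t S / p e| <= 1.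
  near (0 : R)^'+ => e; exists e; split; last by near: e; exact: (usmall_R2 S0 ltr01).
  by split; near: e; [exact: nbhs_right_gt|exact: nbhs_right_le].
have pe := p_gt0 e0; have kT : k (T n) (T n) <= MM by apply: hMM; rewrite lexx lerDl ler01.
exists (2 * (MM + k S S) / e / p e + `|c S| / p e + `|dd S| * e / p e + 1) => t t01.
have ut := u_ge0 (ltW e0) (andP t01).1.
have kut : k (u e t) (u e t) <= MM by apply: hMM; exact: u_itv.
have b1 := @cond_cov_bound _ _ _ _ _ _ hX T n T_gt0 k_neq0 0 (u e t) S (leq0n _) ut (ltW S0).
have b2 := @cond_cov_bound _ _ _ _ _ _ hX T n T_gt0 k_neq0 0 (T n) S (leq0n _) (ltW Tn_gt0) (ltW S0).
have t01' : t \in `[0, 1] by rewrite in_itv.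
have := incr_k S0 e0 t01'; rewrite -/(u e t) => E.
have -> : psi t S = (k (u e t) S - k (T n) S) / e / p e - c S * t / p e - dd S * t ^+ 2 * e / p e - R2 e t S / p e.
  by rewrite E; field; rewrite !gt_eqF.
have tle : `|t| <= 1 by rewrite ger0_norm; case/andP: t01.
apply: (le_trans (ler_normB _ _)); apply: lerD; last by apply: (he t t).
apply: (le_trans (ler_normB _ _)); apply: lerD; last first.
  rewrite !normrM normfV (gtr0_norm pe) (gtr0_norm e0) ler_pM2r ?invr_gt0// ler_pM2r//.
  by rewrite ler_piMr// mulr_ile1.
apply: (le_trans (ler_normB _ _)); apply: lerD; last first.
  by rewrite !normrM normfV (gtr0_norm pe) ler_pM2r ?invr_gt0// ler_piMr.
rewrite !normrM !normfV (gtr0_norm pe) (gtr0_norm e0) !ler_pM2r ?invr_gt0//.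
by apply: (le_trans (ler_normB _ _)); move: b1 b2; rewrite /=; lra.
Unshelve. all: by end_near. Qed.

Lemma incr_covE (e t s : R) : 0 < e -> 0 <= t <= 1 -> 0 <= s <= 1 ->
  k (u e t) (u e s) - k (u e t) (T n) - k (T n) (u e s) + k (T n) (T n) =
  e ^+ 2 * (a ^+ 2 * t * s + b * (t ^+ 2 * s + t * s ^+ 2) * e + phi t s * p e + R1 e t s).
Proof.
move=> e0 t01 s01; have t01' : t \in `[0, 1] by rewrite in_itv.
have s01' : s \in `[0, 1] by rewrite in_itv.
have /(congr1 fine)/= <- := incr_cov e0 t01' s01'.
have ut := u_ge0 (ltW e0) (andP t01).1; have us := u_ge0 (ltW e0) (andP s01).1.
have Tn0 := ltW Tn_gt0.
pose mu v : seq (R * R) := [:: (v, 1)] ++ dscale (-1) [:: (T n, 1)].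
have W v : 0 <= v -> (fun w => X v w - X (T n) w) = (fun w => pairing (mu v) ((absproc X)^~ w)).
  move=> v0; apply/funext => w.
  by rewrite pairing_cat pairing_scale !pairing1 /absproc !ger0_norm ?mulN1r.
have E0 v : ('E_P[fun w => pairing (mu v) ((absproc X)^~ w)] = 0)%E.
  by rewrite unlock; exact: (absproc_mean hX).
rewrite -/(u e t) -/(u e s) !W// covariance_int// -(cov_kernelE (absproc_law hX)).
rewrite kform_catl !kform_catr !kform_scalel !kform_scaler !kform1 /kpath !pairing1 !(absproc_cov hX)//.
ring.
Qed.

Lemma phi_bounded : exists M : R, forall t s : R, 0 <= t <= 1 -> 0 <= s <= 1 -> `|phi t s| <= M.
Proof.
have [MM hMM] := k_diag_bound.
have [e [[e0 e1] he]] : exists e : R, (0 < e /\ e <= 1) /\ forall t s : R, 0 <= t <= 1 -> 0 <= s <= 1 -> `|R1 e t s / p e| <= 1.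
  near (0 : R)^'+ => e; exists e; split; last by near: e; exact: (usmall_R1 ltr01).
  by split; near: e; [exact: nbhs_right_gt|exact: nbhs_right_le].
have pe := p_gt0 e0.
exists (8 * MM / e ^+ 2 / p e + a ^+ 2 / p e + `|b| * 2 * e / p e + 1) => t s t01 s01.
have K2 v v' : T n <= v <= T n + 1 -> T n <= v' <= T n + 1 -> `|k v v'| <= 2 * MM.
  move=> hv hv'; have v0 : 0 <= v by apply: le_trans (ltW Tn_gt0) (andP hv).1.
  have v'0 : 0 <= v' by apply: le_trans (ltW Tn_gt0) (andP hv').1.
  have := @cond_cov_bound _ _ _ _ _ _ hX T n T_gt0 k_neq0 0 v v' (leq0n _) v0 v'0.
  by have := hMM _ hv; have := hMM _ hv'; rewrite /=; lra.
have ut := u_itv e0 e1 t01; have us := u_itv e0 e1 s01.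
have Tn : T n <= T n <= T n + 1 by rewrite lexx lerDl ler01.
have E := incr_covE e0 t01 s01.
have -> : phi t s = (k (u e t) (u e s) - k (u e t) (T n) - k (T n) (u e s) + k (T n) (T n)) / e ^+ 2 / p e
   - a ^+ 2 * (t * s) / p e - b * (t ^+ 2 * s + t * s ^+ 2) * e / p e - R1 e t s / p e.
  by rewrite E; field; rewrite !gt_eqF.
have tle : `|t| <= 1 by rewrite ger0_norm; case/andP: t01.
have sle : `|s| <= 1 by rewrite ger0_norm; case/andP: s01.
apply: (le_trans (ler_normB _ _)); apply: lerD; last exact: he.
apply: (le_trans (ler_normB _ _)); apply: lerD; last first.
  rewrite !normrM normfV (gtr0_norm pe) (gtr0_norm e0) ler_pM2r ?invr_gt0// ler_pM2r// ler_wpM2l//.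
  apply: (le_trans (ler_normD _ _)); rewrite !normrM.
  have : `|t| * `|t| * `|s| <= 1 by rewrite !mulr_ile1 ?mulr_ge0.
  have : `|t| * (`|s| * `|s|) <= 1 by rewrite !mulr_ile1 ?mulr_ge0.
  lra.
apply: (le_trans (ler_normB _ _)); apply: lerD; last first.
  rewrite !normrM normfV (gtr0_norm pe) ler_pM2r ?invr_gt0// -expr2 real_normK ?num_real//.
  by rewrite ler_piMr ?sqr_ge0// mulr_ile1.
rewrite !normrM !normfV (gtr0_norm pe) (gtr0_norm (exprn_gt0 2 e0)) !ler_pM2r ?invr_gt0 ?exprn_gt0//.
have h1 := K2 _ _ ut us; have h2 := K2 _ _ ut Tn; have h3 := K2 _ _ Tn us; have h4 := K2 _ _ Tn Tn.
apply: (le_trans (ler_normD _ _)); apply: (le_trans (lerD (ler_normB _ _) (lexx _))).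
apply: (le_trans (lerD (lerD (ler_normB _ _) (lexx _)) (lexx _))); lra.
Unshelve. all: by end_near. Qed.

(** Increments of [k_j] in the first variable obey the linear recursion of [cond_coef], so each
    coefficient of the expansion, and the remainder, is transported separately. *)
Lemma cond_incr j (e t S : R) : (j <= n)%N -> 0 < e -> 0 <= t <= 1 -> 0 < S ->
  kc j (u e t) S - kc j (T n) S =
  e * (cond_coef k T c j S * t + cond_coef k T dd j S * t ^+ 2 * e +
       cond_coef k T (psi t) j S * p e + cond_coef k T (R2 e t) j S).
Proof.
elim: j S => [|j ih] S jn e0 t01 S0; first by apply: incr_k; rewrite // in_itv.
have Tj : 0 < T j.+1 by rewrite T_gt0.
have h1 := ih S (ltnW jn) e0 t01 S0; have h2 := ih (T j.+1) (ltnW jn) e0 t01 Tj.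
have knz : kc j (T j.+1) (T j.+1) != 0 by exact: (k_neq0 (j := j.+1)).
rewrite [LHS](_ : _ = (kc j (u e t) S - kc j (T n) S) - cond_alpha k T j.+1 S *
  (kc j (u e t) (T j.+1) - kc j (T n) (T j.+1))).
  by rewrite h1 h2 /=; ring.
by rewrite /cond_alpha /=; field.
Qed.

Lemma usmall_cond_R2 j (S : R) : (j <= n)%N -> 0 < S ->
  usmall (fun e t _ => cond_coef k T (R2 e t) j S / p e).
Proof.
elim: j S => [|j ih] S jn S0; first exact: usmall_R2.
have Tj : 0 < T j.+1 by rewrite T_gt0.
apply: usmall_eq (usmallB (ih S (ltnW jn) S0) (usmallZ (cond_alpha k T j.+1 S) (ih (T j.+1) (ltnW jn) Tj))).
by apply: nearW => e t s _ _ /=; ring.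
Qed.

Lemma cond_psi_bounded j (S : R) : (j <= n)%N -> 0 < S ->
  ubounded (fun _ t _ => cond_coef k T (psi t) j S).
Proof.
elim: j S => [|j ih] S jn S0.
  by have [M hM] := psi_bounded S0; apply: (@uboundedT _ _ M) => e t s t01 _; exact: hM.
have Tj : 0 < T j.+1 by rewrite T_gt0.
have [M1 h1] := ih S (ltnW jn) S0; have [M2 h2] := ih (T j.+1) (ltnW jn) Tj.
exists (M1 + `|cond_alpha k T j.+1 S| * M2); apply: filterS2 h1 h2 => e h1 h2 t s t01 s01 /=.
apply: (le_trans (ler_normB _ _)); apply: lerD; first exact: (h1 t s).
by rewrite normrM ler_wpM2l//; exact: (h2 t s).
Qed.

Local Notation kap l := (kc l (T l.+1) (T l.+1)).

(** Conditioning at [T l.+1] subtracts from a rectangular increment the product of two simple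
    increments over the variance, and these corrections add up. Working with increments is what fits
    the two expansions assumed. *)
Lemma cond_cov_incr_sum j (e t s : R) : (j <= n)%N ->
  kc j (u e t) (u e s) - kc j (u e t) (T n) - kc j (T n) (u e s) + kc j (T n) (T n) =
  k (u e t) (u e s) - k (u e t) (T n) - k (T n) (u e s) + k (T n) (T n) -
  \sum_(l < j) (kc l (u e t) (T l.+1) - kc l (T n) (T l.+1)) *
    (kc l (u e s) (T l.+1) - kc l (T n) (T l.+1)) / kap l.
Proof.
elim: j => [|j ih] jn; first by rewrite big_ord0 subr0.
have knz : kap j != 0 by exact: (k_neq0 (j := j.+1)).
rewrite big_ord_recr /= [in RHS]opprD [RHS]addrA -ih; last exact: ltnW.
by field.
Qed.

(** After the last conditioning nothing random remains at [T n], so the rectangular increment of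
    [k_n] based there is [k_n] itself. *)
Lemma cond_cov_last (v : R) : 0 <= v -> kc n v (T n) = 0 /\ kc n (T n) v = 0.
Proof.
move=> v0.
have H w : kc n w (T n) = 0.
  case: n n_ge1 k_neq0 => [//|n'] _ /(_ n'.+1 (leqnn _))/= knz; first by field.
split=> //; rewrite (@cond_cov_sym _ _ _ _ _ _ hX T n T_gt0 k_neq0)//; exact: ltW.
Qed.

Lemma cond_cov_rescaled (e t s : R) : 0 < e -> 0 <= t <= 1 -> 0 <= s <= 1 ->
  kc n (u e t) (u e s) =
  k (u e t) (u e s) - k (u e t) (T n) - k (T n) (u e s) + k (T n) (T n) -
  \sum_(l < n) (kc l (u e t) (T l.+1) - kc l (T n) (T l.+1)) *
    (kc l (u e s) (T l.+1) - kc l (T n) (T l.+1)) / kap l.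
Proof.
move=> e0 t01 s01; rewrite -cond_cov_incr_sum//.
have ut := u_ge0 (ltW e0) (andP t01).1; have us := u_ge0 (ltW e0) (andP s01).1.
have [h1 _] := cond_cov_last ut; have [_ h2] := cond_cov_last us.
by have [h3 _] := cond_cov_last (ltW Tn_gt0); rewrite h1 h2 h3 !subr0 addr0.
Qed.

Local Notation cl l := (cond_coef k T c l (T l.+1)).
Local Notation dl l := (cond_coef k T dd l (T l.+1)).
Local Notation ps l t := (cond_coef k T (psi t) l (T l.+1)).
Local Notation r2 l e t := (cond_coef k T (R2 e t) l (T l.+1)).
Local Notation B := (b_cond k T n b c dd).
Local Notation phin := (phi_cond k T n alpha phi c dd psi).

Definition lead_coef_cov : R := a ^+ 2 - \sum_(l < n) cl l ^+ 2 / kap l.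
Local Notation A := lead_coef_cov.

Definition resc_cov (e t s : R) : R := kc n (u e t) (u e s) / e ^+ 2.
Local Notation N := resc_cov.

Definition resc_rem (e t s : R) : R :=
  (N e t s - A * (t * s) - B * (t * t * s + t * (s * s)) * e) / p e.
Local Notation g := resc_rem.

Lemma b_condE : B = b - \sum_(l < n) cl l * dl l / kap l.
Proof. by rewrite /b_cond big_add1 /= big_mkord. Qed.

Lemma phi_condE (t s : R) : phin t s =
  phi t s - \sum_(l < n) cl l / kap l * (ps l t * s + ps l s * t) -
  (alpha == 1)%:R * \sum_(l < n) dl l ^+ 2 / kap l * (t ^+ 2 * s ^+ 2).
Proof.
rewrite /phi_cond !big_add1 /= !big_mkord; congr (_ - _).
by case: (alpha == 1); rewrite ?mul1r ?mul0r.
Qed.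

Let q l (e t : R) : R := ps l t + r2 l e t / p e.

(* What remains of the product of two increments at [T l.+1], divided by
   [e ^+ 2 * p e], once the terms contributing to [A], [B] and [phin] are removed. *)
Let small l (e t s : R) : R := (kap l)^-1 *
  ((q l e s - ps l s) * (cl l * t) + (q l e t - ps l t) * (cl l * s) +
   (e ^+ 2 / p e - (alpha == 1)%:R) * (dl l * dl l * (t * t) * (s * s)) +
   e * (dl l * (t * t) * q l e s + dl l * (s * s) * q l e t) + p e * (q l e t * q l e s)).

Lemma resc_rem_sub (e t s : R) : 0 < e -> 0 <= t <= 1 -> 0 <= s <= 1 ->
  g e t s - phin t s = R1 e t s / p e - \sum_(l < n) small l e t s.
Proof.
move=> e0 t01 s01; have pe := p_gt0 e0.
have step (l : 'I_n) : (kc l (u e t) (T l.+1) - kc l (T n) (T l.+1)) *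
    (kc l (u e s) (T l.+1) - kc l (T n) (T l.+1)) / kap l =
  e ^+ 2 * (cl l ^+ 2 / kap l * (t * s) + cl l * dl l / kap l * ((t * t * s + t * (s * s)) * e) +
    p e * (cl l / kap l * (ps l t * s + ps l s * t)) +
    p e * (alpha == 1)%:R * (dl l ^+ 2 / kap l * (t ^+ 2 * s ^+ 2)) + p e * small l e t s).
  have Tl : 0 < T l.+1 by rewrite T_gt0//= ltn_ord.
  have knz : kap l != 0 by apply: (k_neq0 (j := l.+1)); rewrite /= ltn_ord.
  have ln : (l <= n)%N by rewrite ltnW.
  by rewrite !cond_incr// /small /q; field; rewrite knz gt_eqF.
rewrite /resc_rem /N cond_cov_rescaled// incr_covE// b_condE phi_condE /A (eq_bigr _ (fun l _ => step l)).
rewrite -mulr_sumr !big_split/= -!mulr_sumr -!mulr_suml.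
move: (\sum_(l < n) cl l ^+ 2 / kap l) (\sum_(l < n) cl l * dl l / kap l)
  (\sum_(l < n) cl l / kap l * (ps l t * s + ps l s * t))
  (\sum_(l < n) dl l ^+ 2 / kap l) (\sum_(l < n) small l e t s) => S1 S2 S3 S4 S5.
by field; rewrite !gt_eqF.
Qed.

Lemma usmall_sub_bounded (f h : R -> R -> R -> R) :
  usmall (fun e t s => f e t s - h e t s) -> ubounded h -> ubounded f.
Proof.
move=> /usmall_bounded hf hh; have [M hM] := uboundedD hf hh; exists M.
by apply: filterS hM => e he t s t01 s01; have := he t s t01 s01; rewrite subrK.
Qed.

Lemma usmall_resc_rem : usmall (fun e t s => g e t s - phin t s).
Proof.
have S0 (l : 'I_n) : 0 < T l.+1 by rewrite T_gt0//= ltn_ord.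
have qs (l : 'I_n) : usmall (fun e t _ => q l e t - ps l t).
  have := usmall_cond_R2 (ltnW (ltn_ord l)) (S0 l); apply: usmall_eq.
  by apply: nearW => e t s _ _; rewrite /q addrAC subrr add0r.
have qb (l : 'I_n) : ubounded (fun e t _ => q l e t).
  exact: usmall_sub_bounded (qs l) (cond_psi_bounded (ltnW (ltn_ord l)) (S0 l)).
have sm (l : 'I_n) : usmall (small l).
  have qs' := usmall_swap (qs l); have qb' := ubounded_swap (qb l).
  have bc z := @ubounded_cst R z; have b1 := @ubounded_fst R; have b2 := @ubounded_snd R.
  apply: usmallZ; apply: usmallD; last first.
    by apply: usmallM usmall_p _; apply: uboundedM.
  apply: usmallD; last first.
    by apply: usmallM usmall_id _; apply: uboundedD; do ?apply: uboundedM.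
  apply: usmallD; last by apply: usmallM usmall_theta _; do ?apply: uboundedM.
  by apply: usmallD; apply: usmallM => //; apply: uboundedM.
apply: usmall_eq (usmallB usmall_R1 (usmall_sum (index_enum 'I_n) sm)).
by apply: filterS near0 => e e0 t s t01 s01; rewrite resc_rem_sub.
Qed.

Lemma phin_bounded : ubounded (fun _ t s => phin t s).
Proof.
have S0 (l : 'I_n) : 0 < T l.+1 by rewrite T_gt0//= ltn_ord.
have pb (l : 'I_n) := cond_psi_bounded (ltnW (ltn_ord l)) (S0 l).
have bc z := @ubounded_cst R z; have b1 := @ubounded_fst R; have b2 := @ubounded_snd R.
have [M hM] := phi_bounded.
have h1 : ubounded (fun _ t s => phi t s) by apply: (@uboundedT _ _ M) => e t s; exact: hM.
have h2 : ubounded (fun e t s => \sum_(l < n) (cl l / kap l) * (ps l t * s + ps l s * t)).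
  apply: ubounded_sum => l; apply: uboundedM => //; apply: uboundedD; apply: uboundedM => //.
  exact: ubounded_swap (pb l).
have h3 : ubounded (fun e t s => \sum_(l < n) (dl l ^+ 2 / kap l) * (t * t * (s * s))).
  by apply: ubounded_sum => l; do ?apply: uboundedM.
have [M' hM'] := uboundedD (uboundedD h1 (uboundedM (bc (-1)) h2)) (uboundedM (bc (- (alpha == 1)%:R)) h3).
exists M'; apply: filterS hM' => e he t s t01 s01; have := he t s t01 s01.
by rewrite phi_condE; congr (`|_| <= _); rewrite mulN1r mulNr.
Qed.

Lemma resc_rem_bounded : ubounded g.
Proof. exact: usmall_sub_bounded usmall_resc_rem phin_bounded. Qed.

Lemma resc_covE (e t s : R) : 0 < e ->
  N e t s = A * (t * s) + B * (t * t * s + t * (s * s)) * e + p e * g e t s.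
Proof. by move=> e0; rewrite /resc_rem; field; rewrite gt_eqF// p_gt0. Qed.

Lemma usmall_resc_cov : usmall (fun e t s => N e t s - A * (t * s)).
Proof.
have bc z := @ubounded_cst R z; have b1 := @ubounded_fst R; have b2 := @ubounded_snd R.
have h1 : usmall (fun e t s => e * (B * (t * t * s + t * (s * s)))).
  by apply: usmallM usmall_id _; apply: uboundedM => //; apply: uboundedD; do ?apply: uboundedM.
apply: usmall_eq (usmallD h1 (usmallM usmall_p resc_rem_bounded)).
by apply: filterS near0 => e e0 t s t01 s01; rewrite resc_covE//; ring.
Qed.

Let in01 : 0 <= (1 : R) <= 1. Proof. by rewrite ler01 lexx. Qed.

Lemma bar_kE (t s : R) : 0 <= t <= 1 -> 0 <= s <= 1 -> bar_k k T n t s = A * (t * s).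
Proof.
move=> t01 s01; rewrite /bar_k; apply/cvg_lim => //.
have h : usmall (fun e t' s' => N e t s - A * (t * s)).
  by move=> eta eta0; apply: filterS (usmall_resc_cov eta0) => e he _ _ _ _; exact: he.
exact: (usmall_cvg t01 s01 h).
Qed.

Lemma bar_k11 : bar_k k T n 1 1 = A.
Proof. by rewrite bar_kE ?in01// !mulr1. Qed.

Lemma A_neq0 : A != 0.
Proof. by rewrite -bar_k11. Qed.

Lemma usmall_inv11 : usmall (fun e _ _ => (N e 1 1)^-1 - A^-1) /\
  \forall e \near 0^'+, N e 1 1 != 0.
Proof.
have h : usmall (fun e _ _ => N e 1 1 - A).
  move=> eta eta0; apply: filterS (usmall_resc_cov eta0) => e he _ _ _ _.
  by have := he 1 1 in01 in01; rewrite !mulr1.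
have [h1 h2] := usmall_inv A_neq0 h; split => //.
by apply: filterS h2 => e he; exact: (he 1 1 in01 in01).
Qed.

Lemma usmall_beta : usmall (fun e t _ => beta k T n e t - t).
Proof.
have [h1 h2] := usmall_inv11.
have bt : ubounded (fun _ t (_ : R) => A * t) by apply: uboundedM; [exact: ubounded_cst|exact: ubounded_fst].
have iv : ubounded (fun e _ _ => (N e 1 1)^-1).
  exact: usmall_sub_bounded h1 (ubounded_cst _).
have hN := usmall_fst1 usmall_resc_cov.
apply: usmall_eq (usmallD (usmallM hN iv) (usmallM h1 bt)).
apply: filterS2 near0 h2 => e e0 he t s _ _; rewrite /beta.
have -> : kc n (T n + e * t) (T n + e) / kc n (T n + e) (T n + e) = N e t 1 / N e 1 1.
  by rewrite /N /u mulr1 invf_div mulrA divfK// expf_neq0// gt_eqF.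
by field; rewrite A_neq0 he.
Qed.

Lemma bar_betaE (t : R) : 0 <= t <= 1 -> bar_beta k T n t = t.
Proof.
move=> t01; rewrite /bar_beta; apply/cvg_lim => //.
have h : usmall (fun e t' s' => beta k T n e t - t).
  by move=> eta eta0; apply: filterS (usmall_beta eta0) => e he _ _ _ _; exact: (he t t).
exact: (usmall_cvg t01 t01 h).
Qed.

Definition bridge_cov (e t s : R) : R :=
  kc n (u e t) (u e s) - kc n (u e t) (u e 1) * kc n (u e 1) (u e s) / kc n (u e 1) (u e 1).

Local Notation bkY := (bar_kY k T n alpha b phi c dd psi).

(** A Schur complement: after division by [e ^+ 2] it is the determinant
    [N(t,s) N(1,1) - N(t,1) N(1,s)] over [N(1,1)], in which the orders 1 and [e] cancel. *)
Lemma usmall_bridge_cov : usmall (fun e t s => bridge_cov e t s / (e ^+ 2 * p e) - bkY t s).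
Proof.
have [iv1 nz] := usmall_inv11; have rs := usmall_resc_rem; have gb := resc_rem_bounded.
have pb := phin_bounded.
have bc z := @ubounded_cst R z; have b1 := @ubounded_fst R; have b2 := @ubounded_snd R.
have iv : ubounded (fun e _ _ => (N e 1 1)^-1) by exact: usmall_sub_bounded iv1 (bc _).
(* In that determinant [B ^+ 2 * S] is the coefficient of [e ^+ 2] and [A * G g] that of [p e]; the
   last two items of [bb] are those of [e * p e] and of the square of [p e]. *)
pose S (t s : R) : R := t * s * s + t * t * s + -1 * (t * t * s * s) + -1 * (s * t).
pose G (f : R -> R -> R) t s := f t s + t * s * f 1 1 + -1 * (t * f 1 s) + -1 * (s * f t 1).
have Sb : ubounded (fun _ t s => S t s) by rewrite /S; do ?apply: uboundedD; do ?apply: uboundedM.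
have Gs : usmall (fun e t s => G (g e) t s - G phin t s).
  have h11 := usmall_snd1 (usmall_fst1 rs).
  apply: usmall_eq (usmallB (usmallB (usmallD rs (usmallM h11 (uboundedM b1 b2))) (usmallM (usmall_snd1 rs) b1)) (usmallM (usmall_fst1 rs) b2)).
  by apply: nearW => e t s _ _; rewrite /G; ring.
have bb (f : R -> R -> R -> R) (z : R) : ubounded f ->
  [/\ ubounded (fun e t s => G (f e) t s),
      ubounded (fun e t s => z * (2 * f e t s + (t * t * s + t * (s * s)) * f e 1 1 +
        -1 * ((t * t + t) * f e 1 s) + -1 * ((s * s + s) * f e t 1))) &
      ubounded (fun e t s => f e t s * f e 1 1 + -1 * (f e t 1 * f e 1 s))].
  move=> fb; have h1 := ubounded_fst1 fb; have h2 := ubounded_snd1 fb; have h11 := ubounded_snd1 h1.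
  split.
  - by rewrite /G; do ?apply: uboundedD; do ?apply: uboundedM.
  - by apply: uboundedM => //; do ?apply: uboundedD; do ?apply: uboundedM => //;
      do ?apply: uboundedD; do ?apply: uboundedM.
  - by do ?apply: uboundedD; do ?apply: uboundedM.
have [Gb _ _] := bb _ 0 pb; have [_ hb1 hb2] := bb _ B gb.
pose al : R := (alpha == 1)%:R.
have hS : ubounded (fun _ t s => B ^+ 2 * S t s) by apply: uboundedM.
(* The first summand compares numerators after division by [p e]; the second replaces [(N e 1 1)^-1]
   by its limit in front of the limiting numerator. *)
have main := usmallD (usmallM (usmallD (usmallD (usmallD (usmallM usmall_theta hS) (usmallZ A Gs))
  (usmallM usmall_id hb1)) (usmallM usmall_p hb2)) iv)
  (usmallM iv1 (uboundedD (uboundedM (bc al) hS) (uboundedM (bc A) Gb))).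
apply: usmall_eq main; apply: filterS2 near0 nz => e e0 he t s t01 s01.
have pe := p_gt0 e0.
have -> : bridge_cov e t s / (e ^+ 2 * p e) = (N e t s * N e 1 1 - N e t 1 * N e 1 s) / N e 1 1 / p e.
  have k11 : kc n (u e 1) (u e 1) != 0.
    by move: he; rewrite /N mulf_eq0 negb_or => /andP[].
  by rewrite /bridge_cov /N; field; rewrite k11 !gt_eqF.
have -> : bkY t s = (al * (B ^+ 2 * S t s) + A * G phin t s) / A.
  rewrite /bar_kY bar_k11 /al /S /G; have A0 := A_neq0.
  by case: ifP => _; rewrite ?mul1r ?mul0r ?add0r; field.
have A0 := A_neq0.
move: he; rewrite !(resc_covE _ _ e0) /S /G -/al.
move: (g e t s) (g e 1 1) (g e t 1) (g e 1 s) (phin t s) (phin 1 1) (phin t 1) (phin 1 s) A A0 B al.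
move=> gts g11 gt1 g1s fts f11 ft1 f1s A' A'0 B' al'; move: (p e) pe => pe pe0.
rewrite !mulr1 !mul1r => N0.
by field; rewrite A'0 gt_eqF//= N0.
Qed.

(** * Path continuity, mean and deviation of the bridge *)

Definition half_line_cont (f : R -> R) := forall v e : R, 0 <= v -> 0 < e ->
  exists2 r : R, 0 < r & forall v' : R, 0 <= v' -> `|v' - v| < r -> `|f v' - f v| < e.

Lemma half_line_cont_lin (f g' : R -> R) (z : R) :
  half_line_cont f -> half_line_cont g' -> half_line_cont (fun v => f v + z * g' v).
Proof.
move=> cf cg v e v0 e0; have e2 : 0 < e / 2 by rewrite divr_gt0.
have z1 : 0 < `|z| + 1 by rewrite ltr_wpDl.
have [r1 r10 h1] := cf v _ v0 e2; have [r2' r20 h2] := cg v _ v0 (divr_gt0 e2 z1).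
exists (Num.min r1 r2'); first by rewrite lt_min r10.
move=> v' v'0; rewrite lt_min => /andP[/(h1 _ v'0) q1 /(h2 _ v'0) q2].
rewrite (_ : _ - _ = (f v' - f v) + z * (g' v' - g' v)); last by ring.
apply: (le_lt_trans (ler_normD _ _)); rewrite normrM.
have : `|z| * `|g' v' - g' v| <= (`|z| + 1) * (e / 2 / (`|z| + 1)).
  by apply: ler_pM => //; [rewrite lerDl|exact: ltW].
have -> : (`|z| + 1) * (e / 2 / (`|z| + 1)) = e / 2 by field; rewrite gt_eqF.
lra.
Qed.

Lemma kc_half_line j (S : R) : (j <= n)%N -> 0 <= S -> half_line_cont (fun v => kc j v S).
Proof.
move=> jn S0 v e v0 e0.
have /quadrant_contP/(_ v S e v0 S0 e0)[r r0 hr] := cond_cov_cont T_gt0 k_quadrant_cont jn.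
by exists r => // v' v'0 vv'; apply: hr => //; rewrite subrr normr0.
Qed.

Local Notation Xc j v w := (cond_proc k T (fun v' => X v' : Omega -> R) (fun=> 0) j v w).

Lemma Xc_half_line j w : (j <= n)%N -> half_line_cont (fun v => Xc j v w).
Proof.
elim: j => [_|j ih jn].
  have [_ _ cX _ _] := hX; move=> v e v0 e0.
  have /subspace_continuousP/(_ v)/= := cX w; rewrite in_itv/= andbT => /(_ v0).
  move=> /cvgrPdist_lt/(_ e e0); rewrite /within/= => /nbhs_ballP[r r0 hr]; exists r => // v' v'0 vv'.
  rewrite distrC; apply: hr; first by rewrite /ball/= distrC.
  by rewrite in_itv/= andbT.
have Tj : 0 <= T j.+1 by rewrite ltW// T_gt0.
have := half_line_cont_lin (- (kap j)^-1 * Xc j (T j.+1) w) (ih (ltnW jn)) (kc_half_line (ltnW jn) Tj).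
by congr half_line_cont; apply/funext => v /=; rewrite subr0 /cond_alpha /=; ring.
Qed.

Lemma Xc_last w : Xc n (T n) w = 0 /\ cond_mean k T x n (T n) = x n.
Proof.
have H : exists2 n', n = n'.+1 & cond_alpha k T n (T n) = 1.
  have := k_neq0 (j := n); rewrite n_ge1 leqnn => /(_ isT).
  by case: n n_ge1 => [//|n'] _ knz; exists n'; rewrite // /cond_alpha /= divff.
have [n' -> a1] := H; rewrite /cond_mean /= a1; split; ring.
Qed.

Lemma usmall_mean j : (j <= n)%N ->
  usmall (fun e t _ => cond_mean k T x j (u e t) - cond_mean k T x j (T n)).
Proof.
elim: j => [_|j ih jn].
  by apply: usmall_eq (@usmall0 R); apply: nearW => e t s _ _; rewrite /cond_mean/= subrr.
have Tj : 0 <= T j.+1 by rewrite ltW// T_gt0.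
have hk : usmall (fun e t _ => kc j (u e t) (T j.+1) - kc j (T n) (T j.+1)).
  move=> eta eta0; have [r r0 hr] := kc_half_line (ltnW jn) Tj (ltW Tn_gt0) eta0.
  near=> e => t s t01 _; apply/ltW/hr.
    by apply: u_ge0; [apply: ltW; near: e; exact: near0|case/andP: t01].
  rewrite /u addrC addKr normrM; apply: (@le_lt_trans _ _ `|e|).
    by rewrite ler_piMr// ger0_norm; case/andP: t01.
  rewrite gtr0_norm; first by near: e; exact: nbhs_right_lt.
  by near: e; exact: near0.
apply: usmall_eq (usmallB (ih (ltnW jn)) (usmallZ ((kap j)^-1 * (cond_mean k T x j (T j.+1) - x j.+1)) hk)).
by apply: nearW => e t s _ _; rewrite /cond_mean /= /cond_alpha /=; ring.
Unshelve. all: by end_near. Qed.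

Definition bridge_mean (e t : R) : R :=
  cond_mean k T x n (u e t) - beta k T n e t * (cond_mean k T x n (T n + e) - y).

Lemma usmall_bridge_mean : usmall (fun e t _ => bridge_mean e t - (x n + t * (y - x n))).
Proof.
(* [Xc_last] is stated at a sample point; one exists because the whole space has probability 1. *)
have [w0] : inhabited Omega.
  by have [w _] : (setT : set Omega) !=set0; [apply/set0P; apply/eqP => h;
    have := probability_setT P; rewrite h measure0 => /eqP; rewrite eqe eq_sym oner_eq0|exact: (inhabits w)].
have [_ mn] := Xc_last w0; have := usmall_mean (leqnn n); rewrite mn => h1.
have h2 := usmall_fst1 (usmall_swap h1).
have b1 := @ubounded_fst R; have bc z := @ubounded_cst R z.
apply: usmall_eq (usmallB (usmallB h1 (usmallM usmall_beta (uboundedD (usmall_bounded h2) (bc (x n - y)))))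
  (usmallM h2 b1)).
by apply: nearW => e t s _ _; rewrite /bridge_mean /u mulr1; ring.
Qed.

Definition bridge_measure (e t : R) : seq (R * R) :=
  cond_measure k T n (u e t) ++ dscale (- beta k T n e t) (cond_measure k T n (T n + e)).

Definition bridge_dev (e : R) (t : I01 R) (w : Omega) : R :=
  pairing (bridge_measure e (val t)) ((absproc X)^~ w).

Lemma bridge_devE (e : R) t w : 0 < e ->
  bridge_dev e t w = Xc n (u e (val t)) w - beta k T n e (val t) * Xc n (T n + e) w.
Proof.
move=> e0; rewrite /bridge_dev pairing_cat pairing_scale mulNr.
have ut := u_ge0 (ltW e0) (I01_ge0 t); have u1 : 0 <= T n + e by rewrite addr_ge0// ltW.
by rewrite !(cond_measure_proc X k T_gt0).
Qed.

Lemma bridge_split (e : R) (t : I01 R) w : 0 < e ->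
  bridge k T n (fun v => X v : Omega -> R) x y e (val t) w = bridge_mean e (val t) + bridge_dev e t w.
Proof.
move=> e0; rewrite bridge_devE// /bridge !(cond_proc_split X k T x) /bridge_mean /u; ring.
Qed.

Lemma bridge_dev_law e (mu : seq (I01 R * R)) :
  exists s, has_law P (fun w => pairing mu (fun t => bridge_dev e t w)) 0 s.
Proof.
have [s hs] := absproc_law hX (flatten [seq dscale p.2 (bridge_measure e (val p.1)) | p <- mu]).
exists s; move: hs; congr has_law; apply/funext => w; elim: mu => [|p mu ih] /=; first by rewrite !pairing_nil.
by rewrite pairing_cat pairing_scale pairing_cons ih.
Qed.

Lemma bridge_dev_cov (e : R) s t : 0 < e -> N e 1 1 != 0 ->
  cov_kernel P (bridge_dev e) s t = bridge_cov e (val s) (val t).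
Proof.
move=> e0 N0; have k11 : kc n (T n + e) (T n + e) != 0.
  by move: N0; rewrite /N /u mulr1 mulf_eq0 negb_or => /andP[].
rewrite /cov_kernel /bridge_dev -(cov_kernelE (absproc_law hX)) /bridge_measure.
have us := u_ge0 (ltW e0) (I01_ge0 s).
have ut := u_ge0 (ltW e0) (I01_ge0 t); have u1 : 0 <= T n + e by rewrite addr_ge0// ltW.
rewrite kform_catl !kform_catr !kform_scalel !kform_scaler !(cond_measure_cov hX T_gt0 k_neq0)//.
have u1E : u e 1 = T n + e by rewrite /u mulr1.
rewrite /bridge_cov /beta u1E -/(u e (val s)) -/(u e (val t)).
rewrite (cond_cov_sym hX T_gt0 k_neq0 (leqnn n) u1 ut).
by field.
Qed.

Let u_dist (e t t' : R) : 0 < e -> `|u e t' - u e t| = e * `|t' - t|.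
Proof.
move=> e0; rewrite /u opprD addrACA subrr add0r -mulrBr normrM gtr0_norm//.
Qed.

Lemma bridge_dev_cont (e : R) w (t : I01 R) : 0 < e -> forall z : R, 0 < z ->
  exists2 r : R, 0 < r & forall s, `|val s - val t| < r -> `|bridge_dev e s w - bridge_dev e t w| < z.
Proof.
move=> e0 z z0; have u1 : 0 <= T n + e by rewrite addr_ge0// ltW.
have ut := u_ge0 (ltW e0) (I01_ge0 t).
have := half_line_cont_lin (- (Xc n (T n + e) w / kc n (T n + e) (T n + e)))
  (Xc_half_line w (leqnn n)) (kc_half_line (leqnn n) u1).
move=> /(_ _ _ ut z0)[r r0 hr]; exists (r / e); first exact: divr_gt0.
move=> s st; have us := u_ge0 (ltW e0) (I01_ge0 s).
rewrite !bridge_devE// /beta -/(u e (val s)) -/(u e (val t)).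
have := hr (u e (val s)) us; rewrite u_dist// => h.
have -> : Xc n (u e (val s)) w - kc n (u e (val s)) (T n + e) / kc n (T n + e) (T n + e) * Xc n (T n + e) w -
  (Xc n (u e (val t)) w - kc n (u e (val t)) (T n + e) / kc n (T n + e) (T n + e) * Xc n (T n + e) w) =
  Xc n (u e (val s)) w + - (Xc n (T n + e) w / kc n (T n + e) (T n + e)) * kc n (u e (val s)) (T n + e) -
  (Xc n (u e (val t)) w + - (Xc n (T n + e) w / kc n (T n + e) (T n + e)) * kc n (u e (val t)) (T n + e)) by ring.
by apply: h; rewrite mulrC -ltr_pdivlMr.
Qed.

(** Transfers a bound from countably many times, where it is measurable, to the whole interval, so
    that the same event can serve every smaller scale. *)
Lemma Xc_dense (d' s' : R) w : 0 < d' -> d' <= 1 ->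
  (forall j, `|Xc n (u d' (val (ratI R j))) w| <= s') ->
  forall v, T n <= v <= T n + d' -> `|Xc n v w| <= s'.
Proof.
move=> d0 d1 hj v /andP[v1 v2]; apply/ler_addgt0Pr => z z0.
have v0 : 0 <= v by apply: le_trans v1; exact: ltW.
have [r r0 hr] := Xc_half_line w (leqnn n) v0 z0.
have t01 : 0 <= (v - T n) / d' <= 1.
  by rewrite divr_ge0 ?subr_ge0 ?(ltW d0)//= ler_pdivrMr// mul1r lerBlDl.
have [j hd] := ratI_dense (toI ((v - T n) / d')) r0; rewrite val_toI// in hd.
have vE : v = u d' ((v - T n) / d') by rewrite /u mulrCA divff ?gt_eqF// mulr1 subrKC.
have uj := u_ge0 (ltW d0) (I01_ge0 (ratI R j)).
have := hr _ uj; rewrite {1}vE u_dist// => h; have {}h := h (le_lt_trans (ler_piMl (normr_ge0 _) d1) hd).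
have := hj j; rewrite -[X in _ -> `|X| <= _](subrK (Xc n (u d' (val (ratI R j))) w)) => h2.
by apply: (le_trans (ler_normD _ _)); rewrite distrC; lra.
Qed.

Lemma beta_le2 : \forall e \near 0^'+, forall t : R, 0 <= t <= 1 -> `|beta k T n e t| <= 2.
Proof.
apply: filterS (usmall_beta ltr01) => e he t t01; have := he t t t01 t01.
by case/andP: t01; rewrite !ler_norml => ? ? /andP[? ?]; apply/andP; split; lra.
Qed.

(** Paths of the centered X^n are continuous and vanish at [T n], so the events [D i] increase to
    the whole space. One of them has probability at least one half, and it serves for all [e] below
    its scale. *)
Lemma bridge_dev_small (s : R) : 0 < s -> \forall e \near 0^'+,
  exists2 D : set Omega, measurable D /\ (2^-1%:E <= P D)%E & forall w t, D w -> `|bridge_dev e t w| <= s.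
Proof.
move=> s0; have s3 : 0 < s / 3 by rewrite divr_gt0.
(* A third suffices: [beta] is at most 2 near 0, so the bridge is bounded by
   [s / 3 + 2 * (s / 3)]. *)
pose D i : set Omega := [set w | forall j, `|Xc n (u i.+1%:R^-1 (val (ratI R j))) w| <= s / 3].
have i0 (i : nat) : (0 : R) < i.+1%:R^-1 by rewrite invr_gt0.
have i1 (i : nat) : i.+1%:R^-1 <= (1 : R) by rewrite invf_le1// ler1n.
have mX v : 0 <= v -> measurable_fun setT (fun w => Xc n v w).
  move=> v0; have [z [mz _]] := absproc_law hX (cond_measure k T n v).
  by under eq_fun do rewrite -(cond_measure_proc X k T_gt0)//.
have mD i : measurable (D i).
  rewrite (_ : D i = \bigcap_j [set w | `|Xc n (u i.+1%:R^-1 (val (ratI R j))) w| <= s / 3]).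
    apply: bigcapT_measurable => j; rewrite -[X in measurable X]setTI.
    rewrite (_ : [set w | _] = (fun w => Xc n (u i.+1%:R^-1 (val (ratI R j))) w) @^-1` `[- (s / 3), s / 3]%classic).
      by apply: mX => //; apply: u_ge0; [exact: ltW|exact: I01_ge0].
    by apply/seteqP; split => w /=; rewrite in_itv/= ler_norml.
  by apply/seteqP; split => w /= h j; [move=> _|]; exact: h.
have Dv i w : D i w -> forall v, T n <= v <= T n + i.+1%:R^-1 -> `|Xc n v w| <= s / 3.
  by move=> Dw; exact: Xc_dense.
have ndD : {homo D : i j / (i <= j)%N >-> (i <= j)%O}.
  move=> i j ij; apply/subsetPset => w Dw l; apply: (Dv i w Dw).
  apply/andP; split; first by rewrite lerDl mulr_ge0 ?(ltW (i0 j)) ?I01_ge0.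
  rewrite lerD2l; apply: (@le_trans _ _ j.+1%:R^-1); first by rewrite ler_piMr ?(ltW (i0 j)) ?I01_le1.
  by rewrite lef_pV2 ?posrE// ler_nat.
have UD : \bigcup_i D i = setT.
  apply/seteqP; split => // w _; have [Xn _] := Xc_last w.
  have [r r0 hr] := Xc_half_line w (leqnn n) (ltW Tn_gt0) s3.
  have [i hi] := exists_mesh r0; exists i => // j.
  have uj := u_ge0 (ltW (i0 i)) (I01_ge0 (ratI R j)).
  have := hr _ uj; rewrite Xn subr0 => h; apply/ltW/h.
  rewrite /u addrC addKr normrM !ger0_norm ?I01_ge0 ?(ltW (i0 i))//.
  by apply: le_lt_trans hi; rewrite ler_piMr ?(ltW (i0 i))// I01_le1.
have cD := nondecreasing_cvg_mu mD (bigcupT_measurable _ mD) ndD.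
have [i Pi] : exists i, (2^-1%:E <= P (D i))%E.
  have /(cD _ P)[i _ hi] : nbhs (P (\bigcup_i D i)) [set z | (2^-1%:E < z)%E].
    apply: open_nbhs_nbhs; split; first exact: open_ereal_gt_ereal.
    by rewrite /= UD probability_setT lte_fin invf_lt1// ltr1n.
  by exists i; apply/ltW/hi => /=.
near=> e; exists (D i) => // w t Dw.
have e0 : 0 < e by near: e; exact: near0.
have ei : e <= i.+1%:R^-1 by near: e; exact: nbhs_right_le.
have bt : `|beta k T n e (val t)| <= 2.
  have h : forall t : R, 0 <= t <= 1 -> `|beta k T n e t| <= 2 by near: e; exact: beta_le2.
  by apply: h; rewrite I01_ge0 I01_le1.
rewrite bridge_devE//; apply: (le_trans (ler_normB _ _)); rewrite normrM.
have h1 : `|Xc n (u e (val t)) w| <= s / 3.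
  apply: (Dv i w Dw); rewrite lerDl mulr_ge0 ?(ltW e0) ?I01_ge0//= lerD2l.
  by apply: le_trans ei; rewrite ler_piMr ?(ltW e0)// I01_le1.
have h2 : `|Xc n (T n + e) w| <= s / 3 by apply: (Dv i w Dw); rewrite lerDl (ltW e0) lerD2l.
have h3 : `|beta k T n e (val t)| * `|Xc n (T n + e) w| <= 2 * (s / 3) by apply: ler_pM.
lra.
Unshelve. all: by end_near. Qed.

(** The limit kernel is a uniform limit of bridge covariances, each uniformly continuous because [k]
    is continuous on a compact square; regularity is read off at one small [e]. *)
Lemma bar_kY_quc (z : R) : 0 < z -> exists2 r : R, 0 < r & forall s t v : I01 R,
  `|val s - val t| < r -> `|bkY (val v) (val s) - bkY (val v) (val t)| <= z.
Proof.
move=> z0; have z3 : 0 < z / 3 by rewrite divr_gt0.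
have [e [e0 hb hc]] : exists e : R, [/\ 0 < e, forall t : R, 0 <= t <= 1 -> `|beta k T n e t| <= 2 &
  forall t s : R, 0 <= t <= 1 -> 0 <= s <= 1 -> `|bridge_cov e t s / (e ^+ 2 * p e) - bkY t s| <= z / 3].
  near (0 : R)^'+ => e; exists e; split; near: e; first exact: near0.
    exact: beta_le2.
  exact: (usmall_bridge_cov z3).
have v0 : 0 < e ^+ 2 * p e by rewrite mulr_gt0 ?p_gt0 ?exprn_gt0.
(* With [beta] at most 2, an increment of the bridge covariance is at most three increments of
   [k_n], hence a third of [z] after rescaling. *)
have eta0 : 0 < z / 9 * (e ^+ 2 * p e) by rewrite mulr_gt0// divr_gt0.
have [r r0 hr] := quadrant_cont_unif (T n + e) (ltW Tn_gt0) (cond_cov_cont T_gt0 k_quadrant_cont (leqnn n)) eta0.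
exists (r / e); first exact: divr_gt0.
move=> s t v st.
have i01 (w : I01 R) : 0 <= val w <= 1 by rewrite I01_ge0 I01_le1.
have ui (w : I01 R) : T n <= u e (val w) <= T n + e.
  by rewrite lerDl mulr_ge0 ?(ltW e0) ?I01_ge0//= lerD2l ler_piMr ?(ltW e0)// I01_le1.
have u1E : u e 1 = T n + e by rewrite /u mulr1.
have u1i : T n <= u e 1 <= T n + e by rewrite u1E lexx lerDl (ltW e0).
have ust : `|u e (val s) - u e (val t)| < r by rewrite u_dist// mulrC -ltr_pdivlMr.
have h1 := hr _ _ _ (ui v) (ui t) (ui s) ust; have h2 := hr _ _ _ u1i (ui t) (ui s) ust.
have cs := hc _ _ (i01 v) (i01 s); have ct := hc _ _ (i01 v) (i01 t).
have bE : bridge_cov e (val v) (val s) - bridge_cov e (val v) (val t) =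
  (kc n (u e (val v)) (u e (val s)) - kc n (u e (val v)) (u e (val t))) -
  beta k T n e (val v) * (kc n (u e 1) (u e (val s)) - kc n (u e 1) (u e (val t))).
  by rewrite /bridge_cov /beta -/(u e (val v)) u1E; ring.
have h3 : `|bridge_cov e (val v) (val s) - bridge_cov e (val v) (val t)| <= z / 3 * (e ^+ 2 * p e).
  rewrite bE; apply: (le_trans (ler_normB _ _)); rewrite normrM.
  have := lerD (ltW h1) (ler_pM (normr_ge0 _) (normr_ge0 _) (hb _ (i01 v)) (ltW h2)).
  by move/le_trans; apply; rewrite le_eqVlt; apply/orP; left; apply/eqP; field.
have h4 : `|bridge_cov e (val v) (val s) / (e ^+ 2 * p e) - bridge_cov e (val v) (val t) / (e ^+ 2 * p e)| <= z / 3.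
  by rewrite -mulrBl normrM normfV (gtr0_norm v0) ler_pdivrMr.
move: cs ct h4; set b1 := bridge_cov e (val v) (val s) / _; set b2 := bridge_cov e (val v) (val t) / _ => cs ct h4.
rewrite (_ : bkY _ _ - bkY _ _ = (b1 - b2) - (b1 - bkY (val v) (val s)) + (b2 - bkY (val v) (val t))); last by ring.
by apply: (le_trans (ler_normD _ _)); apply: (le_trans (lerD (ler_normB _ _) (lexx _))); lra.
Unshelve. all: by end_near. Qed.

(** Symmetry passes to the limit from the covariances, as [phi] is not assumed to be symmetric. *)
Lemma bar_kY_sym (s t : I01 R) : bkY (val s) (val t) = bkY (val t) (val s).
Proof.
apply: (@le_eps_eq _ _ _ 2) => z z0.
have [e [e0 hc]] : exists e : R, 0 < e /\
  forall t s : R, 0 <= t <= 1 -> 0 <= s <= 1 -> `|bridge_cov e t s / (e ^+ 2 * p e) - bkY t s| <= z.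
  near (0 : R)^'+ => e; exists e; split; near: e; first exact: near0.
  exact: (usmall_bridge_cov z0).
have i01 (w : I01 R) : 0 <= val w <= 1 by rewrite I01_ge0 I01_le1.
have u0 (w : I01 R) := u_ge0 (ltW e0) (I01_ge0 w); have u1 : 0 <= u e 1 by rewrite u_ge0// ltW.
have h1 := hc _ _ (i01 s) (i01 t); have h2 := hc _ _ (i01 t) (i01 s).
have bs : bridge_cov e (val s) (val t) = bridge_cov e (val t) (val s).
  rewrite /bridge_cov (cond_cov_sym hX T_gt0 k_neq0 (leqnn n) (u0 s) (u0 t)).
  rewrite (cond_cov_sym hX T_gt0 k_neq0 (leqnn n) (u0 s) u1).
  by rewrite (cond_cov_sym hX T_gt0 k_neq0 (leqnn n) u1 (u0 t)); ring.
rewrite bs in h1; move: h1 h2; set b1 := _ / _ => h1 h2.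
rewrite (_ : bkY _ _ - bkY _ _ = (b1 - bkY (val t) (val s)) - (b1 - bkY (val s) (val t))); last by ring.
by apply: (le_trans (ler_normB _ _)); lra.
Unshelve. all: by end_near. Qed.

Lemma bar_kY_diag_le : exists M, forall t : I01 R, bkY (val t) (val t) <= M.
Proof.
have [MM hMM] := k_diag_bound.
have [e [e0 e1 hb hc]] : exists e : R, [/\ 0 < e, e <= 1, forall t : R, 0 <= t <= 1 -> `|beta k T n e t| <= 2 &
  forall t s : R, 0 <= t <= 1 -> 0 <= s <= 1 -> `|bridge_cov e t s / (e ^+ 2 * p e) - bkY t s| <= 1].
  near (0 : R)^'+ => e; exists e; split; near: e; first exact: near0.
  - exact: nbhs_right_le.
  - exact: beta_le2.
  - exact: (usmall_bridge_cov ltr01).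
have v0 : 0 < e ^+ 2 * p e by rewrite mulr_gt0 ?p_gt0 ?exprn_gt0.
exists (1 + (2 * MM + 2 * (2 * MM)) / (e ^+ 2 * p e)) => t.
have t01 : 0 <= val t <= 1 by rewrite I01_ge0 I01_le1.
have kb v v' : 0 <= v <= 1 -> 0 <= v' <= 1 -> `|kc n (u e v) (u e v')| <= 2 * MM.
  move=> v1 v'1; have uv := u_itv e0 e1 v1; have uv' := u_itv e0 e1 v'1.
  have a1 := hMM _ uv; have a2 := hMM _ uv'.
  have z1 : 0 <= u e v by apply: u_ge0; [exact: ltW|case/andP: v1].
  have z2 : 0 <= u e v' by apply: u_ge0; [exact: ltW|case/andP: v'1].
  by apply: (le_trans (cond_cov_bound hX T_gt0 k_neq0 (leqnn n) z1 z2)); lra.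
have u1E : u e 1 = T n + e by rewrite /u mulr1.
have bE : bridge_cov e (val t) (val t) = kc n (u e (val t)) (u e (val t)) -
  beta k T n e (val t) * kc n (u e 1) (u e (val t)).
  by rewrite /bridge_cov /beta -/(u e (val t)) u1E; ring.
have h1 : bridge_cov e (val t) (val t) <= 2 * MM + 2 * (2 * MM).
  rewrite bE; apply: (le_trans (ler_norm _)); apply: (le_trans (ler_normB _ _)); apply: lerD; first exact: kb.
  by rewrite normrM; apply: ler_pM => //; [exact: hb|exact: kb].
have h2 : bridge_cov e (val t) (val t) / (e ^+ 2 * p e) <= (2 * MM + 2 * (2 * MM)) / (e ^+ 2 * p e).
  by rewrite ler_pM2r// invr_gt0.
have := hc _ _ t01 t01; rewrite ler_norml => /andP[h3 _]; lra.
Unshelve. all: by end_near. Qed.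

Lemma bridge_LDP (Y : R -> Omega -> C01 R) :
  (forall (e : R) w t, 0 < e ->
     ev (Y e w) t = bridge k T n (fun v => X v : Omega -> R) x y e (val t) w) ->
  LDP P Y (fun e => e `^ (3 + alpha))
    (rkhs_rate bkY (fun t : I01 R => bar_m k T n x y (val t))).
Proof.
move=> YE; pose v (e : R) : R := e `^ (3 + alpha).
pose K (s t : I01 R) : R := bkY (val s) (val t).
pose m (t : I01 R) : R := bar_m k T n x y (val t).
have i01 (w : I01 R) : 0 <= val w <= 1 by rewrite I01_ge0 I01_le1.
have mE t : m t = x n + val t * (y - x n) by rewrite /m /bar_m bar_betaE.
have vE e : 0 < e -> v e = e ^+ 2 * p e.
  move=> e0; rewrite /v -powR_mulrn ?(ltW e0)// -powRD; last by apply/implyP => _; rewrite gt_eqF.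
  by congr (_ `^ _); ring.
have v_gt0 e : 0 < e -> 0 < v e by exact: powR_gt0.
have v_cvg0 : v e @[e --> 0^'+] --> 0 by apply: powR_cvg0; rewrite addr_gt0.
have [KB hKB] := bar_kY_diag_le.
have Zlaw e : 0 < e -> forall mu : seq (I01 R * R),
  exists s, has_law P (fun w => pairing mu (fun t => bridge_dev e t w)) 0 s.
  by move=> _ mu; exact: bridge_dev_law.
have Zcov eta : 0 < eta -> \forall e \near 0^'+, forall s t,
  `|cov_kernel P (bridge_dev e) s t - v e * K s t| <= eta * v e.
  move=> eta0; have [_ nz] := usmall_inv11; near=> e => s t.
  have e0 : 0 < e by near: e; exact: near0.
  have N0 : N e 1 1 != 0 by near: e.
  have hc : forall t s : R, 0 <= t <= 1 -> 0 <= s <= 1 -> `|bridge_cov e t s / (e ^+ 2 * p e) - bkY t s| <= eta.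
    by near: e; exact: (usmall_bridge_cov eta0).
  have := hc _ _ (i01 s) (i01 t); rewrite -vE// bridge_dev_cov// => h.
  have ve := v_gt0 e e0.
  rewrite (_ : _ - _ = (bridge_cov e (val s) (val t) / v e - K s t) * v e); last by field; rewrite gt_eqF.
  by rewrite normrM (gtr0_norm ve) ler_pM2r.
have quc := bar_kY_quc.
have Ksym s t : K s t = K t s by exact: bar_kY_sym.
(* The kernel distance is the sum of two row increments, so uniform continuity of the rows
   suffices. *)
have Kdist z : 0 < z -> exists2 r : R, 0 < r &
  forall s t : I01 R, `|val s - val t| < r -> K s s + K t t - 2 * K s t <= z.
  move=> z0; have z2 : 0 < z / 2 by rewrite divr_gt0.
  have [r r0 hr] := quc _ z2; exists r => // s t st.
  have h1 := hr s t s st; have h2 := hr s t t st; rewrite -!/(K _ _) (Ksym t s) in h1 h2.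
  by move: h1 h2; rewrite !ler_norml => /andP[_ h1] /andP[h2 _]; lra.
have Kpos := kernel_pos Zlaw v_gt0 Zcov.
have -> : rkhs_rate bkY (fun t : I01 R => bar_m k T n x y (val t)) = ldp_rate K m.
  by apply/funext => h; exact: (rkhs_rateE Ksym Kpos hKB quc).
apply: (gaussian_LDP (Z := bridge_dev) (me := fun e t => bridge_mean e (val t)) (KB := KB)) => //.
- exact: bridge_dev_small.
- move=> t z z0; have q1 : 0 < `|y - x n| + 1 by rewrite ltr_wpDl.
  exists (z / (`|y - x n| + 1)); first exact: divr_gt0.
  move=> s; rewrite ltr_pdivlMr// => st; rewrite !mE opprD addrACA subrr add0r -mulrBl normrM.
  by apply: le_lt_trans st; rewrite ler_wpM2l// lerDl.
- by move=> e w t e0 z z0; exact: bridge_dev_cont.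
- move=> eta eta0; apply: filterS (usmall_bridge_mean eta0) => e he t.
  by rewrite mE; exact: (he (val t) (val t)).
- by move=> e w t e0; rewrite YE// bridge_split.
Unshelve. all: by end_near. Qed.
End expansions.

Theorem theorem4p13 (R : realType) (disp : measure_display)
    (Omega : measurableType disp) (P : probability Omega R)
    (X : R -> {RV P >-> R}) (k : R -> R -> R)
    (n : nat) (T x : nat -> R) (y : R)
    (alpha a b : R) (phi : R -> R -> R) (c dd : R -> R) (psi : R -> R -> R)
    (R1 : R -> R -> R -> R) (R2 : R -> R -> R -> R)
    (Y : R -> Omega -> C01 R) :
  continuous_centered_gaussian_process X k ->
  (1 <= n)%N ->
  0 < T 1%N ->
  (forall j : nat, (1 <= j < n)%N -> T j < T j.+1) ->
  (forall j : nat, (1 <= j <= n)%N -> cond_cov k T j.-1 (T j) (T j) != 0) ->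
  bar_k k T n 1 1 != 0 ->
  0 < alpha -> alpha <= 1 ->
  (* (i) *)
  (forall e t s : R, 0 < e -> t \in `[0, 1] -> s \in `[0, 1] ->
     covariance P (fun w => X (T n + e * t) w - X (T n) w)
                  (fun w => X (T n + e * s) w - X (T n) w) =
     (e ^+ 2 * (a ^+ 2 * t * s + b * (t ^+ 2 * s + t * s ^+ 2) * e
                + phi t s * e `^ (1 + alpha) + R1 e t s))%:E) ->
  ereal_sup [set (`|R1 e ts.1 ts.2| / e `^ (1 + alpha))%:E
               | ts in [set ts : R * R | ts.1 \in `[0, 1] /\ ts.2 \in `[0, 1]]]
    @[e --> 0^'+] --> 0%E ->
  (* (ii) *)
  (forall S e t : R, 0 < S -> 0 < e -> t \in `[0, 1] ->
     k (T n + e * t) S - k (T n) S =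
     e * (c S * t + dd S * t ^+ 2 * e
          + psi t S * e `^ (1 + alpha) + R2 e t S)) ->
  (forall S : R, 0 < S ->
     ereal_sup [set (`|R2 e t S| / e `^ (1 + alpha))%:E
                  | t in [set t : R | t \in `[0, 1]]]
       @[e --> 0^'+] --> 0%E) ->
  (forall (e : R) (w : Omega) (t : I01 R), 0 < e ->
     ev (Y e w) t = bridge k T n (fun u => X u : Omega -> R) x y e (val t) w) ->
  LDP P Y (fun e => e `^ (3 + alpha))
    (rkhs_rate (bar_kY k T n alpha b phi c dd psi)
               (fun t : I01 R => bar_m k T n x y (val t))).
Proof.
move=> hX n1 T1 Tinc k_neq0 bk_neq0 a0 a1 hi hR1 hii hR2 YE.
have T_gt0 j : (1 <= j <= n)%N -> 0 < T j.
  elim: j => // -[//|j] IH /andP[_ jn].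
  by apply: lt_trans (IH _) (Tinc _ _) => //=; exact: ltnW.
exact: (bridge_LDP hX n1 T_gt0 k_neq0 bk_neq0 a0 a1 hi hR1 hii hR2 YE).
Qed.
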